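(* Suppose that assumptions (H1)-(H5) (listed in the context) hold, and let $u^*\in\mathcal U$ be an optimal control. Then there exists a reference probability $\lambda^*\in\Lambda^{u^*}$ such that $$\inf_{u\in\mathcal U}\int_\Gamma \bar y^u_\gamma(0)\,\lambda^*(d\gamma)\ \ge\ 0 .$$
   Context: Probabilistic setting. $N>0$ is a fixed integer, $\mathcal T=\{0,\dots,N-1\}$. On a complete probability space $(\Omega,\mathcal F,\mathbb P)$, $B(1),\dots,B(N)$ are independent $\mathbb R^d$-valued random variables (components $B^i(k)$) with $\mathbb E[|B(k)|^p]\le C(p)<\infty$ for some $p\ge2$. $\mathcal F_0=\{\emptyset,\Omega\}$, $\mathcal F_k=\sigma(B(1),\dots,B(k))$. $U_0,\dots,U_{N-1}$ are nonempty convex subsets of $\mathbb R^m$. An admissible control is $u=\{u(k)\}_{k\in\mathcal T}$ with $u(k)$ $\mathcal F_k$-measurable, $U_k$-valued, and $\mathbb E[\sum_{k=0}^{N-1}|u(k)|^q]<\infty$ with some (fixed) $q>2$; $\mathcal U$ is the set of admissible controls. Model uncertainty. $\Gamma$ is a locally compact Polish space with distance $\widetilde d$ and Borel $\sigma$-field $\mathcal B(\Gamma)$; $\Lambda$ is a set of probability measures on $(\Gamma,\mathcal B(\Gamma))$. For each $\gamma\in\Gamma$, $k\in\mathcal T$: $b_\gamma(k,\cdot,\cdot):\mathbb R^n\times U_k\to\mathbb R^n$, $\sigma_\gamma(k,\cdot,\cdot):\mathbb R^n\times U_k\to\mathbb R^{n\times d}$ (columns $\sigma^i_\gamma$), $f_\gamma(k,\cdot,\cdot):\mathbb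 R^n\times U_k\to\mathbb R$, $\phi_\gamma:\mathbb R^n\to\mathbb R$ are given continuous functions. $\partial_x,\partial_u$ denote Jacobians (row vectors for scalar functions). State and cost. For $u\in\mathcal U$ and fixed $x_0\in\mathbb R^n$: $x_\gamma(0)=x_0$ and $$x_\gamma(k+1)=b_\gamma(k,x_\gamma(k),u(k))+\sigma_\gamma(k,x_\gamma(k),u(k))B(k+1),\quad k\in\mathcal T;$$ $y_\gamma(0)=\mathbb E\big[\sum_{k=0}^{N-1}f_\gamma(k,x_\gamma(k),u(k))+\phi_\gamma(x_\gamma(N))\big]$ and $J(u)=\sup_{\lambda\in\Lambda}\int_\Gamma y_\gamma(0)\,\lambda(d\gamma)$. A control $u^*\in\mathcal U$ is optimal if it minimizes $J$ over $\mathcal U$. Let $x^*_\gamma$, $y^*_\gamma(0)$ be the state and value associated with $u^*$. Assumptions. A modulus of continuity is a continuous, semiadditive (i.e. subadditive), nondecreasing $\psi:[0,\infty)\to[0,\infty)$ with $\psi(0)=0$. (H1) There is a constant $L>0$ such that for each $k\in\mathcal T$, $\gamma\in\Gamma$: $|b_\gamma(k,0,0)|+|\sigma_\gamma(k,0,0)|\le L$, and $b_\gamma(k,x,u),\sigma_\gamma(k,x,u)$ are continuously differentiable in $(x,u)$ with derivatives bounded by $L$. (H2) For each $k\in\mathcal T$, $\gamma\in\Gamma$: $f_\gamma(k,x,u),\phi_\gamma(x)$ are continuously differentiable in $(x,u)$ with derivatives bounded by $L(1+|x|+|u|)$, and $|f_\gamma(k,0,0)|\le L$. (H3) There is a modulus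 of continuity $\psi$ with $|\chi_\gamma(k,x,u)-\chi_\gamma(k,x',u')|\le\psi(|x-x'|+|u-u'|)$ for all $k\in\mathcal T$, $x,x'\in\mathbb R^n$, $u,u'\in U_k$, $\gamma\in\Gamma$, where $\chi_\gamma$ is any of the derivatives in (H1), (H2). (H4) For each $R>0$ there is a modulus of continuity $\psi_R$ with $|\chi_\gamma(k,x,u)-\chi_{\gamma'}(k,x,u)|\le\psi_R(\widetilde d(\gamma,\gamma'))$ for all $k\in\mathcal T$, $|x|,|u|\le R$, $\gamma,\gamma'\in\Gamma$, where $\chi_\gamma$ is any of $b_\gamma,\sigma_\gamma,f_\gamma,\phi_\gamma$ and their derivatives in $(x,u)$. (H5) $\Lambda$ is a weakly compact and convex set of probability measures on $(\Gamma,\mathcal B(\Gamma))$. Variational objects. A superscript $*$ on a coefficient denotes evaluation along $u^*$: $b^*_\gamma(k)=b_\gamma(k,x^*_\gamma(k),u^*(k))$, $\phi^*_\gamma(N)=\phi_\gamma(x^*_\gamma(N))$, etc., similarly for derivatives. For $u\in\mathcal U$, $\bar x_\gamma$ solves $\bar x_\gamma(0)=0$, $$\bar x_\gamma(k+1)=\partial_xb^*_\gamma(k)\bar x_\gamma(k)+\partial_ub^*_\gamma(k)(u(k)-u^*(k))+\sum_{i=1}^d\{\partial_x\sigma^{*,i}_\gamma(k)\bar x_\gamma(k)+\partial_u\sigma^{*,i}_\gamma(k)(u(k)-u^*(k))\}B^i(k+1),$$ for $k\in\mathcal T$, and $$\bar y^u_\gamma(0)=\mathbb E\Big[\sum_{k=0}^{N-1}\big[\partial_xf^*_\gamma(k)\bar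 x_\gamma(k)+\partial_uf^*_\gamma(k)(u(k)-u^*(k))\big]+\partial_x\phi^*_\gamma(N)\bar x_\gamma(N)\Big].$$ $\Lambda^{u^*}=\{\lambda\in\Lambda: J(u^* )=\int_\Gamma y^*_\gamma(0)\lambda(d\gamma)\}$.
   Formalization: The formal theorem additionally assumes that |φ_γ(0)| is bounded uniformly in γ (the analogue of |f_γ(k,0,0)| ≤ L in (H2)), without which Λ^{u*} can be empty; Λ is taken nonempty, and bounds at u = 0 are read at a point of U_k when 0 is not in U_k. *)

(* Defs.v *)
From HB Require Import structures.
From mathcomp Require Import all_boot all_order all_algebra.
From mathcomp Require Import all_classical all_reals all_analysis.

Set Implicit Arguments.
Unset Strict Implicit.
Unset Printing Implicit Defensive.

Import Order.TTheory GRing.Theory Num.Theory.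
Import numFieldNormedType.Exports.

Local Open Scope classical_set_scope.
Local Open Scope ring_scope.

(* Euclidean norm of a vector, Frobenius norm of a matrix. The norm `|A| that
   the library puts on matrices is the max norm. *)
Definition enorm (R : realType) (p q : nat) (A : 'M[R]_(p, q)) : R :=
  Num.sqrt (\sum_i \sum_j A i j ^+ 2).

(* The library requires measurable spaces to be pointed; a space that carries
   a probability measure is nonempty. *)
#[short(type="pmetricType")]
HB.structure Definition PointedMetric (K : numDomainType) :=
  { M of Metric K M & isPointed M }.

Definition borel_sets (T : topologicalType) : set (set T) := <<s @open T >>.

Definition borelType (T : topologicalType) : Type := g_sigma_algebraType (@open T).

Definition separable (T : topologicalType) : Prop :=
  exists2 A : set T, countable A & dense A.

(* The complete metric D need not be the distance that T may already carry. *)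
Definition completely_metrizable (R : realType) (T : topologicalType) : Prop :=
  exists D : T -> T -> R,
    [/\ [/\ forall x y, D x y = 0 <-> x = y,
            forall x y, D x y = D y x &
            forall x y z, D x z <= D x y + D y z],
        forall (x : T) (A : set T),
          nbhs x A <-> exists2 e : R, 0 < e & [set y | D x y < e] `<=` A &
        forall v : nat -> T,
          (forall e : R, 0 < e -> exists K : nat, forall i j : nat,
             (K <= i)%N -> (K <= j)%N -> D (v i) (v j) < e) ->
          exists x : T, v @ \oo --> x].

Definition polish (R : realType) (T : topologicalType) : Prop :=
  separable T /\ completely_metrizable R T.

Definition modulus (R : realType) (psi : R -> R) : Prop :=
  [/\ {within `[0, +oo[, continuous psi},
      forall r s, 0 <= r -> 0 <= s -> psi (r + s) <= psi r + psi s,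
      forall r s, 0 <= r -> r <= s -> psi r <= psi s,
      forall r, 0 <= r -> 0 <= psi r &
      psi 0 = 0].

Section coefficients.
Context (R : realType) (Gam : Type) (n m d : nat).

(* The coefficients are total functions of the control variable, but only
   their values on U_k are ever constrained or used. As U_k may have empty
   interior, the Jacobians are part of the data; they are tied to the
   coefficients by C1_on. *)
Record coefs := Coefs {
  cb : Gam -> nat -> 'cV[R]_n -> 'cV[R]_m -> 'cV[R]_n ;
  csigma : Gam -> nat -> 'cV[R]_n -> 'cV[R]_m -> 'M[R]_(n, d) ;
  cf : Gam -> nat -> 'cV[R]_n -> 'cV[R]_m -> R ;
  cphi : Gam -> 'cV[R]_n -> R ;
  cb_x : Gam -> nat -> 'cV[R]_n -> 'cV[R]_m -> 'M[R]_n ;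
  cb_u : Gam -> nat -> 'cV[R]_n -> 'cV[R]_m -> 'M[R]_(n, m) ;
  csigma_x : Gam -> nat -> 'I_d -> 'cV[R]_n -> 'cV[R]_m -> 'M[R]_n ;
  csigma_u : Gam -> nat -> 'I_d -> 'cV[R]_n -> 'cV[R]_m -> 'M[R]_(n, m) ;
  cf_x : Gam -> nat -> 'cV[R]_n -> 'cV[R]_m -> 'rV[R]_n ;
  cf_u : Gam -> nat -> 'cV[R]_n -> 'cV[R]_m -> 'rV[R]_m ;
  cphi_x : Gam -> 'cV[R]_n -> 'rV[R]_n }.

(* Differentiability at (x, u) relative to the set R^n x V. *)
Definition is_jacobian_on (p : nat) (V : set 'cV[R]_m)
    (g : 'cV[R]_n -> 'cV[R]_m -> 'cV[R]_p) (x : 'cV[R]_n) (u : 'cV[R]_m)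
    (gx : 'M[R]_(p, n)) (gu : 'M[R]_(p, m)) : Prop :=
  forall e : R, 0 < e -> exists2 r : R, 0 < r &
    forall x' u', V u' -> enorm (x' - x) + enorm (u' - u) < r ->
      enorm (g x' u' - g x u - (gx *m (x' - x) + gu *m (u' - u)))
        <= e * (enorm (x' - x) + enorm (u' - u)).

Definition C1_on (p : nat) (V : set 'cV[R]_m)
    (g : 'cV[R]_n -> 'cV[R]_m -> 'cV[R]_p)
    (gx : 'cV[R]_n -> 'cV[R]_m -> 'M[R]_(p, n))
    (gu : 'cV[R]_n -> 'cV[R]_m -> 'M[R]_(p, m)) : Prop :=
  let RnV := [set z : 'cV[R]_n * 'cV[R]_m | V z.2] in
  [/\ forall x u, V u -> is_jacobian_on V g x u (gx x u) (gu x u),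
      {within RnV, continuous (fun z => gx z.1 z.2)} &
      {within RnV, continuous (fun z => gu z.1 z.2)}].

Variables (N : nat) (U : nat -> set 'cV[R]_m) (c : coefs).

(* The bound |b(k,0,0)| + |sigma(k,0,0)| <= L presupposes 0 \in U_k. If
   0 \notin U_k, it is read at some point of U_k. *)
Definition ref_control (a : nat -> 'cV[R]_m) : Prop :=
  forall k, (k < N)%N -> U k (a k) /\ (U k 0 -> a k = 0).

Definition H1 (a : nat -> 'cV[R]_m) (L : R) : Prop :=
  forall g k, (k < N)%N ->
  [/\ enorm (cb c g k 0 (a k)) + enorm (csigma c g k 0 (a k)) <= L,
      C1_on (U k) (cb c g k) (cb_x c g k) (cb_u c g k),
      forall i, C1_on (U k) (fun x u => col i (csigma c g k x u))
                  (csigma_x c g k i) (csigma_u c g k i),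
      forall x u, U k u -> enorm (cb_x c g k x u) <= L /\
                           enorm (cb_u c g k x u) <= L &
      forall i x u, U k u -> enorm (csigma_x c g k i x u) <= L /\
                             enorm (csigma_u c g k i x u) <= L].

Definition H2 (a : nat -> 'cV[R]_m) (L : R) : Prop :=
  (forall g k, (k < N)%N ->
   [/\ `|cf c g k 0 (a k)| <= L,
       C1_on (U k) (fun x u => (cf c g k x u)%:M) (cf_x c g k) (cf_u c g k) &
       forall x u, U k u ->
         enorm (cf_x c g k x u) <= L * (1 + enorm x + enorm u) /\
         enorm (cf_u c g k x u) <= L * (1 + enorm x + enorm u)]) /\
  (forall g,
   [/\ forall x, is_diff x (cphi c g) (fun h => (cphi_x c g x *m h) 0 0),
       continuous (cphi_x c g) &
       forall x, enorm (cphi_x c g x) <= L * (1 + enorm x)]).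

Definition unif_cont_on (p q : nat) (V : set 'cV[R]_m) (psi : R -> R)
    (chi : 'cV[R]_n -> 'cV[R]_m -> 'M[R]_(p, q)) : Prop :=
  forall x x' u u', V u -> V u' ->
    enorm (chi x u - chi x' u') <= psi (enorm (x - x') + enorm (u - u')).

Definition H3 : Prop := exists2 psi : R -> R, modulus psi &
  (forall g k, (k < N)%N ->
   [/\ unif_cont_on (U k) psi (cb_x c g k),
       unif_cont_on (U k) psi (cb_u c g k),
       forall i, unif_cont_on (U k) psi (csigma_x c g k i) /\
                 unif_cont_on (U k) psi (csigma_u c g k i),
       unif_cont_on (U k) psi (cf_x c g k) &
       unif_cont_on (U k) psi (cf_u c g k)]) /\
  (forall g x x', enorm (cphi_x c g x - cphi_x c g x') <= psi (enorm (x - x'))).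

Definition close_on (p q : nat) (V : set 'cV[R]_m) (r e : R)
    (chi chi' : 'cV[R]_n -> 'cV[R]_m -> 'M[R]_(p, q)) : Prop :=
  forall x u, V u -> enorm x <= r -> enorm u <= r ->
    enorm (chi x u - chi' x u) <= e.

Definition H4 (dist : Gam -> Gam -> R) : Prop :=
  forall r : R, 0 < r -> exists2 psi : R -> R, modulus psi &
  forall g g', let e := psi (dist g g') in
  (forall k, (k < N)%N ->
   [/\ close_on (U k) r e (cb c g k) (cb c g' k) /\
       close_on (U k) r e (csigma c g k) (csigma c g' k),
       close_on (U k) r e (fun x u => (cf c g k x u)%:M : 'M[R]_1)
         (fun x u => (cf c g' k x u)%:M),
       close_on (U k) r e (cb_x c g k) (cb_x c g' k) /\
       close_on (U k) r e (cb_u c g k) (cb_u c g' k),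
       forall i, close_on (U k) r e (csigma_x c g k i) (csigma_x c g' k i) /\
                 close_on (U k) r e (csigma_u c g k i) (csigma_u c g' k i) &
       close_on (U k) r e (cf_x c g k) (cf_x c g' k) /\
       close_on (U k) r e (cf_u c g k) (cf_u c g' k)]) /\
  (forall x, enorm x <= r -> `|cphi c g x - cphi c g' x| <= e /\
                             enorm (cphi_x c g x - cphi_x c g' x) <= e).

End coefficients.

Section weak_topology_on_probabilities.
Context (R : realType) (Gam : pmetricType R).

Definition prob := probability (borelType Gam) R.

Definition Cb : Type :=
  { h : Gam -> R | continuous h /\ exists M : R, forall x, `|h x| <= M }.

Definition integrate_Cb (l : prob) : {ptws Cb -> R^o} :=
  fun h => \int[l]_x (sval h x).

Definition weakly_compact (Lam : set prob) : Prop :=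
  compact (Lam : set (initial_topology integrate_Cb)).

(* A measure of the library is a function on all sets, whose values on
   non-measurable sets are irrelevant; hence the equality on measurable sets. *)
Definition convex_probs (Lam : set prob) : Prop :=
  forall l1 l2 (t : R), Lam l1 -> Lam l2 -> 0 <= t <= 1 ->
    exists2 l, Lam l & forall A, measurable A ->
      l A = (t%:E * l1 A + (1 - t)%:E * l2 A)%E.

Definition H5 (Lam : set prob) : Prop := weakly_compact Lam /\ convex_probs Lam.

End weak_topology_on_probabilities.

Section control_problem.
Context (R : realType) (disp : measure_display) (Omega : measurableType disp).
Context (P : probability Omega R) (Gam : pmetricType R) (n m d N : nat).

Definition sigma_of (T : topologicalType) (X : Omega -> T) : set (set Omega) :=
  preimage_set_system setT X (@borel_sets T).

(* The noise is B 1, ..., B N; the other values of B are irrelevant. *)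
Variable B : nat -> Omega -> 'cV[R]_d.

Definition random_noise : Prop :=
  forall k, (1 <= k <= N)%N -> sigma_of (B k) `<=` measurable.

Definition independent_noise : Prop :=
  forall A : nat -> set 'cV[R]_d,
    (forall k, (1 <= k <= N)%N -> borel_sets (A k)) ->
    fine (P (\bigcap_(k in [set k | (1 <= k <= N)%N]) (B k @^-1` A k))) =
    \prod_(1 <= k < N.+1) fine (P (B k @^-1` A k)).

Definition bounded_moments (p : R) : Prop :=
  exists C : R, forall k, (1 <= k <= N)%N ->
    ('E_P[(fun w => enorm (B k w) `^ p)%R] <= C%:E)%E.

Definition filtration (k : nat) : set (set Omega) :=
  <<s \bigcup_(j in [set j | (1 <= j <= k)%N]) sigma_of (B j) >>.

Definition control := nat -> Omega -> 'cV[R]_m.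

Definition admissible (U : nat -> set 'cV[R]_m) (q : R) (u : control) : Prop :=
  [/\ forall k, (k < N)%N -> sigma_of (u k) `<=` filtration k,
      forall k w, (k < N)%N -> U k (u k w) &
      ('E_P[(fun w => \sum_(0 <= k < N) enorm (u k w) `^ q)%R] < +oo)%E].

Variables (c : coefs R Gam n m d) (x0 : 'cV[R]_n).

Fixpoint state (u : control) (g : Gam) (k : nat) (w : Omega) : 'cV[R]_n :=
  match k with
  | 0%N => x0
  | j.+1 => cb c g j (state u g j w) (u j w)
            + csigma c g j (state u g j w) (u j w) *m B j.+1 w
  end.

Definition y0 (u : control) (g : Gam) : \bar R :=
  'E_P[fun w => \sum_(0 <= k < N) cf c g k (state u g k w) (u k w)
                + cphi c g (state u g N w)].

Definition J (Lam : set (prob Gam)) (u : control) : \bar R :=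
  ereal_sup [set (\int[l]_g y0 u g)%E | l in Lam].

Definition optimal (Lam : set (prob Gam)) (U : nat -> set 'cV[R]_m) (q : R)
    (us : control) : Prop :=
  admissible U q us /\ forall u, admissible U q u -> (J Lam us <= J Lam u)%E.

Definition Lambda_opt (Lam : set (prob Gam)) (us : control) : set (prob Gam) :=
  [set l | Lam l /\ J Lam us = (\int[l]_g y0 us g)%E].

Fixpoint xbar (us u : control) (g : Gam) (k : nat) (w : Omega) : 'cV[R]_n :=
  match k with
  | 0%N => 0
  | j.+1 =>
      let x := state us g j w in
      let z := xbar us u g j w in
      let v := u j w - us j w in
      cb_x c g j x (us j w) *m z + cb_u c g j x (us j w) *m v
      + \sum_(i < d) B j.+1 w i 0 *:
          (csigma_x c g j i x (us j w) *m z + csigma_u c g j i x (us j w) *m v)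
  end.

Definition ybar0 (us u : control) (g : Gam) : \bar R :=
  'E_P[fun w =>
    \sum_(0 <= k < N)
      (cf_x c g k (state us g k w) (us k w) *m xbar us u g k w
       + cf_u c g k (state us g k w) (us k w) *m (u k w - us k w)) 0 0
    + (cphi_x c g (state us g N w) *m xbar us u g N w) 0 0].

End control_problem.

(* Main.v *)
Require Import Defs.
From HB Require Import structures.
From mathcomp Require Import all_boot all_order all_algebra.
From mathcomp Require Import all_classical all_reals all_analysis.
From mathcomp Require Import measurable_realfun measurable_fun_approximation.
From mathcomp Require Import ring lra.

Set Implicit Arguments.
Unset Strict Implicit.
Unset Printing Implicit Defensive.

Import Order.TTheory GRing.Theory Num.Theory.
Import numFieldNormedType.Exports.

Local Open Scope classical_set_scope.
Local Open Scope ring_scope.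

(** Write y_g(u) for the expected cost of a control u in the model g and
    D_g(u) for its derivative at us in the direction u - us. The theorem is a
    Danskin-type first-order condition: J(u) is the supremum over l in Lam of
    the integral of y_g(u), an affine function of l; the measures that attain
    it at u = us form a compact convex set, and optimality of us forces, for
    each direction, a measure of this set under which the derivative is
    nonnegative. A minimax theorem then provides one measure for all
    directions.

    The abstract part is worst_case_first_order. It asks of the model three
    things: y_g(u) and D_g(u) are bounded and continuous in g, so that their
    integrals are continuous for the weak topology; D is affine in u; and the
    expansion y_g(us + e (u - us)) = y_g(us) + e D_g(u) + o(e) holds uniformly
    in g. Given u and a small e, a measure that almost maximises the cost of
    us + e (u - us) is almost a maximiser for us and almost makes the
    derivative nonnegative (directional_witness); weak compactness of Lam
    gives an exact one. The exchange of the quantifiers over u and over the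
    measure is fan_minimax.

    The three properties are obtained outcome by outcome. At a fixed outcome
    the dynamics is a finite recursion whose step has Jacobians bounded by L
    times noise_weight of the noise and with modulus psi times the same
    weight. The mean value inequality on the convex sets U_k
    (mean_value_jacobian) then bounds the state, its increments, and the
    distance from their quotients to xbar by solutions of explicit recursions
    (dominator, defect_bound) in which g does not occur; see enorm_state,
    state_taylor and cost_taylor. The same inequalities show that the cost and
    its derivative at a fixed outcome are continuous in g (cost_cvg,
    cost_derivative_cvg). Dominated convergence transfers all this to
    expectations.

    What makes domination possible with only two moments is independence: the
    bound at time k is a function of the past, so multiplying it by the next
    noise keeps it square integrable (filtration_indep, dominator_L2). Costs
    grow quadratically, so square integrability of the bounds is exactly what
    their expectations need. *)

(** * The Euclidean norm *)

Section euclidean_norm.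
Context {R : realType}.
Implicit Types p q r : nat.

(** The sum of the squares (A b_i - C a_i)^2, where A is the sum of the a_i^2
    and C that of the a_i b_i, equals A times the difference of the two sides.
    *)
Lemma cauchy_schwarz_sum (I : finType) (a b : I -> R) :
  (\sum_i a i * b i) ^+ 2 <= (\sum_i a i ^+ 2) * (\sum_i b i ^+ 2).
Proof.
set A := \sum_i a i ^+ 2; set C := \sum_i a i * b i; set D := \sum_i b i ^+ 2.
have A0 : 0 <= A by apply: sumr_ge0 => i _; exact: sqr_ge0.
have : 0 <= \sum_i (A * b i - C * a i) ^+ 2.
  by apply: sumr_ge0 => i _; exact: sqr_ge0.
have -> : \sum_i (A * b i - C * a i) ^+ 2 = A * (A * D - C ^+ 2).
  transitivity (\sum_i (A ^+ 2 * b i ^+ 2 - 2 * A * C * (a i * b i)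
                        + C ^+ 2 * a i ^+ 2)).
    by apply: eq_bigr => i _; ring.
  rewrite big_split sumrB -!mulr_sumr -/A -/C -/D /=; ring.
have [A0'|] := eqVneq A 0.
  move=> _; suff -> : C = 0 by rewrite A0' mul0r expr0n.
  rewrite /C big1// => i _; suff -> : a i = 0 by rewrite mul0r.
  apply/eqP; rewrite -sqrf_eq0; apply/eqP.
  by apply: (psumr_eq0P _ A0') => // j _; exact: sqr_ge0.
by move=> An0; rewrite pmulr_rge0 ?subr_ge0// lt_def An0.
Qed.

Definition entries_sqsum p q (A : 'M[R]_(p, q)) : R :=
  \sum_(k : 'I_p * 'I_q) A k.1 k.2 ^+ 2.

Lemma enormE p q (A : 'M[R]_(p, q)) : enorm A = Num.sqrt (entries_sqsum A).
Proof. by rewrite /enorm pair_bigA. Qed.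

Lemma entries_sqsum_ge0 p q (A : 'M[R]_(p, q)) : 0 <= entries_sqsum A.
Proof. by apply: sumr_ge0 => i _; exact: sqr_ge0. Qed.

Lemma enorm_ge0 p q (A : 'M[R]_(p, q)) : 0 <= enorm A.
Proof. exact: sqrtr_ge0. Qed.

Lemma sqr_enorm p q (A : 'M[R]_(p, q)) : enorm A ^+ 2 = entries_sqsum A.
Proof. by rewrite enormE sqr_sqrtr// entries_sqsum_ge0. Qed.

Lemma enorm_le_sqr p q (A : 'M[R]_(p, q)) x :
  0 <= x -> entries_sqsum A <= x ^+ 2 -> enorm A <= x.
Proof. by move=> x0; rewrite -sqr_enorm ler_pXn2r// nnegrE enorm_ge0. Qed.

Lemma ler_enormD p q (A B : 'M[R]_(p, q)) :
  enorm (A + B) <= enorm A + enorm B.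
Proof.
apply: enorm_le_sqr; first by rewrite addr_ge0// enorm_ge0.
have -> : entries_sqsum (A + B) = entries_sqsum A + entries_sqsum B
    + 2 * \sum_(k : 'I_p * 'I_q) A k.1 k.2 * B k.1 k.2.
  rewrite /entries_sqsum mulr_sumr -!big_split; apply: eq_bigr => k _ /=.
  by rewrite mxE; ring.
suff : \sum_(k : 'I_p * 'I_q) A k.1 k.2 * B k.1 k.2 <= enorm A * enorm B.
  by rewrite sqrrD !sqr_enorm; lra.
apply: le_trans (ler_norm _) _.
rewrite -(@ler_pXn2r _ 2)// ?nnegrE ?mulr_ge0 ?enorm_ge0//.
by rewrite real_normK ?num_real// exprMn !sqr_enorm cauchy_schwarz_sum.
Qed.

Lemma enormZ p q x (A : 'M[R]_(p, q)) : enorm (x *: A) = `|x| * enorm A.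
Proof.
rewrite !enormE -sqrtr_sqr -sqrtrM ?sqr_ge0//; congr Num.sqrt.
by rewrite /entries_sqsum mulr_sumr; apply: eq_bigr => k _; rewrite mxE exprMn.
Qed.

Lemma enorm0 p q : enorm (0 : 'M[R]_(p, q)) = 0.
Proof. by rewrite -(scale0r 0) enormZ normr0 mul0r. Qed.

Lemma enormN p q (A : 'M[R]_(p, q)) : enorm (- A) = enorm A.
Proof. by rewrite -scaleN1r enormZ normrN1 mul1r. Qed.

Lemma ler_enormB p q (A B : 'M[R]_(p, q)) :
  enorm (A - B) <= enorm A + enorm B.
Proof. by apply: le_trans (ler_enormD _ _) _; rewrite enormN. Qed.

Lemma ler_enorm_sum p q I (s : seq I) (F : I -> 'M[R]_(p, q)) :
  enorm (\sum_(i <- s) F i) <= \sum_(i <- s) enorm (F i).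
Proof.
elim: s => [|i s ih]; first by rewrite !big_nil enorm0.
by rewrite !big_cons; apply: le_trans (ler_enormD _ _) _; rewrite lerD2l.
Qed.

Lemma ler_entry_enorm p q (A : 'M[R]_(p, q)) i j : `|A i j| <= enorm A.
Proof.
rewrite -(@ler_pXn2r _ 2)// ?nnegrE ?enorm_ge0// real_normK ?num_real//.
rewrite sqr_enorm /entries_sqsum (bigD1 (i, j))//= lerDl.
by apply: sumr_ge0 => k _; exact: sqr_ge0.
Qed.

Lemma enorm_le_sum_entries p q (A : 'M[R]_(p, q)) :
  enorm A <= \sum_(k : 'I_p * 'I_q) `|A k.1 k.2|.
Proof.
have {1}-> : A = \sum_(k : 'I_p * 'I_q) A k.1 k.2 *: delta_mx k.1 k.2.
  rewrite {1}(matrix_sum_delta A) pair_bigA.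
  by apply: eq_bigr => k _.
apply: le_trans (ler_enorm_sum _ _) _; apply: ler_sum => -[i j] _ /=.
rewrite enormZ ler_piMr//; apply: enorm_le_sqr => //.
rewrite /entries_sqsum (bigD1 (i, j))//= mxE !eqxx big1 ?addr0//.
move=> [i' j']; rewrite xpair_eqE mxE /= => /negbTE.
by move=> ->; rewrite expr0n.
Qed.

Lemma ler_enormM p q r (A : 'M[R]_(p, q)) (B : 'M[R]_(q, r)) :
  enorm (A *m B) <= enorm A * enorm B.
Proof.
apply: enorm_le_sqr; first by rewrite mulr_ge0 ?enorm_ge0.
rewrite exprMn !sqr_enorm /entries_sqsum.
rewrite -(pair_bigA _ (fun i j => (A *m B) i j ^+ 2)) /=.
rewrite -(pair_bigA _ (fun i j => A i j ^+ 2)) /=.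
rewrite -(pair_bigA _ (fun i j => B i j ^+ 2)) /=.
rewrite [X in _ <= _ * X]exchange_big mulr_suml; apply: ler_sum => i _.
rewrite mulr_sumr; apply: ler_sum => k _.
by rewrite mxE cauchy_schwarz_sum.
Qed.

Lemma enorm_scalar (x : R) : enorm (x%:M : 'M[R]_1) = `|x|.
Proof.
rewrite enormE /entries_sqsum -(pair_bigA _ (fun i j => x%:M i j ^+ 2)) /=.
by rewrite !big_ord1 mxE eqxx mulr1n sqrtr_sqr.
Qed.

Lemma ler_norm_enorm p q (A : 'M[R]_(p, q)) : `|A| <= enorm A.
Proof.
rewrite [`|A|]mx_normrE; apply: bigmax_le => [|i _]; first exact: enorm_ge0.
exact: ler_entry_enorm.
Qed.

End euclidean_norm.

(** * The mean value inequality on a convex set *)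

Section mean_value.
Context {R : realType}.

Lemma convex_set_segment m (V : set 'cV[R]_m) u u' t :
  convex_set V -> V u -> V u' -> 0 <= t <= 1 -> V (u + t *: (u' - u)).
Proof.
move=> cV Vu Vu' /andP[t0 t1].
have := cV u' u (Itv01 t0 t1); rewrite !inE => /(_ Vu' Vu).
suff -> : u + t *: (u' - u) = t *: u' + (1 - t) *: u by [].
by apply/matrixP => i j; rewrite !mxE; ring.
Qed.

(** Vector-valued maps have no mean value equality, so the bound is propagated
    in time instead: the set of the times at which phi has drifted from phi 0
    + s A by at most (M + e) s contains its supremum, and the local hypothesis
    pushes it further as long as it is below 1. At the end points only the
    times inside [0, 1] are looked at, which is all that a convex set with
    empty interior provides. *)
Lemma mean_value_path p (phi : R -> 'cV[R]_p) (A : 'cV[R]_p) (M : R) :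
  (forall t, 0 <= t <= 1 -> forall e, 0 < e -> exists2 r, 0 < r &
     forall s, 0 <= s <= 1 -> `|s - t| < r ->
       enorm (phi s - phi t - (s - t) *: A) <= (M + e) * `|s - t|) ->
  enorm (phi 1 - phi 0 - A) <= M.
Proof.
move=> loc; apply/ler_addgt0Pr => e e0.
pose S := [set s | 0 <= s <= 1 /\
  enorm (phi s - phi 0 - s *: A) <= (M + e) * s].
have S0 : S 0 by split; rewrite ?lexx ?ler01// subrr scale0r subrr enorm0 mulr0.
have ubS : ubound S 1 by move=> s [/andP[]].
have supS : has_sup S by split; [exists 0|exists 1].
have step s t : S s -> s <= t -> 0 <= t <= 1 ->
    enorm (phi t - phi s - (t - s) *: A) <= (M + e) * (t - s) -> S t.
  move=> [_ Ss] st t01 h; split => //.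
  have -> : phi t - phi 0 - t *: A =
     (phi t - phi s - (t - s) *: A) + (phi s - phi 0 - s *: A).
    rewrite scalerBl; apply/matrixP => i j; rewrite !mxE; ring.
  by apply: le_trans (ler_enormD _ _) _; lra.
set t := sup S.
have t0 : 0 <= t by exact: (sup_upper_bound supS).
have t1 : t <= 1 by apply: ge_sup => //; exists 0.
have t01 : 0 <= t <= 1 by rewrite t0.
have [r r0 rP] := loc t t01 e e0.
have St : S t.
  have [s Ss ts] := sup_adherent r0 supS; rewrite -/t in ts.
  have st : s <= t by exact: (sup_upper_bound supS).
  apply: (step s) => //.
  have -> : phi t - phi s - (t - s) *: A = - (phi s - phi t - (s - t) *: A).
    by apply/matrixP => i j; rewrite !mxE; ring.
  have := rP s Ss.1; rewrite enormN distrC ger0_norm ?subr_ge0//; apply.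
  by lra.
have [t1'|t1'] := eqVneq t 1.
  by move: St.2; rewrite t1' scale1r mulr1.
have {t1'}t1 : t < 1 by rewrite lt_neqAle t1'.
pose s := Num.min 1 (t + r / 2).
have ts : t < s by rewrite /s lt_min t1 /= ltrDl divr_gt0.
have sr : s - t < r.
  have : s <= t + r / 2 by rewrite /s ge_min lexx orbT.
  lra.
have s01 : 0 <= s <= 1 by rewrite (le_trans t0 (ltW ts)) /s ge_min lexx.
have : S s.
  apply: (step t) => //; first exact: ltW.
  by have := rP s s01; rewrite ger0_norm ?subr_ge0 ?(ltW ts)//; exact.
by move/(sup_upper_bound supS); rewrite -/t leNgt ts.
Qed.

Context {n m p : nat} (V : set 'cV[R]_m) (g : 'cV[R]_n -> 'cV[R]_m -> 'cV[R]_p)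
  (gx : 'cV[R]_n -> 'cV[R]_m -> 'M[R]_(p, n))
  (gu : 'cV[R]_n -> 'cV[R]_m -> 'M[R]_(p, m)).
Hypothesis V_convex : forall u u' t, V u -> V u' -> 0 <= t <= 1 ->
  V (u + t *: (u' - u)).
Hypothesis g_jacobian : forall x u, V u ->
  is_jacobian_on V g x u (gx x u) (gu x u).

(** Subtracting a constant linear map from the derivative along the segment
    covers both uses: A = C = 0 gives a Lipschitz bound, the Jacobians at (x,
    u) give a first-order remainder. *)
Lemma mean_value_jacobian x x' u u' (A : 'M[R]_(p, n)) (C : 'M[R]_(p, m)) M :
  V u -> V u' ->
  (forall t, 0 <= t <= 1 ->
    let y := x + t *: (x' - x) in let v := u + t *: (u' - u) in
    enorm ((gx y v - A) *m (x' - x) + (gu y v - C) *m (u' - u)) <= M) ->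
  enorm (g x' u' - g x u - (A *m (x' - x) + C *m (u' - u))) <= M.
Proof.
move=> Vu Vu' hM.
pose X t := x + t *: (x' - x); pose Y t := u + t *: (u' - u).
have := @mean_value_path p (fun t => g (X t) (Y t))
  (A *m (x' - x) + C *m (u' - u)) M.
rewrite /X /Y !scale1r !scale0r !addr0 !(addrC _ (_ - _)) !subrK; apply.
move=> t t01 e e0.
have VY s : 0 <= s <= 1 -> V (Y s) by exact: V_convex.
pose D := enorm (x' - x) + enorm (u' - u).
have D0 : 0 <= D by rewrite addr_ge0 ?enorm_ge0.
(* D may vanish, D + 1 does not *)
have D1 : 0 < D + 1 by rewrite ltr_pwDr.
have [r r0 rP] := g_jacobian (X t) (VY t t01) (divr_gt0 e0 D1).
exists (r / (D + 1)); first exact: divr_gt0.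
move=> s s01 str.
have Xst : X s - X t = (s - t) *: (x' - x).
  by rewrite /X scalerBl opprD addrACA subrr add0r.
have Yst : Y s - Y t = (s - t) *: (u' - u).
  by rewrite /Y scalerBl opprD addrACA subrr add0r.
have dst : enorm (X s - X t) + enorm (Y s - Y t) = `|s - t| * D.
  by rewrite Xst Yst !enormZ -mulrDr.
have := rP (X s) (Y s) (VY s s01); rewrite dst => h.
have {}h : `|s - t| * D < r.
  rewrite (le_lt_trans _ (_ : `|s - t| * (D + 1) < r))//.
    by rewrite ler_wpM2l// lerDl.
  by rewrite -ltr_pdivlMr.
have {rP}h := rP (X s) (Y s) (VY s s01) ltac:(by rewrite dst).
rewrite dst in h.
rewrite -/(X s) -/(Y s) -/(X t) -/(Y t).
set G := gx (X t) (Y t) in h *; set H := gu (X t) (Y t) in h *.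
have -> : g (X s) (Y s) - g (X t) (Y t) -
    (s - t) *: (A *m (x' - x) + C *m (u' - u)) =
  (g (X s) (Y s) - g (X t) (Y t) - (G *m (X s - X t) + H *m (Y s - Y t)))
  + (s - t) *: ((G - A) *m (x' - x) + (H - C) *m (u' - u)).
  rewrite Xst Yst -!scalemxAr (mulmxBl G) (mulmxBl H).
  by apply/matrixP => i j; rewrite !mxE; ring.
apply: le_trans (ler_enormD _ _) _.
rewrite enormZ mulrDl addrC lerD//.
  by rewrite mulrC ler_wpM2r//; exact: hM.
apply: le_trans h _.
have -> : e / (D + 1) * (`|s - t| * D) = e * `|s - t| * (D / (D + 1)) by ring.
rewrite ler_piMr//; first by rewrite mulr_ge0// ltW.
by rewrite ler_pdivrMr// mul1r lerDl.
Qed.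

Lemma jacobian_lipschitz x x' u u' K :
  V u -> V u' ->
  (forall t, 0 <= t <= 1 ->
    let y := x + t *: (x' - x) in let v := u + t *: (u' - u) in
    enorm (gx y v) <= K /\ enorm (gu y v) <= K) ->
  enorm (g x' u' - g x u) <= K * (enorm (x' - x) + enorm (u' - u)).
Proof.
move=> Vu Vu' hK.
have := @mean_value_jacobian x x' u u' 0 0 _ Vu Vu'.
rewrite !mul0mx addr0 subr0; apply => t t01.
have [hx hu] := hK t t01.
rewrite /= !subr0 mulrDr; apply: le_trans (ler_enormD _ _) _.
apply: lerD; apply: le_trans (ler_enormM _ _) _.
  by rewrite ler_wpM2r ?enorm_ge0.
by rewrite ler_wpM2r ?enorm_ge0.
Qed.

Lemma jacobian_taylor (w : R -> R) x x' u u' :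
  (forall r s, 0 <= r -> r <= s -> w r <= w s) ->
  unif_cont_on V w gx -> unif_cont_on V w gu -> V u -> V u' ->
  enorm (g x' u' - g x u - (gx x u *m (x' - x) + gu x u *m (u' - u)))
  <= w (enorm (x' - x) + enorm (u' - u)) * (enorm (x' - x) + enorm (u' - u)).
Proof.
move=> wnd wx wu Vu Vu'; apply: mean_value_jacobian => // t t01.
set y := x + _; set v := u + _; cbv zeta.
have Vv : V v by exact: V_convex.
have /andP[t0 t1] := t01.
have hw : w (enorm (y - x) + enorm (v - u)) <=
    w (enorm (x' - x) + enorm (u' - u)).
  apply: wnd; first by rewrite addr_ge0 ?enorm_ge0.
  rewrite /y /v !(addrC _ (t *: _)) !addrK !enormZ ger0_norm//.
  by rewrite -mulrDr ler_piMl// addr_ge0 ?enorm_ge0.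
rewrite mulrDr; apply: le_trans (ler_enormD _ _) _.
apply: lerD; apply: le_trans (ler_enormM _ _) _;
  rewrite ler_wpM2r ?enorm_ge0//.
  exact: le_trans (wx _ _ _ _ Vv Vu) hw.
exact: le_trans (wu _ _ _ _ Vv Vu) hw.
Qed.

End mean_value.

Lemma modulus_ge0 (R : realType) (psi : R -> R) r :
  modulus psi -> 0 <= r -> 0 <= psi r.
Proof. by move=> [_ _ _ + _]; exact. Qed.

Lemma modulus_nondecr (R : realType) (psi : R -> R) r s :
  modulus psi -> 0 <= r -> r <= s -> psi r <= psi s.
Proof. by move=> [_ _ + _ _]; exact. Qed.

(** Subadditivity bounds psi at an integer k by k psi 1. *)
Lemma modulus_linear_growth (R : realType) (psi : R -> R) r :
  modulus psi -> 0 <= r -> psi r <= psi 1 * (1 + r).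
Proof.
move=> [_ sub nd p0 _] r0.
have psin k : psi k.+1%:R <= k.+1%:R * psi 1.
  elim: k => [|k ih]; first by rewrite mul1r.
  rewrite -natr1 mulrDl mul1r; apply: le_trans (sub _ _ _ _) _ => //.
  exact: lerD.
have /andP[rl ru] := truncn_itv r0.
apply: le_trans (nd _ _ r0 (ltW ru)) _; apply: le_trans (psin _) _.
by rewrite mulrC ler_wpM2l ?p0// -natr1 addrC lerD2l.
Qed.

(** * One step of the dynamics *)

Section jacobian_algebra.
Context {R : realType} {n m p : nat} (V : set 'cV[R]_m).
Implicit Types g h : 'cV[R]_n -> 'cV[R]_m -> 'cV[R]_p.

Lemma is_jacobian_on0 x u :
  is_jacobian_on V (fun _ _ => 0 : 'cV[R]_p) x u (0 : 'M[R]_(p, n)) (0 : 'M[R]_(p, m)).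
Proof.
move=> e e0; exists 1 => // x' u' _ _.
by rewrite !mul0mx addr0 !subr0 enorm0 mulr_ge0 ?addr_ge0 ?enorm_ge0// ltW.
Qed.

Lemma is_jacobian_onD g h x u gx gu hx hu :
  is_jacobian_on V g x u gx gu -> is_jacobian_on V h x u hx hu ->
  is_jacobian_on V (fun y v => g y v + h y v) x u (gx + hx) (gu + hu).
Proof.
move=> gP hP e e0; have e20 : 0 < e / 2 by rewrite divr_gt0.
have [r1 r10 gr] := gP _ e20; have [r2 r20 hr] := hP _ e20.
exists (Num.min r1 r2); first by rewrite lt_min r10.
move=> x' u' Vu'; rewrite lt_min => /andP[/(gr x' u' Vu') {}gr /(hr x' u' Vu') {}hr].
set dx := x' - x in gr hr *; set du := u' - u in gr hr *.
have -> : g x' u' + h x' u' - (g x u + h x u)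
    - ((gx + hx) *m dx + (gu + hu) *m du) =
  (g x' u' - g x u - (gx *m dx + gu *m du)) +
  (h x' u' - h x u - (hx *m dx + hu *m du)).
  by rewrite !mulmxDl; apply/matrixP => i j; rewrite !mxE; ring.
apply: le_trans (ler_enormD _ _) _; lra.
Qed.

Lemma is_jacobian_onZ b g x u gx gu :
  is_jacobian_on V g x u gx gu ->
  is_jacobian_on V (fun y v => b *: g y v) x u (b *: gx) (b *: gu).
Proof.
move=> gP e e0; have b0 : 0 < `|b| + 1 by rewrite ltr_pwDr.
have [r r0 gr] := gP _ (divr_gt0 e0 b0).
exists r => // x' u' Vu' /(gr x' u' Vu') {}gr.
rewrite -!scalemxAl -scalerDr -!scalerBr enormZ.
apply: le_trans (ler_wpM2l (normr_ge0 _) gr) _.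
set s := enorm _ + _.
have -> : `|b| * (e / (`|b| + 1) * s) = (`|b| / (`|b| + 1)) * (e * s) by ring.
rewrite ler_piMl ?mulr_ge0 ?addr_ge0 ?enorm_ge0//; first exact: ltW.
by rewrite ler_pdivrMr// mul1r lerDl.
Qed.

Lemma is_jacobian_on_sum I (s : seq I) (g : I -> 'cV[R]_n -> 'cV[R]_m -> 'cV[R]_p)
    x u gx gu :
  (forall i, is_jacobian_on V (g i) x u (gx i) (gu i)) ->
  is_jacobian_on V (fun y v => \sum_(i <- s) g i y v) x u
    (\sum_(i <- s) gx i) (\sum_(i <- s) gu i).
Proof.
move=> gP; elim: s => [|i s ih].
  have := is_jacobian_on0 x u; rewrite !big_nil.
  by congr (is_jacobian_on V _ x u _ _); apply/funext => y; apply/funext => v;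
    rewrite big_nil.
have := is_jacobian_onD (gP i) ih; rewrite !big_cons.
by congr (is_jacobian_on V _ x u _ _); apply/funext => y; apply/funext => v;
  rewrite big_cons.
Qed.

End jacobian_algebra.

Section noisy_step.
Context {R : realType}.

Definition noise_weight d (beta : 'cV[R]_d) : R := 1 + \sum_i `|beta i 0|.

(** The form shared by the step, b + sigma beta, and by its two Jacobians,
    since sigma beta is the combination of the columns of sigma with
    coefficients beta_i. A bound common to the d + 1 terms is multiplied by
    noise_weight, which is why the latter is the only trace that the noise
    leaves in the estimates. *)
Definition noisy d p q (A : 'M[R]_(p, q)) (S : 'I_d -> 'M[R]_(p, q))
  (beta : 'cV[R]_d) : 'M[R]_(p, q) := A + \sum_i beta i 0 *: S i.

Lemma noise_weight_ge1 d (beta : 'cV[R]_d) : 1 <= noise_weight beta.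
Proof. by rewrite /noise_weight lerDl sumr_ge0. Qed.

Lemma noise_weight_ge0 d (beta : 'cV[R]_d) : 0 <= noise_weight beta.
Proof. exact: le_trans ler01 (noise_weight_ge1 _). Qed.

Lemma enorm_noisy d p q (A : 'M[R]_(p, q)) (S : 'I_d -> 'M[R]_(p, q)) beta K :
  enorm A <= K -> (forall i, enorm (S i) <= K) ->
  enorm (noisy A S beta) <= noise_weight beta * K.
Proof.
move=> AK SK; rewrite /noise_weight mulrDl mul1r.
apply: le_trans (ler_enormD _ _) _; rewrite lerD//.
apply: le_trans (ler_enorm_sum _ _) _; rewrite mulr_suml.
by apply: ler_sum => i _; rewrite enormZ ler_wpM2l.
Qed.

Lemma noisyB d p q (A A' : 'M[R]_(p, q)) (S S' : 'I_d -> 'M[R]_(p, q)) beta :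
  noisy A S beta - noisy A' S' beta = noisy (A - A') (fun i => S i - S' i) beta.
Proof.
rewrite /noisy opprD addrACA -sumrB; congr (_ + _); apply: eq_bigr => i _.
by rewrite scalerBr.
Qed.

Lemma mulmx_noisy d p (S : 'M[R]_(p, d)) (beta : 'cV[R]_d) :
  S *m beta = \sum_i beta i 0 *: col i S.
Proof.
apply/matrixP => i j; rewrite !mxE summxE; apply: eq_bigr => l _.
by rewrite !mxE (ord1 j) mulrC.
Qed.

Lemma enorm_col d p (S : 'M[R]_(p, d)) i : enorm (col i S) <= enorm S.
Proof.
apply: enorm_le_sqr; first exact: enorm_ge0.
rewrite sqr_enorm /entries_sqsum.
rewrite -(pair_bigA _ (fun k j => (col i S) k j ^+ 2)) /=.
rewrite -(pair_bigA _ (fun k j => S k j ^+ 2)) /=.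
apply: ler_sum => k _; rewrite big_ord1 mxE (bigD1 i)//= lerDl.
by apply: sumr_ge0 => j _; exact: sqr_ge0.
Qed.

Context {Gam : pmetricType R} {n m d : nat} (c : coefs R Gam n m d).

Definition step g k (beta : 'cV[R]_d) x u : 'cV[R]_n :=
  noisy (cb c g k x u) (fun i => col i (csigma c g k x u)) beta.
Definition step_x g k (beta : 'cV[R]_d) x u : 'M[R]_n :=
  noisy (cb_x c g k x u) (fun i => csigma_x c g k i x u) beta.
Definition step_u g k (beta : 'cV[R]_d) x u : 'M[R]_(n, m) :=
  noisy (cb_u c g k x u) (fun i => csigma_u c g k i x u) beta.

Lemma state_succ disp (Omega : measurableType disp) (B : nat -> Omega -> 'cV[R]_d)
    x0 u g k w :
  state B c x0 u g k.+1 w =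
  step g k (B k.+1 w) (state B c x0 u g k w) (u k w).
Proof. by rewrite /= mulmx_noisy. Qed.

Lemma xbar_succ disp (Omega : measurableType disp) (B : nat -> Omega -> 'cV[R]_d)
    x0 us u g k w (x := state B c x0 us g k w) :
  xbar B c x0 us u g k.+1 w =
  step_x g k (B k.+1 w) x (us k w) *m xbar B c x0 us u g k w +
  step_u g k (B k.+1 w) x (us k w) *m (u k w - us k w).
Proof.
rewrite /= -/x /step_x /step_u /noisy !mulmxDl addrACA; congr (_ + _).
rewrite !mulmx_suml -big_split; apply: eq_bigr => i _ /=.
by rewrite scalerDr !scalemxAl.
Qed.

Context (N : nat) (U : nat -> set 'cV[R]_m) (a : nat -> 'cV[R]_m) (L : R).
Hypothesis h1 : H1 N U c a L.

Section at_time.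
Variables (g : Gam) (k : nat) (beta : 'cV[R]_d).
Hypothesis kN : (k < N)%N.

Lemma step_jacobian x u : U k u ->
  is_jacobian_on (U k) (step g k beta) x u
    (step_x g k beta x u) (step_u g k beta x u).
Proof.
move=> Uu; have [_ [bJ _ _] sJ _ _] := h1 g kN.
apply: is_jacobian_onD; first exact: bJ.
apply: is_jacobian_on_sum => i; apply: is_jacobian_onZ.
by have [sJi _ _] := sJ i; exact: sJi.
Qed.

Lemma enorm_step_ref : enorm (step g k beta 0 (a k)) <= noise_weight beta * L.
Proof.
have [L0 _ _ _ _] := h1 g kN.
have b0 := enorm_ge0 (cb c g k 0 (a k)).
have s0 := enorm_ge0 (csigma c g k 0 (a k)).
apply: enorm_noisy => [|i]; first lra.
by apply: le_trans (enorm_col _ _) _; lra.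
Qed.

Lemma enorm_step_x x u : U k u ->
  enorm (step_x g k beta x u) <= noise_weight beta * L.
Proof.
move=> Uu; have [_ _ _ bL sL] := h1 g kN.
by apply: enorm_noisy => [|i]; [case: (bL x u Uu)|case: (sL i x u Uu)].
Qed.

Lemma enorm_step_u x u : U k u ->
  enorm (step_u g k beta x u) <= noise_weight beta * L.
Proof.
move=> Uu; have [_ _ _ bL sL] := h1 g kN.
by apply: enorm_noisy => [|i]; [case: (bL x u Uu)|case: (sL i x u Uu)].
Qed.

Lemma step_lipschitz x x' u u' : convex_set (U k) -> U k u -> U k u' ->
  enorm (step g k beta x' u' - step g k beta x u)
  <= noise_weight beta * L * (enorm (x' - x) + enorm (u' - u)).
Proof.
move=> cU Uu Uu'.
have seg v v' t : U k v -> U k v' -> 0 <= t <= 1 -> U k (v + t *: (v' - v)).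
  exact: convex_set_segment.
apply: (jacobian_lipschitz (V := U k) (gx := step_x g k beta)
  (gu := step_u g k beta)) => //; first exact: step_jacobian.
move=> t t01 /=; have Ut := seg _ _ _ Uu Uu' t01.
by split; [exact: enorm_step_x|exact: enorm_step_u].
Qed.

End at_time.

Lemma step_x_unif_cont psi g k beta :
  unif_cont_on (U k) psi (cb_x c g k) ->
  (forall i, unif_cont_on (U k) psi (csigma_x c g k i)) ->
  unif_cont_on (U k) (fun r => noise_weight beta * psi r) (step_x g k beta).
Proof.
move=> bP sP x x' u u' Uu Uu'; rewrite noisyB.
by apply: enorm_noisy => [|i]; [exact: bP|exact: sP].
Qed.

Lemma step_u_unif_cont psi g k beta :
  unif_cont_on (U k) psi (cb_u c g k) ->
  (forall i, unif_cont_on (U k) psi (csigma_u c g k i)) ->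
  unif_cont_on (U k) (fun r => noise_weight beta * psi r) (step_u g k beta).
Proof.
move=> bP sP x x' u u' Uu Uu'; rewrite noisyB.
by apply: enorm_noisy => [|i]; [exact: bP|exact: sP].
Qed.

End noisy_step.

(** * Pathwise estimates, uniform in the parameter *)

Lemma enorm_11 (R : realType) (A : 'M[R]_1) : enorm A = `|A 0 0|.
Proof. by rewrite {1}[A]mx11_scalar enorm_scalar. Qed.

(** Reading the terminal cost as a function of (x, u) that is constant in u
    makes the mean value inequalities for running costs available for it. *)
Lemma is_jacobian_on_diff (R : realType) n m (phi : 'cV[R]_n -> R) x (J : 'rV[R]_n)
    (V : set 'cV[R]_m) (u : 'cV[R]_m) :
  is_diff x phi (fun h => (J *m h) 0 0) ->
  is_jacobian_on V (fun y _ => (phi y)%:M) x u J (0 : 'M[R]_(1, m)).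
Proof.
move=> [/diff_locallyP[_ +] dphi]; rewrite dphi => /eqaddoP H e e0.
have /nbhs_norm0P[r /= r0 rP] := H _ e0.
exists r => // x' u' _ lt_r.
have xr : `|x' - x| < r.
  apply: le_lt_trans (ler_norm_enorm _) (le_lt_trans _ lt_r).
  by rewrite lerDl enorm_ge0.
have := rP _ xr; rewrite /= !fctE /= subrK => h.
rewrite mul0mx addr0 enorm_11 !mxE eqxx !mulr1n.
rewrite mxE opprD addrA in h.
apply: le_trans h _; rewrite ler_wpM2l//; first exact: ltW.
apply: le_trans (ler_norm_enorm _) _.
by rewrite lerDl enorm_ge0.
Qed.

(** The body of H3 for one modulus, which the sections below fix. *)
Definition coefs_modulus (R : realType) (Gam : Type) (n m d N : nat)
    (U : nat -> set 'cV[R]_m) (c : coefs R Gam n m d) (psi : R -> R) : Prop :=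
  (forall g k, (k < N)%N ->
   [/\ unif_cont_on (U k) psi (cb_x c g k),
       unif_cont_on (U k) psi (cb_u c g k),
       forall i, unif_cont_on (U k) psi (csigma_x c g k i) /\
                 unif_cont_on (U k) psi (csigma_u c g k i),
       unif_cont_on (U k) psi (cf_x c g k) &
       unif_cont_on (U k) psi (cf_u c g k)]) /\
  (forall g x x', enorm (cphi_x c g x - cphi_x c g x') <= psi (enorm (x - x'))).

Section pathwise.
Context {R : realType} {disp : measure_display} {Omega : measurableType disp}.
Context {Gam : pmetricType R} {n m d : nat} (N : nat).
Context (B : nat -> Omega -> 'cV[R]_d) (U : nat -> set 'cV[R]_m).
Context (c : coefs R Gam n m d) (a : nat -> 'cV[R]_m) (x0 : 'cV[R]_n) (L : R).
Implicit Types (u us : control R Omega m) (w : Omega) (g : Gam) (k : nat).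

(** The solution of the linear recursion that the norms of the state and of
    its variations satisfy as an inequality. It depends on the outcome but not
    on the parameter of the model: this yields at the same time the uniformity
    in the parameter and the dominating functions for the passages to the
    limit. *)
Fixpoint dominator (c0 : R) (wt h : nat -> R) k : R :=
  if k is j.+1 then L * wt j * (dominator c0 wt h j + h j) else c0.

Definition noise w k : R := noise_weight (B k.+1 w).

Definition state_bound u w : nat -> R :=
  dominator (enorm x0) (noise w) (fun k => 1 + enorm (a k) + enorm (u k w)).

(** Dominates xbar and also the difference quotients of the state in the
    direction u - us, which obey the same recursion. *)
Definition variation_bound us u w : nat -> R :=
  dominator 0 (noise w) (fun k => enorm (u k w - us k w)).

Definition perturbed us u (e : R) : control R Omega m :=
  fun k w => us k w + e *: (u k w - us k w).

Definition takes_values u := forall k w, (k < N)%N -> U k (u k w).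

Lemma state_boundS u w k : state_bound u w k.+1 =
  L * noise_weight (B k.+1 w)
  * (state_bound u w k + (1 + enorm (a k) + enorm (u k w))).
Proof. by []. Qed.

Lemma variation_boundS us u w k : variation_bound us u w k.+1 =
  L * noise_weight (B k.+1 w)
  * (variation_bound us u w k + enorm (u k w - us k w)).
Proof. by []. Qed.

Hypothesis L_ge0 : 0 <= L.
Hypothesis U_convex : forall k, (k < N)%N -> convex_set (U k).
Hypothesis a_ref : ref_control N U a.
Hypothesis h1 : H1 N U c a L.
Hypothesis h2 : H2 N U c a L.

Lemma dominator_ge0 c0 wt h k : 0 <= c0 ->
  (forall j, 0 <= wt j) -> (forall j, 0 <= h j) -> 0 <= dominator c0 wt h k.
Proof.
by move=> c00 wt0 h0; elim: k => //= k ih; rewrite !mulr_ge0 ?addr_ge0.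
Qed.

Lemma noise_ge0 w k : 0 <= noise w k.
Proof. exact: noise_weight_ge0. Qed.

Lemma state_bound_ge0 u w k : 0 <= state_bound u w k.
Proof.
apply: dominator_ge0 => *; rewrite ?noise_ge0 ?enorm_ge0//.
by rewrite !addr_ge0 ?enorm_ge0.
Qed.

Lemma variation_bound_ge0 us u w k : 0 <= variation_bound us u w k.
Proof. by apply: dominator_ge0 => *; rewrite ?noise_ge0 ?enorm_ge0. Qed.

Lemma enorm_state u g k w : takes_values u -> (k <= N)%N ->
  enorm (state B c x0 u g k w) <= state_bound u w k.
Proof.
move=> uU; elim: k => // k ih kN; rewrite state_succ.
have {}ih := ih (ltnW kN).
have [Ua _] := a_ref kN.
have lip := step_lipschitz h1 g (B k.+1 w) kN 0 (state B c x0 u g k w)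
  (U_convex kN) Ua (uU k w kN).
rewrite subr0 in lip.
rewrite -[step _ _ _ _ _ _](subrK (step c g k (B k.+1 w) 0 (a k))).
apply: le_trans (ler_enormD _ _) _.
apply: le_trans (lerD lip (enorm_step_ref h1 g (B k.+1 w) kN)) _.
have W0 : 0 <= noise_weight (B k.+1 w) * L.
  by rewrite mulr_ge0// noise_weight_ge0.
rewrite state_boundS -{2}[_ * L]mulr1 -mulrDr [L * _]mulrC ler_wpM2l//.
have := ler_enormB (u k w) (a k); lra.
Qed.

Lemma perturbed_takes_values us u e : takes_values us -> takes_values u ->
  0 <= e <= 1 -> takes_values (perturbed us u e).
Proof.
move=> usU uU e01 k w kN.
exact: (convex_set_segment (U_convex kN) (usU _ _ kN) (uU _ _ kN) e01).
Qed.

Lemma enorm_xbar us u g k w : takes_values us -> (k <= N)%N ->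
  enorm (xbar B c x0 us u g k w) <= variation_bound us u w k.
Proof.
move=> usU; elim: k => [_|k ih kN]; first by rewrite enorm0.
rewrite xbar_succ; have {}ih := ih (ltnW kN).
apply: le_trans (ler_enormD _ _) _.
rewrite variation_boundS [L * _]mulrC mulrDr.
apply: lerD; apply: le_trans (ler_enormM _ _) _; apply: ler_pM;
  rewrite ?enorm_ge0//.
  exact: (enorm_step_x h1 _ _ kN _ (usU _ _ kN)).
exact: (enorm_step_u h1 _ _ kN _ (usU _ _ kN)).
Qed.

Lemma state_increment us u g e k w : takes_values us -> takes_values u ->
  0 <= e <= 1 -> (k <= N)%N ->
  enorm (state B c x0 (perturbed us u e) g k w - state B c x0 us g k w)
  <= e * variation_bound us u w k.
Proof.
move=> usU uU e01; have /andP[e0 _] := e01.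
have eU := perturbed_takes_values usU uU e01.
elim: k => [_|k ih kN]; first by rewrite subrr enorm0 mulr0.
rewrite !state_succ; have {}ih := ih (ltnW kN).
apply: le_trans (step_lipschitz h1 _ _ kN _ _ (U_convex kN) (usU _ _ kN)
  (eU _ _ kN)) _.
have -> : perturbed us u e k w - us k w = e *: (u k w - us k w).
  by rewrite /perturbed addrC addKr.
rewrite enormZ ger0_norm// variation_boundS.
rewrite [e * _]mulrCA [L * _]mulrC ler_wpM2l ?mulrDr ?lerD//.
by rewrite mulr_ge0// noise_weight_ge0.
Qed.

Lemma enorm_segment p (x x' : 'cV[R]_p) s t :
  0 <= t <= 1 -> enorm x <= s -> enorm x' <= s ->
  enorm (x + t *: (x' - x)) <= s.
Proof.
move=> /andP[t0 t1] xs x's.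
have -> : x + t *: (x' - x) = (1 - t) *: x + t *: x'.
  by apply/matrixP => i j; rewrite !mxE; ring.
apply: le_trans (ler_enormD _ _) _.
have t1' : 0 <= 1 - t by rewrite subr_ge0.
rewrite !enormZ !ger0_norm//.
have := ler_wpM2l t1' xs; have := ler_wpM2l t0 x's; lra.
Qed.

(** The gradients grow linearly, so they are bounded on the segment by their
    bound at radii that contain both end points. *)
Lemma running_cost_lipschitz g k x x' (u u' : 'cV[R]_m) s t : (k < N)%N ->
  U k u -> U k u' -> enorm x <= s -> enorm x' <= s ->
  enorm u <= t -> enorm u' <= t ->
  `|cf c g k x' u' - cf c g k x u|
  <= L * (1 + s + t) * (enorm (x' - x) + enorm (u' - u)).
Proof.
move=> kN Uu Uu' xs x's ut u't.
have [_ [fJ _ _] fL] := h2.1 g k kN.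
have seg v1 v2 r : U k v1 -> U k v2 -> 0 <= r <= 1 -> U k (v1 + r *: (v2 - v1)).
  by apply: convex_set_segment; exact: U_convex.
have := jacobian_lipschitz (x := x) (x' := x') (K := L * (1 + s + t)) seg fJ Uu Uu'.
rewrite enorm_11 !mxE eqxx !mulr1n; apply => r r01.
have [fx fu] := fL (x + r *: (x' - x)) _ (seg _ _ _ Uu Uu' r01).
have bnd : L * (1 + enorm (x + r *: (x' - x)) + enorm (u + r *: (u' - u)))
    <= L * (1 + s + t).
  rewrite ler_wpM2l// lerD ?enorm_segment// lerD2l.
  exact: enorm_segment.
by split; [exact: le_trans fx bnd|exact: le_trans fu bnd].
Qed.

Let phi_jacobian g x (u : 'cV[R]_m) :
  is_jacobian_on setT (fun y _ => (cphi c g y)%:M) x u (cphi_x c g x)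
    (0 : 'M[R]_(1, m)).
Proof. by apply: is_jacobian_on_diff; have [] := h2.2 g. Qed.

Lemma terminal_cost_lipschitz g x x' s : enorm x <= s -> enorm x' <= s ->
  `|cphi c g x' - cphi c g x| <= L * (1 + s) * enorm (x' - x).
Proof.
move=> xs x's; have [_ _ phiL] := h2.2 g.
have := jacobian_lipschitz (V := setT) (x := x) (x' := x') (u := 0) (u' := 0)
  (K := L * (1 + s)) (fun _ _ _ _ _ _ => I) (fun y v _ => phi_jacobian g y v) I I.
rewrite enorm_11 !mxE eqxx !mulr1n subrr (@enorm0 _ m 1) addr0; apply => r r01.
have s0 : 0 <= s by exact: le_trans (enorm_ge0 _) xs.
split; last by rewrite enorm0 mulr_ge0// addr_ge0.
apply: le_trans (phiL _) _.
rewrite ler_wpM2l// lerD2l; exact: enorm_segment.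
Qed.

Definition cost u g w : R :=
  \sum_(0 <= k < N) cf c g k (state B c x0 u g k w) (u k w)
  + cphi c g (state B c x0 u g N w).

Definition cost_derivative us u g w : R :=
  \sum_(0 <= k < N)
    (cf_x c g k (state B c x0 us g k w) (us k w) *m xbar B c x0 us u g k w
     + cf_u c g k (state B c x0 us g k w) (us k w) *m (u k w - us k w)) 0 0
  + (cphi_x c g (state B c x0 us g N w) *m xbar B c x0 us u g N w) 0 0.

Definition cost_bound M u w : R :=
  \sum_(0 <= k < N)
    (L + L * (1 + state_bound u w k + (enorm (a k) + enorm (u k w))) ^+ 2)
  + (M + L * (1 + state_bound u w N) ^+ 2).

Lemma cost_le M u g w : (forall g, `|cphi c g 0| <= M) -> takes_values u ->
  `|cost u g w| <= cost_bound M u w.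
Proof.
move=> phiM uU; apply: le_trans (ler_normD _ _) _; apply: lerD.
  rewrite !big_nat; apply: le_trans (ler_norm_sum _ _ _) _.
  apply: ler_sum => k /andP[_ kN].
  have [f0 _ _] := h2.1 g k kN; have [Ua _] := a_ref kN.
  set x := state _ _ _ _ _ _ _.
  have xG : enorm x <= state_bound u w k by apply: enorm_state => //; exact: ltnW.
  have G0 := state_bound_ge0 u w k.
  have := running_cost_lipschitz g (x := 0) (x' := x) kN Ua (uU k w kN)
    (s := state_bound u w k) (t := enorm (a k) + enorm (u k w)).
  rewrite enorm0 subr0 lerDl lerDr !enorm_ge0 => /(_ G0 xG isT isT) lip.
  rewrite -[cf c g k x _](subrK (cf c g k 0 (a k))).
  apply: le_trans (ler_normD _ _) _; rewrite addrC lerD//.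
  apply: le_trans lip _; rewrite -mulrA ler_wpM2l// expr2 ler_wpM2l//.
    by rewrite !addr_ge0 ?enorm_ge0.
  have := ler_enormB (u k w) (a k); lra.
set x := state _ _ _ _ _ _ _.
have xG : enorm x <= state_bound u w N by exact: enorm_state.
have G0 := state_bound_ge0 u w N.
have := terminal_cost_lipschitz g (x := 0) (x' := x) (s := state_bound u w N).
rewrite enorm0 subr0 => /(_ G0 xG) lip.
rewrite -[cphi c g x](subrK (cphi c g 0)).
apply: le_trans (ler_normD _ _) _; rewrite addrC lerD//.
apply: le_trans lip _; rewrite -mulrA ler_wpM2l// expr2 ler_wpM2l//.
  by rewrite addr_ge0.
lra.
Qed.

Definition increment_bound us u w k : R :=
  variation_bound us u w k + enorm (u k w - us k w).

Lemma increment_bound_ge0 us u w k : 0 <= increment_bound us u w k.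
Proof. by rewrite addr_ge0 ?enorm_ge0 ?variation_bound_ge0. Qed.

Lemma entry_mulmx_le p (A : 'rV[R]_p) (C : 'cV[R]_p) s t :
  enorm A <= s -> enorm C <= t -> `|(A *m C) 0 0| <= s * t.
Proof.
move=> As Ct; apply: le_trans (ler_entry_enorm _ _ _) _.
by apply: le_trans (ler_enormM _ _) _; rewrite ler_pM ?enorm_ge0.
Qed.

Lemma entry_defect p q f f' (X : 'rV[R]_p) (Y : 'rV[R]_q) dx z v e :
  f' - f - e * (X *m z + Y *m v) 0 0 =
    (f'%:M - f%:M - (X *m dx + Y *m (e *: v))) 0 0
    + (X *m (dx - e *: z)) 0 0.
Proof.
rewrite mulmxBr -!scalemxAr.
move: (X *m z) (Y *m v) (X *m dx) => A C D.
by rewrite !mxE eqxx !mulr1n; ring.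
Qed.

Lemma running_gradient_le us g w k : takes_values us -> (k < N)%N ->
  let x := state B c x0 us g k w in
  enorm (cf_x c g k x (us k w)) <= L * (1 + state_bound us w k + enorm (us k w))
  /\ enorm (cf_u c g k x (us k w))
     <= L * (1 + state_bound us w k + enorm (us k w)).
Proof.
move=> usU kN x; have [_ _ fL] := h2.1 g k kN.
have [fx fu] := fL x _ (usU k w kN).
have xG : enorm x <= state_bound us w k.
  by apply: enorm_state => //; exact: ltnW.
have bnd : L * (1 + enorm x + enorm (us k w))
    <= L * (1 + state_bound us w k + enorm (us k w)).
  by rewrite ler_wpM2l// lerD2r lerD2l.
by split; [exact: le_trans fx bnd|exact: le_trans fu bnd].
Qed.

Lemma terminal_gradient_le us g w : takes_values us ->
  enorm (cphi_x c g (state B c x0 us g N w)) <= L * (1 + state_bound us w N).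
Proof.
move=> usU; have [_ _ phiL] := h2.2 g; apply: le_trans (phiL _) _.
by rewrite ler_wpM2l// lerD2l; exact: enorm_state.
Qed.

Definition derivative_bound us u w : R :=
  \sum_(0 <= k < N) L * (1 + state_bound us w k + enorm (us k w))
                    * increment_bound us u w k
  + L * (1 + state_bound us w N) * variation_bound us u w N.

Lemma cost_derivative_le us u g w : takes_values us ->
  `|cost_derivative us u g w| <= derivative_bound us u w.
Proof.
move=> usU; apply: le_trans (ler_normD _ _) _; apply: lerD; last first.
  by apply: entry_mulmx_le; [exact: terminal_gradient_le|exact: enorm_xbar].
rewrite !big_nat; apply: le_trans (ler_norm_sum _ _ _) _.
apply: ler_sum => k /andP[_ kN]; have [fx fu] := running_gradient_le g w usU kN.
rewrite mxE mulrDr; apply: le_trans (ler_normD _ _) _; apply: lerD.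
  by apply: entry_mulmx_le => //; apply: enorm_xbar => //; exact: ltnW.
exact: entry_mulmx_le.
Qed.

Section modulus.
Variable psi : R -> R.
Hypothesis psi_modulus : modulus psi.
Hypothesis psi_coefs : coefs_modulus N U c psi.
Let psi_coef := psi_coefs.1.
Let psi_phi := psi_coefs.2.

(** Dominates the distance from the difference quotient of the state to xbar.
    The second term of the minimum is what linearising one step gives, and it
    vanishes with e; but psi (e r) r may grow like r ^ 2 while r has only two
    moments, so the square of this term need not be integrable. The first
    term, the sum of the bounds on the quotient and on xbar, supplies the
    domination. *)
Fixpoint defect_bound us u (e : R) w k : R :=
  if k is j.+1 then
    Num.min (2 * variation_bound us u w j.+1)
      (noise w j * (L * defect_bound us u e w j
        + psi (e * increment_bound us u w j) * increment_bound us u w j))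
  else 0.

Lemma defect_boundS us u e w k : defect_bound us u e w k.+1 =
  Num.min (2 * variation_bound us u w k.+1)
    (noise_weight (B k.+1 w) * (L * defect_bound us u e w k
      + psi (e * increment_bound us u w k) * increment_bound us u w k)).
Proof. by []. Qed.

Let psi_ge0 r : 0 <= r -> 0 <= psi r := modulus_ge0 psi_modulus (r := r).
Let psi_nondecr r s : 0 <= r -> r <= s -> psi r <= psi s :=
  modulus_nondecr psi_modulus (r := r) (s := s).

Lemma defect_bound_ge0 us u e w k : 0 <= e -> 0 <= defect_bound us u e w k.
Proof.
move=> e0; elim: k => // k ih; rewrite defect_boundS le_min mulr_ge0//=; last first.
  exact: variation_bound_ge0.
rewrite mulr_ge0 ?noise_weight_ge0// addr_ge0 ?mulr_ge0 ?psi_ge0 ?increment_bound_ge0//.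
by rewrite mulr_ge0 ?increment_bound_ge0.
Qed.

Lemma defect_bound_le us u e w k :
  defect_bound us u e w k <= 2 * variation_bound us u w k.
Proof.
case: k => [|k]; first by rewrite /= mulr_ge0// variation_bound_ge0.
by rewrite defect_boundS ge_min lexx.
Qed.

(** Linearising one step leaves the Jacobian in x applied to the defect of the
    previous state, and a remainder governed by the oscillation of the
    Jacobians along the increment. *)
Lemma state_taylor us u g e k w : takes_values us -> takes_values u ->
  0 <= e <= 1 -> (k <= N)%N ->
  enorm (state B c x0 (perturbed us u e) g k w - state B c x0 us g k w
         - e *: xbar B c x0 us u g k w)
  <= e * defect_bound us u e w k.
Proof.
move=> usU uU e01; have /andP[e0 _] := e01.
have eU := perturbed_takes_values usU uU e01.
elim: k => [_|k ih kN]; first by rewrite /= subrr scaler0 subr0 enorm0 mulr0.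
rewrite defect_boundS minr_pMr// le_min; apply/andP; split.
  apply: le_trans (ler_enormB _ _) _; rewrite enormZ (ger0_norm e0).
  have h3 := state_increment g w usU uU e01 kN.
  have h4 := ler_wpM2l e0 (enorm_xbar u g w usU kN).
  lra.
rewrite !state_succ xbar_succ; have {}ih := ih (ltnW kN).
set x := state B c x0 us g k w in ih *.
set x' := state B c x0 (perturbed us u e) g k w in ih *.
set z := xbar B c x0 us u g k w in ih *.
set beta := B k.+1 w; set v := u k w - us k w.
have dv : perturbed us u e k w - us k w = e *: v.
  by rewrite /perturbed addrC addKr.
have [bx bu sxu _ _] := psi_coef g kN.
have seg v1 v2 t : U k v1 -> U k v2 -> 0 <= t <= 1 -> U k (v1 + t *: (v2 - v1)).
  by apply: convex_set_segment; exact: U_convex.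
have jac y v1 : U k v1 -> is_jacobian_on (U k) (step c g k beta) y v1
  (step_x c g k beta y v1) (step_u c g k beta y v1).
  by move=> Uv1; exact: (step_jacobian h1).
have wnd r s : 0 <= r -> r <= s ->
    noise_weight beta * psi r <= noise_weight beta * psi s.
  by move=> r0 rs; rewrite ler_wpM2l ?noise_weight_ge0 ?psi_nondecr.
have sxc := step_x_unif_cont beta bx (fun i => (sxu i).1).
have suc := step_u_unif_cont beta bu (fun i => (sxu i).2).
have := jacobian_taylor seg jac x x' wnd sxc suc (usU k w kN) (eU k w kN).
rewrite dv enormZ (ger0_norm e0).
set X := step_x _ _ _ _ _ _; set Y := step_u _ _ _ _ _ _.
set F' := step _ _ _ _ _ _; set F := step _ _ _ _ _ _ => tay.
have -> : F' - F - e *: (X *m z + Y *m v) =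
    (F' - F - (X *m (x' - x) + Y *m (e *: v))) + X *m (x' - x - e *: z).
  rewrite (mulmxBr X (x' - x)) -!scalemxAr scalerDr.
  by apply/matrixP => i j; rewrite !mxE; ring.
apply: le_trans (ler_enormD _ _) _.
have XL : enorm X <= noise_weight beta * L.
  exact: (enorm_step_x h1 _ _ kN _ (usU _ _ kN)).
have h4 : enorm (X *m (x' - x - e *: z)) <=
    noise_weight beta * L * (e * defect_bound us u e w k).
  apply: le_trans (ler_enormM _ _) _.
  by rewrite ler_pM ?enorm_ge0.
have dle : enorm (x' - x) + e * enorm v <= e * increment_bound us u w k.
  by rewrite mulrDr lerD2r; exact: (state_increment g w usU uU e01 (ltnW kN)).
have d0 : 0 <= enorm (x' - x) + e * enorm v.
  by rewrite addr_ge0 ?mulr_ge0 ?enorm_ge0.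
have h5 : noise_weight beta * psi (enorm (x' - x) + e * enorm v) *
    (enorm (x' - x) + e * enorm v) <=
  noise_weight beta * psi (e * increment_bound us u w k) *
    (e * increment_bound us u w k).
  apply: ler_pM => //; first by rewrite mulr_ge0 ?noise_weight_ge0 ?psi_ge0.
  by apply: wnd.
apply: le_trans (lerD (le_trans tay h5) h4) _.
rewrite -/beta le_eqVlt; apply/orP; left; apply/eqP; ring.
Qed.


Definition remainder_bound us u e w : R :=
  \sum_(0 <= k < N)
    (L * (1 + state_bound us w k + enorm (us k w)) * defect_bound us u e w k
     + psi (e * increment_bound us u w k) * increment_bound us u w k)
  + (L * (1 + state_bound us w N) * defect_bound us u e w N
     + psi (e * variation_bound us u w N) * variation_bound us u w N).

Lemma cost_taylor us u g e w : takes_values us -> takes_values u ->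
  0 <= e <= 1 ->
  `|cost (perturbed us u e) g w - cost us g w - e * cost_derivative us u g w|
  <= e * remainder_bound us u e w.
Proof.
move=> usU uU e01; have /andP[e0 _] := e01.
have eU := perturbed_takes_values usU uU e01.
rewrite /cost /cost_derivative /remainder_bound.
set S1 := \sum_(0 <= k < N) _; set S2 := \sum_(0 <= k < N) _.
set S3 := \sum_(0 <= k < N) _.
set F1 := cphi _ _ _; set F2 := cphi _ _ _; set F3 := _ 0 0.
have -> : S1 + F1 - (S2 + F2) - e * (S3 + F3) =
  (S1 - S2 - e * S3) + (F1 - F2 - e * F3) by ring.
apply: le_trans (ler_normD _ _) _; rewrite mulrDr; apply: lerD.
  rewrite /S1 /S2 /S3 !mulr_sumr -!sumrB !big_nat.
  apply: le_trans (ler_norm_sum _ _ _) _; apply: ler_sum => k /andP[_ kN].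
  set x := state B c x0 us g k w; set x' := state B c x0 (perturbed us u e) g k w.
  set z := xbar B c x0 us u g k w; set v := u k w - us k w.
  have dv : perturbed us u e k w - us k w = e *: v.
    by rewrite /perturbed addrC addKr.
  have [_ _ _ fx fu] := psi_coef g kN.
  have [_ [fJ _ _] _] := h2.1 g k kN.
  have seg v1 v2 t : U k v1 -> U k v2 -> 0 <= t <= 1 -> U k (v1 + t *: (v2 - v1)).
    by apply: convex_set_segment; exact: U_convex.
  have := jacobian_taylor seg fJ x x' psi_nondecr fx fu (usU k w kN) (eU k w kN).
  rewrite dv enormZ (ger0_norm e0).
  have [] := running_gradient_le g w usU kN; rewrite -/x.
  set X := cf_x _ _ _ _ _; set Y := cf_u _ _ _ _ _ => XL YL tay.
  rewrite -/(perturbed us u e k w).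
  set f' := cf _ _ _ _ _ in tay *; set f := cf _ _ _ _ _ in tay *.
  rewrite (entry_defect f f' X Y (x' - x)).
  apply: le_trans (ler_normD _ _) _; rewrite mulrDr addrC; apply: lerD.
    rewrite mulrCA; apply: entry_mulmx_le => //.
    by apply: state_taylor => //; exact: ltnW.
  apply: le_trans (ler_entry_enorm _ _ _) (le_trans tay _).
  have dle : enorm (x' - x) + e * enorm v <= e * increment_bound us u w k.
    by rewrite mulrDr lerD2r; exact: (state_increment g w usU uU e01 (ltnW kN)).
  have d0 : 0 <= enorm (x' - x) + e * enorm v.
    by rewrite addr_ge0 ?mulr_ge0 ?enorm_ge0.
  rewrite mulrCA; apply: ler_pM => //; first exact: psi_ge0.
  exact: psi_nondecr.
rewrite /F1 /F2 /F3; set x := state _ _ _ us _ _ _.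
set x' := state _ _ _ _ _ _ _; set z := xbar _ _ _ _ _ _ _ _.
set X := cphi_x _ _ _.
have XL : enorm X <= L * (1 + state_bound us w N) by exact: terminal_gradient_le.
have ucX : unif_cont_on [set: 'cV[R]_m] psi (fun y (_ : 'cV[R]_m) => cphi_x c g y).
  move=> y y' v v' _ _; apply: le_trans (psi_phi _ _ _) _.
  by apply: psi_nondecr; rewrite ?enorm_ge0// lerDl enorm_ge0.
have uc0 : unif_cont_on [set: 'cV[R]_m] psi
    (fun (_ : 'cV[R]_n) (_ : 'cV[R]_m) => 0 : 'M[R]_(1, m)).
  by move=> y y' v v' _ _; rewrite subrr enorm0 psi_ge0// addr_ge0 ?enorm_ge0.
have := jacobian_taylor (fun _ _ _ _ _ _ => I)
  (fun y v _ => phi_jacobian g y v) x x' psi_nondecr ucX uc0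
  (I : [set: 'cV[R]_m] 0) (I : [set: 'cV[R]_m] 0).
rewrite subrr (@enorm0 _ m 1) mulmx0 !addr0 => tay.
have := entry_defect (cphi c g x) (cphi c g x') X (0 : 'rV[R]_m) (x' - x) z 0 e.
rewrite !mul0mx !addr0 => ->.
apply: le_trans (ler_normD _ _) _; rewrite mulrDr addrC; apply: lerD.
  by rewrite mulrCA; apply: entry_mulmx_le => //; exact: state_taylor.
apply: le_trans (ler_entry_enorm _ _ _) (le_trans tay _).
have dle : enorm (x' - x) <= e * variation_bound us u w N.
  exact: state_increment.
rewrite mulrCA; apply: ler_pM; rewrite ?psi_ge0 ?enorm_ge0//.
by apply: psi_nondecr; rewrite ?enorm_ge0.
Qed.

End modulus.
End pathwise.

(** * Pathwise limits *)

Section vanishing.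
Context {R : realType}.
Implicit Types f h : nat -> R.

Definition vanishing f := f @ \oo --> (0 : R).

Lemma vanishing_le f h :
  (forall i, 0 <= f i) -> (forall i, f i <= h i) -> vanishing h -> vanishing f.
Proof.
move=> f0 fh h0; apply: (squeeze_cvgr _ (cvg_cst 0) h0).
by near=> i; rewrite f0 fh.
Unshelve. all: by end_near. Qed.

Lemma vanishingD f h : vanishing f -> vanishing h ->
  vanishing (fun i => f i + h i).
Proof. by move=> f0 h0; rewrite /vanishing -[0]addr0; exact: cvgD. Qed.

Lemma vanishingZ K f : vanishing f -> vanishing (fun i => K * f i).
Proof. by move=> f0; rewrite /vanishing -(mulr0 K); exact: cvgMr. Qed.

Lemma vanishing_sum N (F : nat -> nat -> R) :
  (forall k, (k < N)%N -> vanishing (F k)) ->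
  vanishing (fun i => \sum_(0 <= k < N) F k i).
Proof.
elim: N => [_|N ih FN].
  by apply: (vanishing_le (h := fun=> 0)) => [i|i|];
    rewrite ?big_geq//; exact: cvg_cst.
have -> : (fun i => \sum_(0 <= k < N.+1) F k i) =
  (fun i => \sum_(0 <= k < N) F k i + F N i).
  by apply/funext => i; rewrite big_nat_recr.
by apply: vanishingD; [apply: ih => k kN; exact/FN/ltnW|exact: FN].
Qed.

Lemma vanishing_abs f : vanishing (fun i => `|f i|) <-> vanishing f.
Proof. by rewrite /vanishing; split => [?|?]; exact/norm_cvg0P. Qed.

Lemma vanishing_mulmx p q r (X_ : nat -> 'M[R]_(p, q)) X
    (z_ : nat -> 'M[R]_(q, r)) z K :
  (forall i, enorm (X_ i) <= K) ->
  vanishing (fun i => enorm (X_ i - X)) ->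
  vanishing (fun i => enorm (z_ i - z)) ->
  vanishing (fun i => enorm (X_ i *m z_ i - X *m z)).
Proof.
move=> XK X0 z0.
apply: (vanishing_le
  (h := fun i => K * enorm (z_ i - z) + enorm z * enorm (X_ i - X))).
- by move=> i; exact: enorm_ge0.
- move=> i.
  have -> : X_ i *m z_ i - X *m z = X_ i *m (z_ i - z) + (X_ i - X) *m z.
    by rewrite mulmxBr mulmxBl addrA subrK.
  apply: le_trans (ler_enormD _ _) _; apply: lerD.
    apply: le_trans (ler_enormM _ _) _.
    by rewrite ler_wpM2r ?enorm_ge0.
  by rewrite mulrC; exact: ler_enormM.
- by apply: vanishingD; exact: vanishingZ.
Qed.

Lemma modulus_small (psi : R -> R) e : modulus psi -> 0 < e ->
  exists2 r : R, 0 < r & forall s, 0 <= s -> s < r -> psi s < e.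
Proof.
move=> [cpsi _ nd pge psi0] e0.
have /continuous_within_itvcyP[_] := cpsi.
rewrite psi0 => /cvgrPdist_lt/(_ e e0) [r /= r0 rP].
exists r => // s; rewrite le_eqVlt => /predU1P[<- _|s0 sr]; first by rewrite psi0.
have := rP s; rewrite /= sub0r normrN gtr0_norm// => /(_ sr s0).
by rewrite sub0r normrN ger0_norm// pge// ltW.
Qed.

Lemma vanishing_modulus (psi : R -> R) f : modulus psi ->
  (forall i, 0 <= f i) -> vanishing f -> vanishing (psi \o f).
Proof.
move=> psim f0 fv; have [_ _ _ pge _] := psim.
apply/cvgrPdist_lt => e e0; have [r r0 rP] := modulus_small psim e0.
have /cvgrPdist_lt/(_ r r0) := fv.
apply: filterS => i; rewrite !sub0r !normrN ger0_norm// ger0_norm ?pge//.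
exact: rP.
Qed.

End vanishing.

Section pathwise_limits.
Context {R : realType} {disp : measure_display} {Omega : measurableType disp}.
Context {Gam : pmetricType R} {n m d : nat} (N : nat).
Context (B : nat -> Omega -> 'cV[R]_d) (U : nat -> set 'cV[R]_m).
Context (c : coefs R Gam n m d) (a : nat -> 'cV[R]_m) (x0 : 'cV[R]_n) (L : R).
Implicit Types (u us : control R Omega m) (w : Omega) (g : Gam) (k : nat).
Hypothesis L_ge0 : 0 <= L.
Hypothesis U_convex : forall k, (k < N)%N -> convex_set (U k).
Hypothesis a_ref : ref_control N U a.
Hypothesis h1 : H1 N U c a L.
Hypothesis h2 : H2 N U c a L.
Variable psi : R -> R.
Hypothesis psi_modulus : modulus psi.
Hypothesis psi_coefs : coefs_modulus N U c psi.
Let psi_coef := psi_coefs.1.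
Let psi_phi := psi_coefs.2.

Lemma remainder_bound_cvg us u w (e_ : nat -> R) :
  (forall i, 0 <= e_ i) -> vanishing e_ ->
  vanishing (fun i => remainder_bound N B a x0 L psi us u (e_ i) w).
Proof.
move=> e0 ev.
have psiv r : 0 <= r -> vanishing (fun i => psi (e_ i * r)).
  move=> r0; apply: (vanishing_modulus psi_modulus) => [i|].
    by rewrite mulr_ge0.
  by under eq_fun do rewrite mulrC; exact: vanishingZ.
have Dv k : vanishing (fun i => defect_bound B L psi us u (e_ i) w k).
  elim: k => [|k ih]; first exact: cvg_cst.
  apply: (vanishing_le (h := fun i => noise_weight (B k.+1 w) *
    (L * defect_bound B L psi us u (e_ i) w k
     + increment_bound B L us u w k * psi (e_ i * increment_bound B L us u w k)))).
  - by move=> i; exact: defect_bound_ge0.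
  - by move=> i; rewrite defect_boundS ge_min [X in _ + X]mulrC lexx orbT.
  - apply: vanishingZ; apply: vanishingD; first exact: vanishingZ.
    by apply: vanishingZ; apply: psiv; exact: increment_bound_ge0.
apply: vanishingD.
  apply: vanishing_sum => k kN; apply: vanishingD; first exact: vanishingZ.
  under eq_fun do rewrite mulrC.
  by apply/vanishingZ/psiv/increment_bound_ge0.
apply: vanishingD; first exact: vanishingZ.
under eq_fun do rewrite mulrC.
by apply/vanishingZ/psiv/variation_bound_ge0.
Qed.

Variables (gs : nat -> Gam) (g : Gam).
Hypothesis h4 : H4 N U c (@mdist R Gam).
Hypothesis gs_cvg : vanishing (fun i => mdist (gs i) g).

(** At a fixed point one modulus from H4 serves all the coefficients: the one
    for a radius that exceeds the norms of the point. *)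
Lemma coefs_cvg k x v : (k < N)%N -> U k v ->
  exists2 eta : nat -> R, vanishing eta & forall i,
  [/\ [/\ enorm (cb c (gs i) k x v - cb c g k x v) <= eta i,
      enorm (csigma c (gs i) k x v - csigma c g k x v) <= eta i &
      `|cf c (gs i) k x v - cf c g k x v| <= eta i],
      enorm (cb_x c (gs i) k x v - cb_x c g k x v) <= eta i /\
      enorm (cb_u c (gs i) k x v - cb_u c g k x v) <= eta i,
      forall j, enorm (csigma_x c (gs i) k j x v - csigma_x c g k j x v) <= eta i /\
                enorm (csigma_u c (gs i) k j x v - csigma_u c g k j x v) <= eta i &
      enorm (cf_x c (gs i) k x v - cf_x c g k x v) <= eta i /\
      enorm (cf_u c (gs i) k x v - cf_u c g k x v) <= eta i].
Proof.
move=> kN Uv; pose r := 1 + enorm x + enorm v.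
have x_ge0 := enorm_ge0 x; have v_ge0 := enorm_ge0 v.
have r0 : 0 < r by rewrite /r; lra.
have xr : enorm x <= r by rewrite /r; lra.
have vr : enorm v <= r by rewrite /r; lra.
have [rho rhom close] := h4 r0.
exists (rho \o (fun i => mdist (gs i) g)).
  by apply: vanishing_modulus => // i; exact: mdist_ge0.
move=> i; have [+ _] := close (gs i) g.
move=> /(_ k kN) [[cb0 cs0] cf0 [cbx cbu] cs [cfx cfu]].
split.
- split; [exact: cb0|exact: cs0|].
  by have := cf0 x v Uv xr vr; rewrite enorm_11 !mxE eqxx !mulr1n.
- by split; [exact: cbx|exact: cbu].
- by move=> j; have [csx csu] := cs j; split; [exact: csx|exact: csu].
- by split; [exact: cfx|exact: cfu].
Qed.

Lemma terminal_coefs_cvg x : exists2 eta : nat -> R, vanishing eta & forall i,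
  `|cphi c (gs i) x - cphi c g x| <= eta i /\
  enorm (cphi_x c (gs i) x - cphi_x c g x) <= eta i.
Proof.
have x_ge0 := enorm_ge0 x.
have r0 : 0 < 1 + enorm x by lra.
have [rho rhom close] := h4 r0.
exists (rho \o (fun i => mdist (gs i) g)).
  by apply: vanishing_modulus => // i; exact: mdist_ge0.
by move=> i; have [_] := close (gs i) g; apply; lra.
Qed.

Lemma state_cvg u k w : takes_values N U u -> (k <= N)%N ->
  vanishing (fun i => enorm (state B c x0 u (gs i) k w - state B c x0 u g k w)).
Proof.
move=> uU; elim: k => [_|k ih kN].
  by under eq_fun do rewrite subrr enorm0; exact: cvg_cst.
set x := state B c x0 u g k w in ih *.
have [eta etav etaP] := coefs_cvg x kN (uU k w kN).
apply: (vanishing_le (h := fun i =>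
  noise_weight (B k.+1 w) * L * enorm (state B c x0 u (gs i) k w - x)
  + noise_weight (B k.+1 w) * eta i)) => [i|i|].
- exact: enorm_ge0.
- rewrite !state_succ -/x.
  rewrite -[X in enorm X](subrKA (step c (gs i) k (B k.+1 w) x (u k w))).
  apply: le_trans (ler_enormD _ _) _; apply: lerD.
    have := step_lipschitz h1 (gs i) (B k.+1 w) kN x (state B c x0 u (gs i) k w)
      (U_convex kN) (uU k w kN) (uU k w kN).
    by rewrite subrr enorm0 addr0.
  rewrite noisyB; have [[bi si _] _ _ _] := etaP i.
  apply: enorm_noisy => // j; rewrite -linearB /=.
  exact: le_trans (enorm_col _ _) si.
- by apply: vanishingD; apply: vanishingZ => //; apply: ih; exact: ltnW.
Qed.

(** Moving the argument costs at most w of the displacement whatever the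
    index; what remains is convergence at a fixed point. *)
Lemma vanishing_coef p q V (w : R -> R)
    (chi_ : nat -> 'cV[R]_n -> 'cV[R]_m -> 'M[R]_(p, q)) chi x_ x v :
  (forall i, unif_cont_on V w (chi_ i)) -> V v ->
  vanishing (fun i => w (enorm (x_ i - x))) ->
  vanishing (fun i => enorm (chi_ i x v - chi x v)) ->
  vanishing (fun i => enorm (chi_ i (x_ i) v - chi x v)).
Proof.
move=> uc Vv wv cv.
apply: (vanishing_le (h := fun i => w (enorm (x_ i - x)) +
  enorm (chi_ i x v - chi x v))) => [i|i|].
- exact: enorm_ge0.
- rewrite -[X in enorm X <= _](subrKA (chi_ i x v)).
  apply: le_trans (ler_enormD _ _) _; apply: lerD => //.
  by have := uc i (x_ i) x v v Vv Vv; rewrite subrr enorm0 addr0.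
- exact: vanishingD.
Qed.

Lemma vanishing_psi_state u k w : takes_values N U u -> (k <= N)%N ->
  vanishing (fun i =>
    psi (enorm (state B c x0 u (gs i) k w - state B c x0 u g k w))).
Proof.
move=> uU kN; apply: (vanishing_modulus psi_modulus) => [i|].
  exact: enorm_ge0.
exact: state_cvg.
Qed.

Lemma vanishing_bound p q (F : nat -> 'M[R]_(p, q)) eta K :
  (forall i, enorm (F i) <= K * eta i) -> vanishing eta ->
  vanishing (fun i => enorm (F i)).
Proof.
move=> FK ev; apply: (vanishing_le (h := fun i => K * eta i)) => // [i|].
  exact: enorm_ge0.
exact: vanishingZ.
Qed.

Lemma vanishing_cst_dist p q (z : 'M[R]_(p, q)) :
  vanishing (fun=> enorm (z - z)).
Proof. by under eq_fun do rewrite subrr enorm0; exact: cvg_cst. Qed.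

Lemma xbar_cvg us u k w : takes_values N U us -> (k <= N)%N ->
  vanishing (fun i =>
    enorm (xbar B c x0 us u (gs i) k w - xbar B c x0 us u g k w)).
Proof.
move=> usU; elim: k => [_|k ih kN]; first exact: vanishing_cst_dist.
set z := xbar B c x0 us u g k w in ih *; set x := state B c x0 us g k w.
have Uus := usU k w kN.
have [eta etav etaP] := coefs_cvg x kN Uus.
pose wt := noise_weight (B k.+1 w).
have wv : vanishing (fun i => wt * psi (enorm (state B c x0 us (gs i) k w - x))).
  by apply: vanishingZ; apply: vanishing_psi_state => //; exact: ltnW.
pose X_ i := step_x c (gs i) k (B k.+1 w) (state B c x0 us (gs i) k w) (us k w).
pose Y_ i := step_u c (gs i) k (B k.+1 w) (state B c x0 us (gs i) k w) (us k w).
have Xv : vanishing (fun i => enorm (X_ i - step_x c g k (B k.+1 w) x (us k w))).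
  apply: (vanishing_coef (V := U k) (w := fun r => wt * psi r)
    (chi_ := fun i => step_x c (gs i) k (B k.+1 w))) => // [i|].
    have [bx _ sxu _ _] := psi_coef (gs i) kN.
    by apply: step_x_unif_cont => // j; case: (sxu j).
  apply: (vanishing_bound (K := wt)) etav => i; rewrite noisyB.
  have [_ [bi _] si _] := etaP i.
  by apply: enorm_noisy => // j; case: (si j).
have Yv : vanishing (fun i => enorm (Y_ i - step_u c g k (B k.+1 w) x (us k w))).
  apply: (vanishing_coef (V := U k) (w := fun r => wt * psi r)
    (chi_ := fun i => step_u c (gs i) k (B k.+1 w))) => // [i|].
    have [_ bu sxu _ _] := psi_coef (gs i) kN.
    by apply: step_u_unif_cont => // j; case: (sxu j).
  apply: (vanishing_bound (K := wt)) etav => i; rewrite noisyB.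
  have [_ [_ bi] si _] := etaP i.
  by apply: enorm_noisy => // j; case: (si j).
have Xz := vanishing_mulmx (X_ := X_) (K := wt * L)
  (fun i => enorm_step_x h1 _ _ kN _ Uus) Xv (ih (ltnW kN)).
have Yw := vanishing_mulmx (X_ := Y_) (K := wt * L)
  (fun i => enorm_step_u h1 _ _ kN _ Uus) Yv
  (vanishing_cst_dist (u k w - us k w)).
apply: vanishing_le (vanishingD Xz Yw) => i; first exact: enorm_ge0.
rewrite !xbar_succ -/x -/z opprD addrACA; exact: ler_enormD.
Qed.

Lemma cost_cvg u w : takes_values N U u ->
  vanishing (fun i => `|cost N B c x0 u (gs i) w - cost N B c x0 u g w|).
Proof.
move=> uU.
pose G k := state_bound B a x0 L u w k.
have stG g' k : (k <= N)%N -> enorm (state B c x0 u g' k w) <= G k.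
  by move=> kN; exact: (enorm_state B x0 L_ge0 U_convex a_ref h1 g' w uU kN).
have runv k : (k < N)%N -> vanishing (fun i =>
    `|cf c (gs i) k (state B c x0 u (gs i) k w) (u k w)
      - cf c g k (state B c x0 u g k w) (u k w)|).
  move=> kN; set x := state B c x0 u g k w.
  have [eta etav etaP] := coefs_cvg x kN (uU k w kN).
  apply: (vanishing_le (h := fun i => L * (1 + G k + enorm (u k w)) *
     enorm (state B c x0 u (gs i) k w - x) + eta i)) => [i|i|] //.
    rewrite -[X in `|X|](subrKA (cf c (gs i) k x (u k w))).
    apply: le_trans (ler_normD _ _) _; apply: lerD; last by have [[]] := etaP i.
    have := running_cost_lipschitz L_ge0 U_convex h2 (gs i) kN
      (uU k w kN) (uU k w kN) (stG g k (ltnW kN)) (stG (gs i) k (ltnW kN))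
      (lexx _) (lexx _).
    by rewrite subrr enorm0 addr0.
  apply: vanishingD => //; apply: vanishingZ; apply: state_cvg => //.
  exact: ltnW.
have terv : vanishing (fun i =>
    `|cphi c (gs i) (state B c x0 u (gs i) N w)
      - cphi c g (state B c x0 u g N w)|).
  set x := state B c x0 u g N w.
  have [eta etav etaP] := terminal_coefs_cvg x.
  apply: (vanishing_le (h := fun i => L * (1 + G N) *
     enorm (state B c x0 u (gs i) N w - x) + eta i)) => [i|i|] //.
    rewrite -[X in `|X|](subrKA (cphi c (gs i) x)).
    apply: le_trans (ler_normD _ _) _; apply: lerD; last by have [] := etaP i.
    exact: (terminal_cost_lipschitz L_ge0 h2 (gs i) (stG g N _) (stG (gs i) N _)).
  by apply: vanishingD => //; apply: vanishingZ; exact: state_cvg.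
apply: vanishing_le (vanishingD (vanishing_sum runv) terv) => i //.
rewrite /cost opprD addrACA -sumrB; apply: le_trans (ler_normD _ _) _.
by rewrite lerD2r; exact: ler_norm_sum.
Qed.

Lemma cost_derivative_cvg us u w : takes_values N U us ->
  vanishing (fun i => `|cost_derivative N B c x0 us u (gs i) w
                        - cost_derivative N B c x0 us u g w|).
Proof.
move=> usU.
pose x_ i k := state B c x0 us (gs i) k w.
pose z_ i k := xbar B c x0 us u (gs i) k w.
have runv k : (k < N)%N -> vanishing (fun i =>
    `|(cf_x c (gs i) k (x_ i k) (us k w) *m z_ i k
       + cf_u c (gs i) k (x_ i k) (us k w) *m (u k w - us k w)) 0 0
      - (cf_x c g k (state B c x0 us g k w) (us k w) *m xbar B c x0 us u g k w
       + cf_u c g k (state B c x0 us g k w) (us k w) *m (u k w - us k w)) 0 0|).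
  move=> kN; set x := state B c x0 us g k w; set z := xbar B c x0 us u g k w.
  have [eta etav etaP] := coefs_cvg x kN (usU k w kN).
  pose X_ i := cf_x c (gs i) k (x_ i k) (us k w).
  pose Y_ i := cf_u c (gs i) k (x_ i k) (us k w).
  have Xv : vanishing (fun i => enorm (X_ i - cf_x c g k x (us k w))).
    apply: (vanishing_coef (V := U k) (w := psi)
      (chi_ := fun i => cf_x c (gs i) k)) => [i||| ].
    - by have [] := psi_coef (gs i) kN.
    - exact: usU.
    - by apply: vanishing_psi_state => //; exact: ltnW.
    - by apply: (vanishing_bound (K := 1)) etav => i; rewrite mul1r;
        have [_ _ _ []] := etaP i.
  have Yv : vanishing (fun i => enorm (Y_ i - cf_u c g k x (us k w))).
    apply: (vanishing_coef (V := U k) (w := psi)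
      (chi_ := fun i => cf_u c (gs i) k)) => [i||| ].
    - by have [] := psi_coef (gs i) kN.
    - exact: usU.
    - by apply: vanishing_psi_state => //; exact: ltnW.
    - by apply: (vanishing_bound (K := 1)) etav => i; rewrite mul1r;
        have [_ _ _ []] := etaP i.
  pose K := L * (1 + state_bound B a x0 L us w k + enorm (us k w)).
  have grad i := running_gradient_le B x0 L_ge0 U_convex a_ref h1 h2 (gs i) w usU kN.
  have Xz := vanishing_mulmx (X_ := X_) (K := K)
    (fun i => (grad i).1) Xv (xbar_cvg u w usU (ltnW kN)).
  have Yw := vanishing_mulmx (X_ := Y_) (K := K) (fun i => (grad i).2) Yv
    (vanishing_cst_dist (u k w - us k w)).
  apply: vanishing_le (vanishingD Xz Yw) => i //.
  have -> (A C : 'M[R]_1) : A 0 0 - C 0 0 = (A - C) 0 0 by rewrite !mxE.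
  apply: le_trans (ler_entry_enorm _ _ _) _.
  by rewrite opprD addrACA; exact: ler_enormD.
have terv : vanishing (fun i =>
    `|(cphi_x c (gs i) (x_ i N) *m z_ i N) 0 0
      - (cphi_x c g (state B c x0 us g N w) *m xbar B c x0 us u g N w) 0 0|).
  set x := state B c x0 us g N w.
  have [eta etav etaP] := terminal_coefs_cvg x.
  have Xv : vanishing (fun i => enorm (cphi_x c (gs i) (x_ i N) - cphi_x c g x)).
    apply: (vanishing_coef (V := setT) (w := psi) (v := 0)
      (chi_ := fun i y _ => cphi_x c (gs i) y)
      (chi := fun y _ => cphi_x c g y)) => [i||| ] //.
    - move=> y y' v v' _ _; apply: le_trans (psi_phi _ _ _) _.
      by apply: (modulus_nondecr psi_modulus); rewrite ?enorm_ge0// lerDl enorm_ge0.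
    - exact: vanishing_psi_state.
    - by apply: (vanishing_bound (K := 1)) etav => i; rewrite mul1r;
        have [] := etaP i.
  have Xz := vanishing_mulmx
    (fun i => terminal_gradient_le B x0 L_ge0 U_convex a_ref h1 h2 (gs i) w usU) Xv
    (xbar_cvg u w usU (leqnn N)).
  apply: vanishing_le Xz => i //.
  have -> (A C : 'M[R]_1) : A 0 0 - C 0 0 = (A - C) 0 0 by rewrite !mxE.
  exact: ler_entry_enorm.
apply: vanishing_le (vanishingD (vanishing_sum runv) terv) => i //.
rewrite /cost_derivative opprD addrACA -sumrB; apply: le_trans (ler_normD _ _) _.
by rewrite lerD2r; exact: ler_norm_sum.
Qed.

End pathwise_limits.

(** * Measurability of the state and of the costs *)

Section coordinate_measurability.
Context {d : measure_display} {T : measurableType d} {R : realType}.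

(** A is the union of the countably many boxes with rational centres and
    radii, in the coordinates X, that are contained in A. Only the values
    taken by X matter, so nothing is required of the set in which X lives. *)
Lemma measurable_locally_determined (I : finType) (X : I -> T -> R) (A : set T) :
  (forall i, measurable_fun setT (X i)) ->
  (forall w, A w -> exists2 r : R, 0 < r &
     forall w', (forall i, `|X i w' - X i w| < r) -> A w') ->
  measurable A.
Proof.
move=> mX locA.
pose box (b : {ffun I -> rat} * rat) : set T :=
  \bigcap_(i in [set: I]) [set w | `|X i w - ratr (b.1 i)| < ratr b.2 :> R].
have mbox b : measurable (box b).
  apply: fin_bigcap_measurable => [|i _]; first exact: finite_finset.
  suff -> : [set w | `|X i w - ratr (b.1 i)| < ratr b.2] =
      setT `&` X i @^-1` `]ratr (b.1 i) - ratr b.2, ratr (b.1 i) + ratr b.2[.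
    exact: mX.
  apply/seteqP; split => w /=; rewrite in_itv/= -ltr_distl; first by [].
  by case.
pose F k : set T := if @unpickle ({ffun I -> rat} * rat)%type k is Some b then
  (if `[< box b `<=` A >] then box b else set0) else set0.
suff -> : A = \bigcup_k F k.
  apply: bigcupT_measurable => k; rewrite /F; case: unpickle => // b.
  by case: ifP => // _; exact: measurable0.
apply/seteqP; split=> [w Aw|w [k _]]; last first.
  by rewrite /F; case: unpickle => // b; case: ifP => // /asboolP; exact.
have [r r0 rP] := locA w Aw.
have [rho] := rat_in_itvoo (divr_gt0 r0 (ltr0n R 2)).
rewrite in_itv/= => /andP[rho0 rhor].
have cand i : exists q : rat, `|X i w - ratr q| < ratr rho :> R.
  have [q] := @rat_in_itvoo R (X i w - ratr rho) (X i w + ratr rho) ltac:(lra).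
  rewrite in_itv/= => /andP[q1 q2]; exists q.
  by rewrite distrC ltr_distl q1.
have [b bP] := choice cand.
(* two points of the box are at distance less than 2 rho < r in each
   coordinate *)
pose B := ([ffun i => b i] : {ffun I -> rat}, rho).
have wB : box B w by move=> i _ /=; rewrite ffunE; exact: bP.
have BA : box B `<=` A.
  move=> w' w'B; apply: rP => i; have := w'B i Logic.I.
  rewrite /= ffunE => h; have := bP i; rewrite (distrC (X i w)) => h'.
  have := ler_normD (X i w' - ratr (b i)) (ratr (b i) - X i w).
  rewrite addrA subrK; lra.
exists (pickle B) => //; rewrite /F pickleK.
by case: ifPn => // /asboolP.
Qed.

Lemma measurable_fun_of_coords (I : finType) (X : I -> T -> R) (f : T -> R) :
  (forall i, measurable_fun setT (X i)) ->
  (forall w e, 0 < e -> exists2 r : R, 0 < r &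
     forall w', (forall i, `|X i w' - X i w| < r) -> `|f w' - f w| < e) ->
  measurable_fun setT f.
Proof.
move=> mX locf; apply: (measurability _ (measurable_realfun.RGenOpens.measurableE R)).
move=> _ [_ [a [b ->] <-]]; apply: (measurable_locally_determined mX).
move=> w [_ /=]; rewrite in_itv/= => /andP[aw wb].
have e0 : 0 < Num.min (f w - a) (b - f w) by rewrite lt_min !subr_gt0 aw.
have [r r0 rP] := locf w _ e0.
exists r => // w' /rP; rewrite lt_min => /andP[h1 h2]; split => //=.
rewrite in_itv/=; move: h1 h2; rewrite !ltr_norml => /andP[? ?] /andP[? ?].
by apply/andP; split; lra.
Qed.

Definition measurable_entries p q (X : T -> 'M[R]_(p, q)) :=
  forall i j, measurable_fun setT (fun w => X w i j).

Lemma measurable_entriesP p q (X : T -> 'M[R]_(p, q)) :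
  sigma_of X `<=` measurable <-> measurable_entries X.
Proof.
split=> [XB i j|mX].
  apply: (measurability _ (measurable_realfun.RGenOpens.measurableE R)).
  move=> _ [_ [a [b ->] <-]]; apply: XB.
  exists ((fun M : 'M[R]_(p, q) => M i j) @^-1` `]a, b[%classic) => //.
  apply: sub_sigma_algebra.
  move: (interval_open (a := BSide false a) (b := BSide true b) isT isT).
  apply: open_comp => M _; exact: coord_continuous.
have -> : sigma_of X = preimage_set_system setT X (borel_sets (T := 'M[R]_(p, q))).
  by [].
suff : borel_sets (T := 'M[R]_(p, q)) `<=` [set A | measurable (X @^-1` A)].
  by move=> h _ [A /h mA <-]; rewrite setTI.
apply: smallest_sub.
  split => [|A mA|F mF] /=.
  - by rewrite preimage_set0.
  - by rewrite setTD preimage_setC; exact: measurableC.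
  - by rewrite preimage_bigcup; exact: bigcupT_measurable.
move=> A oA /=.
apply: (measurable_locally_determined (I := ('I_p * 'I_q)%type)
  (X := fun k w => X w k.1 k.2)) => [k|w /= Aw]; first exact: mX.
have /nbhs_ballP[r /= r0 rA] := open_nbhs_nbhs (conj oA Aw).
exists r => // w' h; apply: rA; split => // i j.
by have := h (i, j); rewrite /= distrC.
Qed.

End coordinate_measurability.

Section entries_closure.
Context {d : measure_display} {T : measurableType d} {R : realType}.

Lemma measurable_entriesD p q (X Y : T -> 'M[R]_(p, q)) :
  measurable_entries X -> measurable_entries Y ->
  measurable_entries (fun w => X w + Y w).
Proof.
move=> mX mY i j.
have -> : (fun w => (X w + Y w) i j) = (fun w => X w i j) \+ (fun w => Y w i j).
  by apply/funext => w; rewrite mxE.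
exact: measurable_funD.
Qed.

Lemma measurable_entriesM p q r (X : T -> 'M[R]_(p, q)) (Y : T -> 'M[R]_(q, r)) :
  measurable_entries X -> measurable_entries Y ->
  measurable_entries (fun w => X w *m Y w).
Proof.
move=> mX mY i j.
have -> : (fun w => (X w *m Y w) i j) = (fun w => \sum_k X w i k * Y w k j).
  by apply/funext => w; rewrite mxE.
by apply: measurable_sum => k; exact: measurable_funM.
Qed.

Lemma measurable_entriesZ p q (b : T -> R) (X : T -> 'M[R]_(p, q)) :
  measurable_fun setT b -> measurable_entries X ->
  measurable_entries (fun w => b w *: X w).
Proof.
move=> mb mX i j.
have -> : (fun w => (b w *: X w) i j) = (fun w => b w * X w i j).
  by apply/funext => w; rewrite mxE.
exact: measurable_funM.
Qed.

Lemma measurable_entries_cst p q (A : 'M[R]_(p, q)) :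
  measurable_entries (fun _ : T => A).
Proof. by move=> i j; exact: measurable_cst. Qed.

Lemma measurable_entriesB p q (X Y : T -> 'M[R]_(p, q)) :
  measurable_entries X -> measurable_entries Y ->
  measurable_entries (fun w => X w - Y w).
Proof.
move=> mX mY; have -> : (fun w => X w - Y w) = (fun w => X w + (-1) *: Y w).
  by apply/funext => w; rewrite scaleN1r.
by apply: measurable_entriesD => //; apply: measurable_entriesZ => //;
  exact: measurable_cst.
Qed.

Lemma measurable_entries_sum p q I (s : seq I) (X : I -> T -> 'M[R]_(p, q)) :
  (forall i, measurable_entries (X i)) ->
  measurable_entries (fun w => \sum_(i <- s) X i w).
Proof.
move=> mX i j.
have -> : (fun w => (\sum_(k <- s) X k w) i j) = (fun w => \sum_(k <- s) X k w i j).
  by apply/funext => w; rewrite summxE.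
by apply: measurable_sum => k; exact: mX.
Qed.

Lemma measurable_noisy dn p q (A : T -> 'M[R]_(p, q))
    (S : 'I_dn -> T -> 'M[R]_(p, q)) (beta : T -> 'cV[R]_dn) :
  measurable_entries A -> (forall i, measurable_entries (S i)) ->
  measurable_entries beta ->
  measurable_entries (fun w => noisy (A w) (fun i => S i w) (beta w)).
Proof.
move=> mA mS mb; apply: measurable_entriesD => //.
by apply: measurable_entries_sum => i; apply: measurable_entriesZ.
Qed.

Lemma measurable_enorm p q (X : T -> 'M[R]_(p, q)) :
  measurable_entries X -> measurable_fun setT (fun w => enorm (X w)).
Proof.
move=> mX; have -> : (fun w => enorm (X w)) =
    @Num.sqrt R \o (fun w => \sum_(k : 'I_p * 'I_q) X w k.1 k.2 ^+ 2).
  by apply/funext => w; rewrite enormE.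
have msqrt : measurable_fun [set: R] (@Num.sqrt R).
  by apply: continuous_measurable_fun; exact: sqrt_continuous.
apply: (measurableT_comp msqrt).
by apply: measurable_sum => k; apply: measurable_funX; exact: mX.
Qed.

Lemma measurable_noise_weight dn (beta : T -> 'cV[R]_dn) :
  measurable_entries beta ->
  measurable_fun setT (fun w => noise_weight (beta w)).
Proof.
move=> mb; apply: measurable_funD; first exact: measurable_cst.
apply: measurable_sum => i.
apply: (measurableT_comp (@normr_measurable R setT)); exact: mb.
Qed.

Context {n m p q : nat}.

Definition enorm_continuous_on (V : set 'cV[R]_m)
    (G : 'cV[R]_n -> 'cV[R]_m -> 'M[R]_(p, q)) :=
  forall x v, V v -> forall e, 0 < e -> exists2 r : R, 0 < r &
    forall x' v', V v' -> enorm (x' - x) + enorm (v' - v) < r ->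
      enorm (G x' v' - G x v) < e.

(** G is continuous relative to V only, and a convex set V may fail to be a
    Borel set; hence the measurability is read on T, where the preimages are
    locally determined, and does not come from a composition of Borel maps. *)
Lemma measurable_entries_comp V (G : 'cV[R]_n -> 'cV[R]_m -> 'M[R]_(p, q))
    (X : T -> 'cV[R]_n) (Y : T -> 'cV[R]_m) :
  enorm_continuous_on V G -> measurable_entries X -> measurable_entries Y ->
  (forall w, V (Y w)) -> measurable_entries (fun w => G (X w) (Y w)).
Proof.
move=> cG mX mY VY i j.
pose I := (('I_n * 'I_1) + ('I_m * 'I_1))%type.
pose Z (k : I) w := match k with inl k => X w k.1 k.2 | inr k => Y w k.1 k.2 end.
apply: (measurable_fun_of_coords (I := I) (X := Z)) => [[k|k]|w e e0].
- exact: mX.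
- exact: mY.
have [r r0 rP] := cG (X w) (Y w) (VY w) e e0.
(* the norms are at most the sums of the n and of the m entries; the extra 1
   avoids a division by 0 *)
have K0 : 0 < (n + m)%:R + 1 :> R by rewrite ltr_pwDr.
exists (r / ((n + m)%:R + 1)); first exact: divr_gt0.
move=> w' close.
have bnd k (F : 'cV[R]_k) : (forall l, `|F l.1 l.2| <= r / ((n + m)%:R + 1)) ->
    enorm F <= k%:R * (r / ((n + m)%:R + 1)).
  move=> Fle; apply: le_trans (enorm_le_sum_entries _) _.
  apply: le_trans (ler_sum _ (fun l _ => Fle l)) _.
  by rewrite sumr_const card_prod !card_ord muln1 mulr_natl.
have := rP (X w') (Y w') (VY w').
have : enorm (X w' - X w) + enorm (Y w' - Y w) < r.
  apply: (@le_lt_trans _ _ ((n + m)%:R * (r / ((n + m)%:R + 1)))).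
    rewrite [X in _ <= X * _]natrD mulrDl.
    apply: lerD; apply: bnd => l; rewrite !mxE; apply: ltW.
      exact: (close (inl l)).
    exact: (close (inr l)).
  by rewrite mulrCA gtr_pMr// ltr_pdivrMr// mul1r ltrDl.
move=> xr /(_ xr); apply: le_lt_trans.
by have := ler_entry_enorm (G (X w') (Y w') - G (X w) (Y w)) i j; rewrite !mxE.
Qed.

End entries_closure.

Lemma jacobian_continuous (R : realType) n m p V (g : 'cV[R]_n -> 'cV[R]_m -> 'cV[R]_p)
    gx gu :
  (forall x v, V v -> is_jacobian_on V g x v (gx x v) (gu x v)) ->
  enorm_continuous_on V g.
Proof.
move=> J x v Vv e e0; have [r1 r10 r1P] := J x v Vv 1 ltr01.
(* K is a local Lipschitz constant: the two Jacobians, and 1 for the remainder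
   *)
pose K := 1 + (enorm (gx x v) + enorm (gu x v)).
have K0 : 0 < K by rewrite ltr_pwDl// addr_ge0 ?enorm_ge0.
exists (Num.min r1 (e / K)); first by rewrite lt_min r10 divr_gt0.
move=> x' v' Vv'; rewrite lt_min => /andP[/(r1P x' v' Vv')].
set D := enorm _ + enorm _; set lin := _ *m _ + _ => h.
rewrite ltr_pdivlMr// => DK.
rewrite -[_ - _](subrK lin); apply: le_lt_trans (ler_enormD _ _) _.
apply: le_lt_trans DK; rewrite mulrC mulrDl mul1r; apply: lerD.
  by rewrite mul1r in h.
apply: le_trans (ler_enormD _ _) _.
rewrite mulrDl; apply: lerD; apply: le_trans (ler_enormM _ _) _;
  rewrite ler_wpM2l ?enorm_ge0//.
  by rewrite lerDl enorm_ge0.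
by rewrite lerDr enorm_ge0.
Qed.

Lemma unif_cont_continuous (R : realType) n m p q V psi
    (g : 'cV[R]_n -> 'cV[R]_m -> 'M[R]_(p, q)) :
  modulus psi -> unif_cont_on V psi g -> enorm_continuous_on V g.
Proof.
move=> psim uc x v Vv e e0; have [r r0 rP] := modulus_small psim e0.
exists r => // x' v' Vv' xr; apply: le_lt_trans (uc _ _ _ _ Vv' Vv) _.
by apply: rP => //; rewrite addr_ge0 ?enorm_ge0.
Qed.

Section random_state_measurability.
Context {R : realType} {disp : measure_display} {Omega : measurableType disp}.
Context {Gam : pmetricType R} {n m d : nat} (N : nat).
Context (B : nat -> Omega -> 'cV[R]_d) (U : nat -> set 'cV[R]_m).
Context (c : coefs R Gam n m d) (a : nat -> 'cV[R]_m) (x0 : 'cV[R]_n) (L : R).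
Implicit Types (u us : control R Omega m) (w : Omega) (g : Gam) (k : nat).
Hypothesis h1 : H1 N U c a L.
Hypothesis h2 : H2 N U c a L.
Variable psi : R -> R.
Hypothesis psi_modulus : modulus psi.
Hypothesis psi_coefs : coefs_modulus N U c psi.
Let psi_coef := psi_coefs.1.
Let psi_phi := psi_coefs.2.
Hypothesis mB : forall k, (1 <= k <= N)%N -> measurable_entries (B k).

Definition measurable_control u :=
  forall k, (k < N)%N -> measurable_entries (u k).

Lemma measurable_state u g k : takes_values N U u -> measurable_control u ->
  (k <= N)%N -> measurable_entries (fun w => state B c x0 u g k w).
Proof.
move=> uU mu; elim: k => [_|k ih kN]; first exact: measurable_entries_cst.
have -> : (fun w => state B c x0 u g k.+1 w) = (fun w =>
    step c g k (B k.+1 w) (state B c x0 u g k w) (u k w)).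
  by apply/funext => w; exact: state_succ.
have [_ [bJ _ _] sJ _ _] := h1 g kN.
have mx := ih (ltnW kN).
apply: measurable_noisy => [|i|]; last exact: mB.
  by apply: (measurable_entries_comp (jacobian_continuous bJ) mx (mu k kN)) => w;
    exact: uU.
have [sJi _ _] := sJ i.
by apply: (measurable_entries_comp (jacobian_continuous sJi) mx (mu k kN)) => w;
  exact: uU.
Qed.

Lemma measurable_xbar us u g k : takes_values N U us -> measurable_control us ->
  measurable_control u -> (k <= N)%N ->
  measurable_entries (fun w => xbar B c x0 us u g k w).
Proof.
move=> usU mus mu; elim: k => [_|k ih kN]; first exact: measurable_entries_cst.
have -> : (fun w => xbar B c x0 us u g k.+1 w) = (fun w =>
  step_x c g k (B k.+1 w) (state B c x0 us g k w) (us k w) *m xbar B c x0 us u g k w +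
  step_u c g k (B k.+1 w) (state B c x0 us g k w) (us k w) *m (u k w - us k w)).
  by apply/funext => w; exact: xbar_succ.
have mx := measurable_state g usU mus (ltnW kN).
have [bx bu sxu _ _] := psi_coef g kN.
have comp p q (G : 'cV[R]_n -> 'cV[R]_m -> 'M[R]_(p, q)) :
    unif_cont_on (U k) psi G ->
    measurable_entries (fun w => G (state B c x0 us g k w) (us k w)).
  move=> /(unif_cont_continuous psi_modulus) cG.
  by apply: (measurable_entries_comp cG mx (mus k kN)) => w; exact: usU.
apply: measurable_entriesD; apply: measurable_entriesM.
- apply: measurable_noisy => [|i|]; [exact: comp| |exact: mB].
  by case: (sxu i) => ? ?; exact: comp.
- by apply: ih; exact: ltnW.
- apply: measurable_noisy => [|i|]; [exact: comp| |exact: mB].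
  by case: (sxu i) => ? ?; exact: comp.
- by apply: measurable_entriesB; [exact: mu|exact: mus].
Qed.

Lemma measurable_cost u g : takes_values N U u -> measurable_control u ->
  measurable_fun setT (cost N B c x0 u g).
Proof.
move=> uU mu; apply: measurable_funD.
  have -> : (fun w => \sum_(0 <= k < N) cf c g k (state B c x0 u g k w) (u k w)) =
    (fun w => \sum_(k <- index_iota 0 N)
       if (k < N)%N then cf c g k (state B c x0 u g k w) (u k w) else 0).
    by apply/funext => w; rewrite !big_nat; apply: eq_bigr => k /andP[_ ->].
  apply: measurable_sum => k.
  case: (boolP (k < N)%N) => [kN|_]; last exact: measurable_cst.
  have [_ [fJ _ _] _] := h2.1 g k kN.
  have mx := measurable_state g uU mu (ltnW kN).
  have := measurable_entries_comp (jacobian_continuous fJ) mx (mu k kN).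
  move=> /(_ (fun w => uU k w kN) 0 0).
  by under eq_fun do rewrite !mxE eqxx mulr1n.
have mx := measurable_state g uU mu (leqnn N).
have J (x : 'cV[R]_n) (v : 'cV[R]_m) : setT v -> is_jacobian_on setT
    (fun y (_ : 'cV[R]_m) => (cphi c g y)%:M) x v (cphi_x c g x) (0 : 'M[R]_(1, m)).
  by move=> _; apply: is_jacobian_on_diff; have [] := h2.2 g.
have := measurable_entries_comp (jacobian_continuous J) mx
  (measurable_entries_cst 0) (fun=> Logic.I) 0 0.
by under eq_fun do rewrite !mxE eqxx mulr1n.
Qed.

Lemma measurable_cost_derivative us u g : takes_values N U us ->
  measurable_control us -> measurable_control u ->
  measurable_fun setT (cost_derivative N B c x0 us u g).
Proof.
move=> usU mus mu; apply: measurable_funD.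
  pose F k w := (cf_x c g k (state B c x0 us g k w) (us k w)
    *m xbar B c x0 us u g k w
    + cf_u c g k (state B c x0 us g k w) (us k w) *m (u k w - us k w)) 0 0.
  have -> : (fun w => \sum_(0 <= k < N) F k w) =
    (fun w => \sum_(k <- index_iota 0 N) if (k < N)%N then F k w else 0).
    by apply/funext => w; rewrite !big_nat; apply: eq_bigr => k /andP[_ ->].
  apply: measurable_sum => k.
  case: (boolP (k < N)%N) => [kN|_]; last exact: measurable_cst.
  have [_ _ _ fx fu] := psi_coef g kN.
  have mx := measurable_state g usU mus (ltnW kN).
  have comp p q (G : 'cV[R]_n -> 'cV[R]_m -> 'M[R]_(p, q)) :
      unif_cont_on (U k) psi G ->
      measurable_entries (fun w => G (state B c x0 us g k w) (us k w)).
    move=> /(unif_cont_continuous psi_modulus) cG.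
    by apply: (measurable_entries_comp cG mx (mus k kN)) => w; exact: usU.
  apply: measurable_entriesD; apply: measurable_entriesM.
  - exact: comp.
  - by apply: measurable_xbar => //; exact: ltnW.
  - exact: comp.
  - by apply: measurable_entriesB; [exact: mu|exact: mus].
have mx := measurable_state g usU mus (leqnn N).
apply: measurable_entriesM; last exact: measurable_xbar.
have uc : unif_cont_on [set: 'cV[R]_m] psi (fun y (_ : 'cV[R]_m) => cphi_x c g y).
  move=> y y' v v' _ _; apply: le_trans (psi_phi _ _ _) _.
  by apply: (modulus_nondecr psi_modulus); rewrite ?enorm_ge0// lerDl enorm_ge0.
exact: (measurable_entries_comp (unif_cont_continuous psi_modulus uc) mx
  (measurable_entries_cst (0 : 'cV[R]_m)) (fun=> Logic.I)).
Qed.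

End random_state_measurability.

(** * Independence of the past and the next noise *)

Section independence.
Context {R : realType} {disp : measure_display} {Omega : measurableType disp}.
Variable P : probability Omega R.

(** The joint law of X and Y is the product of their laws, and Tonelli's
    theorem splits the integral of the product of the coordinates. *)
Lemma integral_mul_independent (X Y : Omega -> R) :
  measurable_fun setT X -> measurable_fun setT Y ->
  (forall w, 0 <= X w) -> (forall w, 0 <= Y w) ->
  (forall A C, measurable A -> measurable C ->
     P (X @^-1` A `&` Y @^-1` C) = P (X @^-1` A) * P (Y @^-1` C))%E ->
  (\int[P]_w (X w * Y w)%:E = \int[P]_w (X w)%:E * \int[P]_w (Y w)%:E)%E.
Proof.
move=> mX mY X0 Y0 indep.
pose X' : {mfun Omega >-> R} := HB.pack X (isMeasurableFun.Build _ _ _ _ X mX).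
pose Y' : {mfun Omega >-> R} := HB.pack Y (isMeasurableFun.Build _ _ _ _ Y mY).
have mXY : measurable_fun setT (fun w => (X w, Y w)) by exact: measurable_fun_pair.
pose Z : {mfun Omega >-> (R * R)%type} :=
  HB.pack (fun w => (X w, Y w)) (isMeasurableFun.Build _ _ _ _ _ mXY).
pose mu := distribution P X'; pose nu := distribution P Y'.
have prodE : forall S, measurable S -> (mu \x nu)%E S = distribution P Z S.
  by apply: product_measure_unique => A C mA mC; exact: indep.
pose f (z : R * R) : \bar R := (`|z.1| * `|z.2|)%:E.
have mf : measurable_fun setT f.
  apply/measurable_EFinP; apply: measurable_funM; exact: measurableT_comp.
have f0 z : (0 <= f z)%E by rewrite lee_fin mulr_ge0.
have -> : (\int[P]_w (X w * Y w)%:E = \int[distribution P Z]_z f z)%E.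
  rewrite ge0_integral_distribution//; apply: eq_integral => w _.
  by rewrite /f /= !ger0_norm.
rewrite (eq_measure_integral (mu \x nu)%E); last first.
  by move=> S mS _; exact/esym/prodE.
rewrite fubini_tonelli1//; rewrite /fubini_F.
under eq_integral.
  move=> x _.
  have -> : (\int[nu]_y f (x, y) = `|x|%:E * \int[nu]_y `|y|%:E)%E.
    rewrite /f /= -ge0_integralZl_EFin//.
    by apply/measurable_EFinP.
  over.
rewrite ge0_integralZr//; last 2 first.
- by apply/measurable_EFinP.
- by apply: integral_ge0 => y _; rewrite lee_fin.
rewrite !ge0_integral_distribution//; last 2 first.
- by apply/measurable_EFinP.
- by apply/measurable_EFinP.
by congr (_ * _)%E; apply: eq_integral => w _; rewrite /= ger0_norm.
Qed.

Context {d : nat} (N : nat) (B : nat -> Omega -> 'cV[R]_d).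
Hypothesis B_random : random_noise N B.
Hypothesis B_indep : independent_noise P N B.

Let past_box k := [set A : set Omega | exists2 F : nat -> set 'cV[R]_d,
  (forall j, borel_sets (F j)) &
  A = \bigcap_(j in [set j | (1 <= j <= k)%N]) (B j @^-1` F j)].

Lemma borel_setsT (T : topologicalType) : borel_sets [set: T].
Proof. by apply: sub_sigma_algebra; exact: openT. Qed.

Lemma borel_setsI (T : ptopologicalType) (A C : set T) :
  borel_sets A -> borel_sets C -> borel_sets (A `&` C).
Proof. exact: (@measurableI _ (g_sigma_algebraType (@open T))). Qed.

Lemma noise_preimage_measurable j (F : set 'cV[R]_d) : (1 <= j <= N)%N ->
  borel_sets F -> measurable (B j @^-1` F).
Proof. by move=> jN bF; apply: (B_random jN); exists F => //; rewrite setTI. Qed.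

Lemma past_box_measurable k : (k <= N)%N -> past_box k `<=` measurable.
Proof.
move=> kN _ [F bF ->]; apply: fin_bigcap_measurable.
  apply: (@sub_finite_set _ _ `I_k.+1); last exact: finite_II.
  by move=> j /=; rewrite ltnS => /andP[].
by move=> j /andP[j1 jk]; apply: noise_preimage_measurable => //;
  rewrite j1 (leq_trans jk kN).
Qed.

(** Put the set D at time k + 1 and the whole space at later times: the
    product rule says that the probability is kappa P (B_(k+1) in D), with a
    factor kappa that does not depend on D. The choice of the whole space for
    D shows that kappa is the probability of the past event. *)
Lemma past_box_indep k A (C : set 'cV[R]_d) : (k < N)%N -> past_box k A ->
  borel_sets C -> (P (A `&` B k.+1 @^-1` C) = P A * P (B k.+1 @^-1` C))%E.
Proof.
move=> kN [F bF ->] bC.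
pose F' (D : set 'cV[R]_d) j :=
  if (j <= k)%N then F j else if j == k.+1 then D else setT.
have inter D : \bigcap_(j in [set j | (1 <= j <= N)%N]) (B j @^-1` F' D j) =
    \bigcap_(j in [set j | (1 <= j <= k)%N]) (B j @^-1` F j) `&` B k.+1 @^-1` D.
  apply/seteqP; split=> w.
    move=> h; split; last by have := h k.+1 kN; rewrite /F' ltnn eqxx.
    move=> j /andP[j1 jk]; have := h j; rewrite /F' jk; apply.
    by rewrite /= j1 (leq_trans jk (ltnW kN)).
  move=> [h hD] j /andP[j1 jN]; rewrite /F' /=.
  case: ifPn => jk; first by apply: h; rewrite /= j1.
  by case: eqP => [->|].
pose kappa := \prod_(1 <= j < N.+1 | j != k.+1) fine (P (B j @^-1` F' setT j)).
have key D : borel_sets D ->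
    P (\bigcap_(j in [set j | (1 <= j <= k)%N]) (B j @^-1` F j) `&` B k.+1 @^-1` D)
    = (kappa%:E * P (B k.+1 @^-1` D))%E.
  move=> bD; rewrite -inter.
  have bF' j : borel_sets (F' D j).
    by rewrite /F'; case: ifP => // _; case: ifP => // _; exact: borel_setsT.
  have mI : measurable (\bigcap_(j in [set j | (1 <= j <= N)%N]) (B j @^-1` F' D j)).
    by apply: (past_box_measurable (leqnn N)); exists (F' D).
  rewrite -[LHS]fineK ?fin_num_measure// (B_indep (A := F' D))//.
  rewrite (bigD1_seq k.+1) ?mem_index_iota ?ltnS ?iota_uniq//=.
  rewrite /F' ltnn eqxx mulrC EFinM fineK; last first.
    rewrite fin_num_measure//; exact: noise_preimage_measurable.
  congr (_%:E * _)%E; apply: eq_bigr => j jk.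
  by rewrite /F' (negbTE jk).
rewrite key//; have := key setT (@borel_setsT _).
rewrite preimage_setT setIT probability_setT mule1 => ->.
by [].
Qed.

Lemma past_box_setI_closed k : setI_closed (past_box k).
Proof.
move=> _ _ [F1 bF1 ->] [F2 bF2 ->]; exists (fun j => F1 j `&` F2 j).
  by move=> j; exact: borel_setsI.
apply/seteqP; split=> w.
  by move=> [h1 h2] j jk; split; [exact: h1|exact: h2].
by move=> h; split=> j jk; have [] := h j jk.
Qed.

Lemma filtration_past_box k : filtration B k `<=` <<s past_box k >>.
Proof.
apply: smallest_sub; first exact: smallest_sigma_algebra.
move=> _ [j jk [F bF <-]]; apply: sub_sigma_algebra.
exists (fun i => if i == j then F else setT).
  by move=> i; case: ifP => // _; exact: borel_setsT.
rewrite setTI; apply/seteqP; split=> w.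
  by move=> wF i _ /=; case: eqP => [->|].
by move=> /(_ j jk); rewrite /= eqxx.
Qed.

Lemma filtration_measurable k : (k <= N)%N -> filtration B k `<=` measurable.
Proof.
move=> kN; apply: subset_trans (@filtration_past_box k) _.
apply: smallest_sub; first exact: sigma_algebra_measurable.
exact: past_box_measurable.
Qed.

(** Both sides are finite measures of A which agree on the boxes of the past,
    a family closed under intersection that generates the filtration. *)
Lemma filtration_indep k A (C : set 'cV[R]_d) : (k < N)%N -> filtration B k A ->
  borel_sets C -> (P (A `&` B k.+1 @^-1` C) = P A * P (B k.+1 @^-1` C))%E.
Proof.
move=> kN FA bC; have mC : measurable (B k.+1 @^-1` C).
  exact: noise_preimage_measurable.
have PC : (fine (P (B k.+1 @^-1` C)))%:E = P (B k.+1 @^-1` C).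
  by rewrite fineK// fin_num_measure.
have t0 : 0 <= fine (P (B k.+1 @^-1` C)) by rewrite fine_ge0.
pose t := NngNum t0.
have mscaleE D : mscale t P D = (P D * P (B k.+1 @^-1` C))%E.
  by rewrite -PC muleC.
rewrite -mscaleE; apply: (@g_sigma_algebra_measure_unique _ R _ (past_box k)
  (past_box_measurable (ltnW kN)) (fun=> setT) _ _ (mrestr P mC) (mscale t P)
  (@past_box_setI_closed k) _ _ A (filtration_past_box FA)).
- move=> _; exists (fun=> setT); first by move=> j; exact: borel_setsT.
  by apply/seteqP; split.
- by rewrite bigcup_const//; exists 0%N.
- by move=> D /(past_box_indep kN)/(_ bC) h; exact: etrans h (esym (mscaleE D)).
- by move=> _; rewrite /= /mrestr setTI ltey_eq fin_num_measure.
Qed.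

End independence.

Section square_integrable.
Context {R : realType} {disp : measure_display} {Omega : measurableType disp}.
Variable P : probability Omega R.
Implicit Types X Y : Omega -> R.

Definition L1 X := P.-integrable setT (EFin \o X).

Definition L2 X :=
  measurable_fun setT X /\ L1 (fun w => X w ^+ 2).

Lemma L1D X Y : L1 X -> L1 Y -> L1 (fun w => X w + Y w).
Proof. exact: integrableD. Qed.

Lemma L1Z b X : L1 X -> L1 (fun w => b * X w).
Proof. exact: integrableZl. Qed.

Lemma L1_cst b : L1 (fun=> b).
Proof. exact: finite_measure_integrable_cst. Qed.

Lemma le_L1 X Y : measurable_fun setT X ->
  (forall w, `|X w| <= Y w) -> L1 Y -> L1 X.
Proof.
move=> mX XY; apply: le_integrable => //; first exact/measurable_EFinP.
by move=> w _ /=; rewrite lee_fin (le_trans (XY w))// ler_norm.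
Qed.

Lemma L1_measurable X : L1 X -> measurable_fun setT X.
Proof. by move=> /measurable_int/measurable_EFinP. Qed.

Lemma L2D X Y : L2 X -> L2 Y ->
  L2 (fun w => X w + Y w).
Proof.
move=> [mX sX] [mY sY]; split; first exact: measurable_funD.
apply: (le_L1 (Y := fun w => 2 * X w ^+ 2 + 2 * Y w ^+ 2)).
- by apply: measurable_funX; exact: measurable_funD.
- move=> w; rewrite ger0_norm ?sqr_ge0//.
  have := sqr_ge0 (X w - Y w); nra.
- by apply: L1D; exact: L1Z.
Qed.

Lemma L2Z b X : L2 X ->
  L2 (fun w => b * X w).
Proof.
move=> [mX sX]; split; first by apply: measurable_funM.
by under [X in L1 X]eq_fun do rewrite exprMn; exact: L1Z.
Qed.

Lemma L2_cst b : L2 (fun=> b).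
Proof. by split; [exact: measurable_cst|exact: L1_cst]. Qed.

Lemma L1M X Y : L2 X -> L2 Y ->
  L1 (fun w => X w * Y w).
Proof.
move=> [mX sX] [mY sY].
apply: (le_L1 (Y := fun w => X w ^+ 2 + Y w ^+ 2)).
- exact: measurable_funM.
- move=> w; rewrite ler_norml.
  have := sqr_ge0 (X w - Y w); have := sqr_ge0 (X w + Y w); nra.
- exact: L1D.
Qed.

Lemma le_L2 X Y : measurable_fun setT X ->
  (forall w, `|X w| <= Y w) -> L2 Y -> L2 X.
Proof.
move=> mX XY [mY sY]; split => //.
apply: (le_L1 (Y := fun w => Y w ^+ 2)) => //.
  exact: measurable_funX.
move=> w; rewrite normrX ler_pXn2r ?nnegrE//.
exact: le_trans (normr_ge0 _) (XY w).
Qed.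

Lemma L2_powR X p : 2 <= p -> measurable_fun setT X ->
  (forall w, 0 <= X w) -> L1 (fun w => X w `^ p) -> L2 X.
Proof.
move=> p2 mX X0 sX; split => //.
apply: (le_L1 (Y := fun w => 1 + X w `^ p)).
- exact: measurable_funX.
- move=> w; rewrite ger0_norm ?sqr_ge0//.
  have [X1|X1] := leP (X w) 1.
    apply: (@le_trans _ _ 1); first by rewrite exprn_ile1.
    by rewrite lerDl powR_ge0.
  apply: (@le_trans _ _ (X w `^ p)); last by rewrite lerDr.
  by rewrite -powR_mulrn// ler_powR// ltW.
- by apply: L1D => //; exact: L1_cst.
Qed.

(** A product of two square integrable variables is in general only
    integrable; independence is what allows one more step of the recursion
    without asking for more moments. *)
Lemma L2M_independent X Y :
  L2 X -> L2 Y ->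
  (forall w, 0 <= X w) -> (forall w, 0 <= Y w) ->
  (forall A C, measurable A -> measurable C ->
     P (X @^-1` A `&` Y @^-1` C) = P (X @^-1` A) * P (Y @^-1` C))%E ->
  L2 (fun w => X w * Y w).
Proof.
move=> [mX sX] [mY sY] X0 Y0 indep; split; first exact: measurable_funM.
have mX2 : measurable_fun setT (fun w => X w ^+ 2) by exact: measurable_funX.
have mY2 : measurable_fun setT (fun w => Y w ^+ 2) by exact: measurable_funX.
apply/integrableP; split.
  by apply/measurable_EFinP/measurable_funX/measurable_funM.
have -> : (\int[P]_w `|(EFin \o (fun w => ((X w * Y w) ^+ 2)%R)) w| =
    \int[P]_w (X w ^+ 2 * Y w ^+ 2)%:E)%E.
  by apply: eq_integral => w _ /=; rewrite exprMn ger0_norm// mulr_ge0 ?sqr_ge0.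
rewrite integral_mul_independent//.
- have fin Z : L1 (fun w => Z w ^+ 2) ->
      (\int[P]_w (Z w ^+ 2)%:E \is a fin_num)%E.
    by move=> sZ; exact: integrable_fin_num.
  by rewrite -ge0_fin_numE ?mule_ge0 ?integral_ge0// ?fin_numM ?fin// => w _;
    rewrite lee_fin sqr_ge0.
- by move=> w; exact: sqr_ge0.
- by move=> w; exact: sqr_ge0.
- move=> A C mA mC.
  have msq : measurable_fun setT (fun x : R => x ^+ 2) by exact: exprn_measurable.
  have := indep _ _ (msq measurableT _ mA) (msq measurableT _ mC).
  by rewrite !setTI.
Qed.

End square_integrable.

(** * Square integrability of the dominating processes *)

Section finite_sums.
Context {R : realType} {disp : measure_display} {Omega : measurableType disp}.
Variable P : probability Omega R.

Lemma L1_sum_nat N (X : nat -> Omega -> R) :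
  (forall k, (k < N)%N -> L1 P (X k)) ->
  L1 P (fun w => \sum_(0 <= k < N) X k w).
Proof.
elim: N => [_|N ih sX].
  by under eq_fun do rewrite big_geq//; exact: L1_cst.
under eq_fun do rewrite big_nat_recr//=.
by apply: L1D; [apply: ih => k kN; exact/sX/ltnW|exact: sX].
Qed.

Lemma measurable_sum_nat N (X : nat -> Omega -> R) :
  (forall k, (k < N)%N -> measurable_fun setT (X k)) ->
  measurable_fun setT (fun w => \sum_(0 <= k < N) X k w).
Proof.
elim: N => [_|N ih sX].
  by under eq_fun do rewrite big_geq//; exact: measurable_cst.
under eq_fun do rewrite big_nat_recr//=.
by apply: measurable_funD; [apply: ih => k kN; exact/sX/ltnW|exact: sX].
Qed.

End finite_sums.

Section domination.
Context {R : realType} {disp : measure_display} {Omega : measurableType disp}.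
Context (P : probability Omega R) {d m : nat} (N : nat).
Context (B : nat -> Omega -> 'cV[R]_d) (U : nat -> set 'cV[R]_m).
Context (p q L : R).
Hypothesis p_ge2 : 2 <= p.
Hypothesis q_gt2 : 2 < q.
Hypothesis L_ge0 : 0 <= L.
Hypothesis B_random : random_noise N B.
Hypothesis B_indep : independent_noise P N B.
Hypothesis B_moments : bounded_moments P N B p.
Implicit Types (u us : control R Omega m) (w : Omega) (k : nat).

(** The sample space with the events known at time k, so that adaptedness is
    ordinary measurability and inherits its closure properties. *)
Definition past k : Type := g_sigma_algebraType
  (\bigcup_(j in [set j | (1 <= j <= k)%N]) sigma_of (B j)).
HB.instance Definition _ k := Measurable.on (past k).

Definition adapted k (X : Omega -> R) := measurable_fun [set: past k] X.

Lemma adapted_filtration k X A : adapted k X -> measurable A ->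
  filtration B k (X @^-1` A).
Proof. by move=> mX mA; have := mX measurableT A mA; rewrite setTI. Qed.

Lemma filtration_adapted k X :
  (forall A, measurable A -> filtration B k (X @^-1` A)) -> adapted k X.
Proof. by move=> mX _ A mA; rewrite setTI; exact: mX. Qed.

Lemma filtration_nondecr k k' : (k <= k')%N -> filtration B k `<=` filtration B k'.
Proof.
move=> kk'; apply: sub_sigma_algebra2 => A [j /andP[j1 jk] BA].
by exists j => //=; rewrite j1 (leq_trans jk).
Qed.

Lemma adapted_le k k' X : (k <= k')%N -> adapted k X -> adapted k' X.
Proof.
move=> kk' mX; apply: filtration_adapted => A mA.
by apply: (filtration_nondecr kk'); exact: adapted_filtration.
Qed.

Lemma adapted_measurable k X : (k <= N)%N -> adapted k X ->
  measurable_fun setT X.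
Proof.
move=> kN mX _ A mA; rewrite setTI; apply: (filtration_measurable B_random kN).
exact: adapted_filtration.
Qed.

Lemma adapted_noise k : adapted k.+1 (fun w => noise_weight (B k.+1 w)).
Proof.
apply: (measurable_noise_weight (T := past k.+1) (beta := B k.+1)).
apply/(measurable_entriesP (T := past k.+1) (B k.+1)).
by move=> A BA; apply: sub_sigma_algebra; exists k.+1 => //=.
Qed.

Lemma borel_noise_weight A : measurable A ->
  borel_sets ((fun b : 'cV[R]_d => noise_weight b) @^-1` A).
Proof.
move=> mA; pose T := g_sigma_algebraType (@open 'cV[R]_d).
have mid : measurable_entries (fun b : T => b : 'cV[R]_d).
  apply/measurable_entriesP => C [C' bC' <-]; rewrite setTI; exact: bC'.
by have := measurable_noise_weight mid measurableT mA; rewrite setTI.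
Qed.

Lemma noise_L2 k : (k < N)%N ->
  L2 P (fun w => noise_weight (B k.+1 w)).
Proof.
move=> kN; have k1N : (1 <= k.+1 <= N)%N by [].
have mB : measurable_entries (B k.+1) by apply/measurable_entriesP; exact: B_random.
have [C CP] := B_moments.
have sB : L2 P (fun w => enorm (B k.+1 w)).
  apply: (L2_powR p_ge2) => [|w|]; first exact: measurable_enorm.
    exact: enorm_ge0.
  have mpow : measurable_fun setT (fun w => enorm (B k.+1 w) `^ p).
    exact: (measurableT_comp (measurable_powR p) (measurable_enorm mB)).
  apply/integrableP; split; first exact/measurable_EFinP.
  apply: (@le_lt_trans _ _ C%:E); last by rewrite ltry.
  apply: le_trans (CP _ k1N); rewrite expectation.unlock.
  rewrite le_eqVlt; apply/orP; left; apply/eqP.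
  by apply: eq_integral => w _ /=; rewrite ger0_norm// powR_ge0.
apply: (le_L2 (Y := fun w => 1 + d%:R * enorm (B k.+1 w))).
- exact: measurable_noise_weight.
- move=> w; rewrite ger0_norm ?noise_weight_ge0// lerD2l.
  apply: le_trans (ler_sum _ (fun i _ => ler_entry_enorm (B k.+1 w) i 0)) _.
  by rewrite sumr_const card_ord mulr_natl.
- by apply: L2D; [exact: L2_cst|exact: L2Z].
Qed.

Lemma adapted_noise_indep k X : (k < N)%N -> adapted k X ->
  forall A C, measurable A -> measurable C ->
  (P (X @^-1` A `&` (fun w => noise_weight (B k.+1 w)) @^-1` C) =
   P (X @^-1` A) * P ((fun w => noise_weight (B k.+1 w)) @^-1` C))%E.
Proof.
move=> kN aX A C mA mC.
exact: (filtration_indep B_random B_indep kN (adapted_filtration aX mA)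
  (borel_noise_weight mC)).
Qed.

(** Adaptedness is carried through the induction together with square
    integrability, because it makes the bound at time k independent of the
    noise of the next step. *)
Lemma dominator_L2 c0 (h : Omega -> nat -> R) :
  0 <= c0 -> (forall w k, 0 <= h w k) ->
  (forall k, (k < N)%N -> adapted k (h^~ k)) ->
  (forall k, (k < N)%N -> L2 P (h^~ k)) ->
  forall k, (k <= N)%N ->
    adapted k (fun w => dominator L c0 (noise B w) (h w) k) /\
    L2 P (fun w => dominator L c0 (noise B w) (h w) k).
Proof.
move=> c00 h0 ah sh; elim=> [_|k ih kN].
  by split; [exact: measurable_cst|exact: L2_cst].
have [adom sdom] := ih (ltnW kN).
pose X w := dominator L c0 (noise B w) (h w) k + h w k.
have aX : adapted k X by apply: measurable_funD => //; exact: ah.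
have sX : L2 P X by apply: L2D => //; exact: sh.
have X0 w : 0 <= X w.
  by rewrite addr_ge0// dominator_ge0// => j; exact: noise_weight_ge0.
have sXY := L2M_independent sX (noise_L2 kN) X0
  (fun w => noise_weight_ge0 (B k.+1 w)) (adapted_noise_indep kN aX).
have domE : (fun w => dominator L c0 (noise B w) (h w) k.+1) =
    (fun w => L * (X w * noise_weight (B k.+1 w))).
  by apply/funext => w /=; rewrite -mulrA (mulrC (X w)).
rewrite domE; split; last exact: L2Z.
apply: measurable_funM => //; apply: measurable_funM; last exact: adapted_noise.
exact: adapted_le (leqnSn k) aX.
Qed.

Lemma admissible_entries u k : admissible P N B U q u -> (k < N)%N ->
  measurable_entries (fun w : past k => u k w).
Proof.
move=> [au _ _] kN; apply/(measurable_entriesP (T := past k) (u k)).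
exact: au.
Qed.

Lemma admissible_measurable u : admissible P N B U q u -> measurable_control N u.
Proof.
move=> au k kN i j; apply: (@adapted_measurable k); first exact: ltnW.
exact: (admissible_entries au kN i j).
Qed.

Lemma admissible_takes_values u : admissible P N B U q u -> takes_values N U u.
Proof. by move=> [_ uU _] k w; exact: uU. Qed.

Lemma admissible_L2 u k : admissible P N B U q u -> (k < N)%N ->
  L2 P (fun w => enorm (u k w)).
Proof.
move=> au kN; have [_ _ uq] := au.
have mu j : (j < N)%N -> measurable_fun setT (fun w => enorm (u j w)).
  by move=> jN; apply: measurable_enorm; exact: admissible_measurable.
have mpow j : (j < N)%N -> measurable_fun setT (fun w => enorm (u j w) `^ q).
  by move=> jN; exact: (measurableT_comp (measurable_powR q) (mu j jN)).
apply: (L2_powR (ltW q_gt2)) => [|w|].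
- exact: mu.
- exact: enorm_ge0.
- apply: (le_L1 (Y := fun w => \sum_(0 <= j < N) enorm (u j w) `^ q)).
  + exact: mpow.
  + move=> w; rewrite ger0_norm ?powR_ge0//.
    rewrite (bigD1_seq k) ?mem_index_iota ?iota_uniq//= lerDl.
    by apply: sumr_ge0 => j _; exact: powR_ge0.
  + apply/integrableP; split.
      by apply/measurable_EFinP; exact: measurable_sum_nat.
    apply: le_lt_trans uq; rewrite expectation.unlock.
    rewrite le_eqVlt; apply/orP; left; apply/eqP.
    apply: eq_integral => w _ /=; rewrite ger0_norm//.
    by apply: sumr_ge0 => j _; exact: powR_ge0.
Qed.

(** The norm of a convex combination is at most the larger of the two norms,
    so its power q is at most the sum of their powers. *)
Lemma perturbed_admissible us u e : (forall k, (k < N)%N -> convex_set (U k)) ->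
  admissible P N B U q us -> admissible P N B U q u -> 0 <= e <= 1 ->
  admissible P N B U q (perturbed us u e).
Proof.
move=> U_convex aus au e01.
have pE k : (k < N)%N ->
    measurable_entries (fun w : past k => perturbed us u e k w).
  move=> kN; apply: measurable_entriesD; first exact: admissible_entries.
  apply: measurable_entriesZ; first exact: measurable_cst.
  by apply: measurable_entriesB; exact: admissible_entries.
have [_ usU usq] := aus; have [_ uU uq] := au.
have peU := perturbed_takes_values U_convex (admissible_takes_values aus)
  (admissible_takes_values au) e01.
have mp k : (k < N)%N -> measurable_fun setT (fun w => enorm (perturbed us u e k w)).
  move=> kN; apply: measurable_enorm => i j.
  apply: (@adapted_measurable k); first exact: ltnW.
  exact: pE.
split => //.
  move=> k kN; apply/(measurable_entriesP (T := past k) (perturbed us u e k)).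
  exact: pE.
have msum v : admissible P N B U q v ->
    measurable_fun setT (fun w => \sum_(0 <= k < N) enorm (v k w) `^ q).
  move=> av; apply: measurable_sum_nat => k kN.
  apply: (measurableT_comp (measurable_powR q)).
  by apply: measurable_enorm; exact: admissible_measurable.
rewrite expectation.unlock in usq uq *.
apply: le_lt_trans (lte_add_pinfty usq uq).
rewrite -ge0_integralD//; last 4 first.
- by move=> w _; rewrite lee_fin; apply: sumr_ge0 => k _; exact: powR_ge0.
- by apply/measurable_EFinP; exact: msum.
- by move=> w _; rewrite lee_fin; apply: sumr_ge0 => k _; exact: powR_ge0.
- by apply/measurable_EFinP; exact: msum.
apply: ge0_le_integral => //.
- by move=> w _; rewrite lee_fin; apply: sumr_ge0 => k _; exact: powR_ge0.
- apply/measurable_EFinP; apply: measurable_sum_nat => k kN.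
  exact: (measurableT_comp (measurable_powR q) (mp k kN)).
- by apply/measurable_EFinP; apply: measurable_funD; exact: msum.
move=> w _; rewrite -EFinD lee_fin -big_split /=; apply: ler_sum => k _.
have q0 : 0 <= q by rewrite ltW// (lt_trans _ q_gt2).
have [le_us|/ltW le_u] := leP (enorm (u k w)) (enorm (us k w)).
  apply: (@le_trans _ _ (enorm (us k w) `^ q)); last by rewrite lerDl powR_ge0.
  by apply: ge0_ler_powR; rewrite ?nnegrE ?enorm_ge0//; exact: enorm_segment.
apply: (@le_trans _ _ (enorm (u k w) `^ q)); last by rewrite lerDr powR_ge0.
by apply: ge0_ler_powR; rewrite ?nnegrE ?enorm_ge0//; exact: enorm_segment.
Qed.

End domination.

(** * Expected costs as functions of the parameter *)

Section limits_of_means.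
Context {R : realType} {disp : measure_display} {Omega : measurableType disp}.
Variable P : probability Omega R.

Lemma dominated_vanishing (F_ : nat -> Omega -> R) (F H : Omega -> R) :
  (forall i, measurable_fun setT (F_ i)) -> measurable_fun setT F ->
  (forall w, vanishing (fun i => `|F_ i w - F w|)) ->
  L1 P H -> (forall i w, `|F_ i w| <= H w) ->
  vanishing (fun i => `|\int[P]_w F_ i w - \int[P]_w F w|).
Proof.
move=> mF_ mF FF LH FH.
have cF w : F_ ^~ w @ \oo --> F w.
  by apply/subr_cvg0; apply/vanishing_abs; exact: FF.
have [iF _ cv] : [/\ P.-integrable setT (EFin \o F),
    (\int[P]_w `|(EFin \o F_ i) w - (EFin \o F) w| @[i --> \oo] --> 0)%E &
    (\int[P]_w (EFin \o F_ i) w @[i --> \oo] --> \int[P]_w (EFin \o F) w)%E].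
  apply: (@dominated_convergence _ _ _ P setT measurableT _ _ (EFin \o H)) => //.
  - by move=> i; exact/measurable_EFinP.
  - exact/measurable_EFinP.
  - by apply: aeW => w _; apply: cvg_EFin; [exact: nearW|exact: cF].
  - by apply: aeW => w i _ /=; rewrite lee_fin.
apply/vanishing_abs/subr_cvg0; apply: fine_cvg.
by rewrite /Rintegral fineK//; exact: integrable_fin_num.
Qed.

Lemma continuous_mdist (Gam : pmetricType R) (h : Gam -> R) :
  (forall gs g, vanishing (fun i => mdist (gs i) g) ->
     vanishing (fun i => `|h (gs i) - h g|)) -> continuous h.
Proof.
move=> seqh g; apply/cvgrPdist_lt => e e0; apply: contrapT => nh.
have far i : exists g' : Gam, mdist g' g < i.+1%:R^-1 /\ e <= `|h g' - h g|.
  apply: contrapT => nex; apply: nh.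
  have i0 : 0 < i.+1%:R^-1 :> R by rewrite invr_gt0.
  have := nbhsx_ballx g (i.+1%:R^-1) i0; apply: filterS => g'.
  rewrite ballEmdist /= => gg'; rewrite ltNge; apply/negP => he; apply: nex.
  exists g'; split; last by rewrite distrC.
  have := @ball_sym _ _ g g' i.+1%:R^-1; rewrite !ballEmdist /=; exact.
have [gs gsP] := choice far.
have gv : vanishing (fun i => mdist (gs i) g).
  apply: (vanishing_le (h := harmonic)) => [i|i|]; first exact: mdist_ge0.
    exact: ltW (gsP i).1.
  exact: cvg_harmonic.
have /cvgrPdist_lt/(_ e e0)[k _ kP] := seqh gs g gv.
have := kP k (leqnn k); rewrite /= sub0r normrN normr_id ltNge.
by rewrite (gsP k).2.
Qed.

End limits_of_means.

Section mean_costs.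
Context {R : realType} {disp : measure_display} {Omega : measurableType disp}.
Context (P : probability Omega R) {Gam : pmetricType R} {n m d : nat} (N : nat).
Context (B : nat -> Omega -> 'cV[R]_d) (U : nat -> set 'cV[R]_m).
Context (c : coefs R Gam n m d) (a : nat -> 'cV[R]_m) (x0 : 'cV[R]_n).
Context (p q L M : R) (psi : R -> R).
Hypothesis p_ge2 : 2 <= p.
Hypothesis q_gt2 : 2 < q.
Hypothesis L_ge0 : 0 <= L.
Hypothesis B_random : random_noise N B.
Hypothesis B_indep : independent_noise P N B.
Hypothesis B_moments : bounded_moments P N B p.
Hypothesis U_convex : forall k, (k < N)%N -> convex_set (U k).
Hypothesis a_ref : ref_control N U a.
Hypothesis h1 : H1 N U c a L.
Hypothesis h2 : H2 N U c a L.
Hypothesis phi_le : forall g, `|cphi c g 0| <= M.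
Hypothesis psi_modulus : modulus psi.
Hypothesis psi_coefs : coefs_modulus N U c psi.
Let psi_coef := psi_coefs.1.
Let psi_phi := psi_coefs.2.
Hypothesis h4 : H4 N U c (@mdist R Gam).

Let mB k : (1 <= k <= N)%N -> measurable_entries (B k).
Proof. by move=> kN; apply/measurable_entriesP; exact: B_random. Qed.

Variables (us u : control R Omega m).
Hypothesis us_adm : admissible P N B U q us.
Hypothesis u_adm : admissible P N B U q u.

Let usU : takes_values N U us. Proof. exact: (admissible_takes_values us_adm). Qed.
Let uU : takes_values N U u. Proof. exact: (admissible_takes_values u_adm). Qed.
Let mus : measurable_control N us.
Proof. exact: (admissible_measurable B_random us_adm). Qed.
Let mu : measurable_control N u.
Proof. exact: (admissible_measurable B_random u_adm). Qed.

Let usL2 k : (k < N)%N -> L2 P (fun w => enorm (us k w)).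
Proof. exact: (admissible_L2 q_gt2 B_random us_adm). Qed.

Lemma state_bound_L2 k : (k <= N)%N ->
  L2 P (fun w => state_bound B a x0 L us w k).
Proof.
move=> kN; apply: (dominator_L2 p_ge2 L_ge0 B_random B_indep B_moments
  (h := fun w k => 1 + enorm (a k) + enorm (us k w)) _ _ _ _ kN).2.
- exact: enorm_ge0.
- by move=> w j; rewrite !addr_ge0 ?enorm_ge0.
- move=> j jN; apply: measurable_funD; first exact: measurable_cst.
  exact: (measurable_enorm (admissible_entries us_adm jN)).
- move=> j jN; apply: L2D; first exact: L2_cst.
  exact: usL2.
Qed.

Lemma direction_L2 k : (k < N)%N -> L2 P (fun w => enorm (u k w - us k w)).
Proof.
move=> kN; apply: (le_L2 (Y := fun w => enorm (u k w) + enorm (us k w))).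
- by apply: measurable_enorm; apply: measurable_entriesB; [exact: mu|exact: mus].
- by move=> w; rewrite ger0_norm ?enorm_ge0// ler_enormB.
- by apply: L2D; [exact: admissible_L2 u_adm kN|exact: usL2].
Qed.

Lemma variation_bound_L2 k : (k <= N)%N ->
  L2 P (fun w => variation_bound B L us u w k).
Proof.
move=> kN; apply: (dominator_L2 p_ge2 L_ge0 B_random B_indep B_moments
  (h := fun w k => enorm (u k w - us k w)) _ _ _ _ kN).2.
- exact: lexx.
- by move=> w j; rewrite enorm_ge0.
- move=> j jN; apply: (measurable_enorm (T := past B j)).
  apply: measurable_entriesB; first exact: (admissible_entries u_adm jN).
  exact: (admissible_entries us_adm jN).
- by move=> j jN; exact: direction_L2.
Qed.

Lemma increment_bound_L2 k : (k < N)%N ->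
  L2 P (fun w => increment_bound B L us u w k).
Proof.
by move=> kN; apply: L2D; [exact/variation_bound_L2/ltnW|exact: direction_L2].
Qed.

Lemma cost_bound_L1 : L1 P (cost_bound N B a x0 L M us).
Proof.
have sq (X : Omega -> R) : L2 P X -> L1 P (fun w => L * X w ^+ 2).
  by move=> [_ ?]; exact: L1Z.
apply: L1D; last first.
  apply: L1D; first exact: L1_cst.
  apply: (sq (fun w => 1 + _)); apply: L2D; first exact: L2_cst.
  exact: state_bound_L2.
apply: L1_sum_nat => k kN; apply: L1D; first exact: L1_cst.
apply: (sq (fun w => 1 + _ + _)); apply: L2D.
  by apply: L2D; [exact: L2_cst|exact/state_bound_L2/ltnW].
by apply: L2D; [exact: L2_cst|exact: usL2].
Qed.

Let gradient_bound_L2 k : (k < N)%N ->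
  L2 P (fun w => L * (1 + state_bound B a x0 L us w k + enorm (us k w))).
Proof.
move=> kN; apply: L2Z; apply: L2D; last exact: usL2.
by apply: L2D; [exact: L2_cst|exact/state_bound_L2/ltnW].
Qed.

Let terminal_gradient_bound_L2 :
  L2 P (fun w => L * (1 + state_bound B a x0 L us w N)).
Proof. by apply: L2Z; apply: L2D; [exact: L2_cst|exact: state_bound_L2]. Qed.

Lemma derivative_bound_L1 : L1 P (derivative_bound N B a x0 L us u).
Proof.
apply: L1D; last by apply: L1M => //; exact: variation_bound_L2.
apply: L1_sum_nat => k kN.
by apply: L1M; [exact: gradient_bound_L2|exact: increment_bound_L2].
Qed.

(** The linear growth of psi replaces psi (e r) by psi 1 (1 + r), so that e
    disappears. *)
Definition remainder_dominator w : R :=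
  \sum_(0 <= k < N)
    (L * (1 + state_bound B a x0 L us w k + enorm (us k w))
       * (2 * variation_bound B L us u w k)
     + psi 1 * ((1 + increment_bound B L us u w k) * increment_bound B L us u w k))
  + (L * (1 + state_bound B a x0 L us w N) * (2 * variation_bound B L us u w N)
     + psi 1 * ((1 + variation_bound B L us u w N) * variation_bound B L us u w N)).

Lemma remainder_dominator_L1 : L1 P remainder_dominator.
Proof.
have quad (X : Omega -> R) : L2 P X -> L1 P (fun w => psi 1 * ((1 + X w) * X w)).
  by move=> LX; apply: L1Z; apply: L1M => //; apply: L2D => //; exact: L2_cst.
apply: L1D.
  apply: L1_sum_nat => k kN; apply: L1D.
    apply: L1M; first exact: gradient_bound_L2.
    by apply: L2Z; exact/variation_bound_L2/ltnW.
  by apply: quad; exact: increment_bound_L2.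
apply: L1D; last by apply: quad; exact: variation_bound_L2.
by apply: L1M => //; apply: L2Z; exact: variation_bound_L2.
Qed.

Lemma remainder_bound_ge0 e w : 0 <= e ->
  0 <= remainder_bound N B a x0 L psi us u e w.
Proof.
move=> e0.
have G0 k := state_bound_ge0 B a x0 L_ge0 us w k.
have Z0 k := variation_bound_ge0 B L_ge0 us u w k.
have R0 k := increment_bound_ge0 B L_ge0 us u w k.
have D0 k := defect_bound_ge0 B L_ge0 psi_modulus us u w k e0.
apply: addr_ge0.
  apply: sumr_ge0 => k _; apply: addr_ge0; rewrite mulr_ge0//.
    by rewrite mulr_ge0// !addr_ge0 ?enorm_ge0.
  by rewrite (modulus_ge0 psi_modulus)// mulr_ge0.
apply: addr_ge0; rewrite mulr_ge0//.
  by rewrite mulr_ge0// addr_ge0.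
by rewrite (modulus_ge0 psi_modulus)// mulr_ge0.
Qed.

Lemma remainder_bound_le e w : 0 <= e <= 1 ->
  remainder_bound N B a x0 L psi us u e w <= remainder_dominator w.
Proof.
move=> /andP[e0 e1].
have G0 k := state_bound_ge0 B a x0 L_ge0 us w k.
have Z0 k := variation_bound_ge0 B L_ge0 us u w k.
have R0 k := increment_bound_ge0 B L_ge0 us u w k.
have D2 k := defect_bound_le B L psi us u e w k.
have quad x : 0 <= x -> psi (e * x) * x <= psi 1 * ((1 + x) * x).
  move=> x_ge0; rewrite mulrA ler_wpM2r//.
  apply: le_trans (modulus_linear_growth psi_modulus x_ge0).
  by apply: (modulus_nondecr psi_modulus); rewrite ?mulr_ge0// ler_piMl.
apply: lerD.
  apply: ler_sum => k _; apply: lerD; last exact: quad.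
  by rewrite ler_wpM2l// mulr_ge0// !addr_ge0 ?enorm_ge0.
apply: lerD; last exact: quad.
by rewrite ler_wpM2l// mulr_ge0// addr_ge0.
Qed.

Lemma measurable_modulus_comp (X : Omega -> R) : measurable_fun setT X ->
  (forall w, 0 <= X w) -> measurable_fun setT (fun w => psi (X w)).
Proof.
move=> mX X0; have [cpsi _ _ _ _] := psi_modulus.
have mI : measurable (`[0, +oo[%classic : set R) by exact: measurable_itv.
suff : measurable_fun setT (psi \o X) by [].
apply: (measurable_comp mI) => //.
  by move=> _ [w _ <-]; rewrite /= in_itv/= X0.
exact: subspace_continuous_measurable_fun.
Qed.

Lemma measurable_remainder_bound e : 0 <= e ->
  measurable_fun setT (remainder_bound N B a x0 L psi us u e).
Proof.
move=> e0.
have mG k : (k <= N)%N -> measurable_fun setT (fun w => state_bound B a x0 L us w k).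
  by case/state_bound_L2.
have mZ k : (k <= N)%N -> measurable_fun setT (fun w => variation_bound B L us u w k).
  by case/variation_bound_L2.
have mR k : (k < N)%N -> measurable_fun setT (fun w => increment_bound B L us u w k).
  by case/increment_bound_L2.
have mquad (X : Omega -> R) : measurable_fun setT X -> (forall w, 0 <= X w) ->
    measurable_fun setT (fun w => psi (e * X w) * X w).
  move=> mX X0; apply: measurable_funM => //.
  apply: measurable_modulus_comp => [|w]; last by rewrite mulr_ge0.
  exact: measurable_funM.
have mD k : (k <= N)%N ->
    measurable_fun setT (fun w => defect_bound B L psi us u e w k).
  elim: k => [_|k ih kN]; first exact: measurable_cst.
  under eq_fun do rewrite defect_boundS.
  apply: measurable_minr.
    by apply: measurable_funM; [exact: measurable_cst|exact: mZ].
  apply: measurable_funM; first by apply: measurable_noise_weight; exact: mB.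
  apply: measurable_funD.
    by apply: measurable_funM; [exact: measurable_cst|exact/ih/ltnW].
  by apply: mquad => [|w]; [exact: mR|exact: increment_bound_ge0].
apply: measurable_funD.
  apply: measurable_sum_nat => k kN; apply: measurable_funD.
    apply: measurable_funM; last exact/mD/ltnW.
    by case: (gradient_bound_L2 kN).
  by apply: mquad => [|w]; [exact: mR|exact: increment_bound_ge0].
apply: measurable_funD.
  by apply: measurable_funM; [case: terminal_gradient_bound_L2|exact: mD].
by apply: mquad => [|w]; [exact: mZ|exact: variation_bound_ge0].
Qed.

Lemma cost_L1 g : L1 P (cost N B c x0 us g).
Proof.
apply: le_L1 cost_bound_L1; last first.
  by move=> w; exact: (cost_le B x0 L_ge0 U_convex a_ref h1 h2 _ w phi_le usU).
exact: (measurable_cost x0 h1 h2 mB g usU mus).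
Qed.

Lemma cost_derivative_L1 g : L1 P (cost_derivative N B c x0 us u g).
Proof.
apply: le_L1 derivative_bound_L1; last first.
  by move=> w; exact: (cost_derivative_le B x0 L_ge0 U_convex a_ref h1 h2 u _ w usU).
exact: (measurable_cost_derivative x0 h1 psi_modulus psi_coefs mB g usU mus mu).
Qed.

Definition mean_cost g : R := \int[P]_w cost N B c x0 us g w.
Definition mean_derivative g : R := \int[P]_w cost_derivative N B c x0 us u g w.

Lemma y0E g : y0 P N B c x0 us g = (mean_cost g)%:E.
Proof.
rewrite /mean_cost /Rintegral fineK; last exact: integrable_fin_num (cost_L1 g).
by rewrite /y0 expectation.unlock.
Qed.

Lemma ybar0E g : ybar0 P N B c x0 us u g = (mean_derivative g)%:E.
Proof.
rewrite /mean_derivative /Rintegral fineK; last first.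
  exact: integrable_fin_num (cost_derivative_L1 g).
by rewrite /ybar0 expectation.unlock.
Qed.

Lemma mean_le (X Y : Omega -> R) : L1 P X -> L1 P Y ->
  (forall w, `|X w| <= Y w) -> `|\int[P]_w X w| <= \int[P]_w Y w.
Proof.
move=> LX LY XY; apply: le_trans (le_normr_Rintegral _ _) _ => //.
apply: le_Rintegral => //.
apply: le_L1 LY => [|w]; last by rewrite normr_id.
exact: measurableT_comp (L1_measurable LX).
Qed.

Lemma mean_cost_le g : `|mean_cost g| <= \int[P]_w cost_bound N B a x0 L M us w.
Proof.
apply: mean_le => [||w]; [exact: cost_L1|exact: cost_bound_L1|].
exact: (cost_le B x0 L_ge0 U_convex a_ref h1 h2 _ w phi_le usU).
Qed.

Lemma mean_derivative_le g :
  `|mean_derivative g| <= \int[P]_w derivative_bound N B a x0 L us u w.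
Proof.
apply: mean_le => [||w]; [exact: cost_derivative_L1|exact: derivative_bound_L1|].
exact: (cost_derivative_le B x0 L_ge0 U_convex a_ref h1 h2 u _ w usU).
Qed.

Lemma mean_cost_continuous : continuous mean_cost.
Proof.
apply: continuous_mdist => gs g gsg.
apply: (dominated_vanishing (H := cost_bound N B a x0 L M us)).
- by move=> i; exact: L1_measurable (cost_L1 (gs i)).
- exact: L1_measurable (cost_L1 g).
- by move=> w; exact: (cost_cvg B x0 L_ge0 U_convex a_ref h1 h2 h4 gsg w usU).
- exact: cost_bound_L1.
- by move=> i w; exact: (cost_le B x0 L_ge0 U_convex a_ref h1 h2 _ w phi_le usU).
Qed.

Lemma mean_derivative_continuous : continuous mean_derivative.
Proof.
apply: continuous_mdist => gs g gsg.
apply: (dominated_vanishing (H := derivative_bound N B a x0 L us u)).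
- by move=> i; exact: L1_measurable (cost_derivative_L1 (gs i)).
- exact: L1_measurable (cost_derivative_L1 g).
- move=> w; exact: (cost_derivative_cvg B x0 L_ge0 U_convex a_ref h1 h2
    psi_modulus psi_coefs h4 gsg u w usU).
- exact: derivative_bound_L1.
- by move=> i w; exact: (cost_derivative_le B x0 L_ge0 U_convex a_ref h1 h2 u _ w usU).
Qed.

Definition mean_remainder e : R :=
  \int[P]_w remainder_bound N B a x0 L psi us u e w.

Lemma mean_remainder_cvg (e_ : nat -> R) : (forall i, 0 <= e_ i <= 1) ->
  vanishing e_ -> vanishing (mean_remainder \o e_).
Proof.
move=> e01 ev; have e0 i : 0 <= e_ i by case/andP: (e01 i).
have : vanishing (fun i => `|mean_remainder (e_ i) - \int[P]_w (cst 0 : Omega -> R) w|).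
  apply: (dominated_vanishing (H := remainder_dominator)).
  - by move=> i; exact: measurable_remainder_bound.
  - exact: measurable_cst.
  - move=> w; apply/vanishing_abs; under eq_fun do rewrite subr0.
    exact: remainder_bound_cvg.
  - exact: remainder_dominator_L1.
  - move=> i w; rewrite ger0_norm; first exact: remainder_bound_le.
    exact: remainder_bound_ge0.
rewrite Rintegral_cst// mul0r; under eq_fun do rewrite subr0.
by move/vanishing_abs.
Qed.

End mean_costs.

(** * First-order expansion of the expected cost *)

Section expansion_of_means.
Context {R : realType} {disp : measure_display} {Omega : measurableType disp}.
Context (P : probability Omega R) {Gam : pmetricType R} {n m d : nat} (N : nat).
Context (B : nat -> Omega -> 'cV[R]_d) (U : nat -> set 'cV[R]_m).
Context (c : coefs R Gam n m d) (a : nat -> 'cV[R]_m) (x0 : 'cV[R]_n).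
Context (p q L M : R) (psi : R -> R).
Hypothesis p_ge2 : 2 <= p.
Hypothesis q_gt2 : 2 < q.
Hypothesis L_ge0 : 0 <= L.
Hypothesis B_random : random_noise N B.
Hypothesis B_indep : independent_noise P N B.
Hypothesis B_moments : bounded_moments P N B p.
Hypothesis U_convex : forall k, (k < N)%N -> convex_set (U k).
Hypothesis a_ref : ref_control N U a.
Hypothesis h1 : H1 N U c a L.
Hypothesis h2 : H2 N U c a L.
Hypothesis phi_le : forall g, `|cphi c g 0| <= M.
Hypothesis psi_modulus : modulus psi.
Hypothesis psi_coefs : coefs_modulus N U c psi.
Let psi_coef := psi_coefs.1.
Let psi_phi := psi_coefs.2.

Lemma xbar_mix us (u v : control R Omega m) t g k w :
  xbar B c x0 us (perturbed v u t) g k w =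
  t *: xbar B c x0 us u g k w + (1 - t) *: xbar B c x0 us v g k w.
Proof.
elim: k => [|k ih]; first by rewrite /= !scaler0 addr0.
rewrite !xbar_succ ih.
have -> : perturbed v u t k w - us k w =
    t *: (u k w - us k w) + (1 - t) *: (v k w - us k w).
  by rewrite /perturbed; apply/matrixP => i j; rewrite !mxE; ring.
move: (u k w - us k w) (v k w - us k w) => du dv.
by rewrite !mulmxDr -!scalemxAr !scalerDr addrACA.
Qed.

Lemma cost_derivative_mix us (u v : control R Omega m) t g w :
  cost_derivative N B c x0 us (perturbed v u t) g w =
  t * cost_derivative N B c x0 us u g w
  + (1 - t) * cost_derivative N B c x0 us v g w.
Proof.
have entry (A C : 'M[R]_1) :
    (t *: A + (1 - t) *: C) 0 0 = t * A 0 0 + (1 - t) * C 0 0 by rewrite !mxE.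
rewrite /cost_derivative !mulrDr addrACA !mulr_sumr -big_split /=.
congr (_ + _).
  apply: eq_bigr => k _; rewrite xbar_mix.
  have -> : perturbed v u t k w - us k w =
      t *: (u k w - us k w) + (1 - t) *: (v k w - us k w).
    by rewrite /perturbed; apply/matrixP => i j; rewrite !mxE; ring.
  rewrite -entry; congr (fun_of_matrix _ 0 0).
  move: (u k w - us k w) (v k w - us k w) => du dv.
  by rewrite !mulmxDr -!scalemxAr !scalerDr addrACA.
rewrite xbar_mix -entry; congr (fun_of_matrix _ 0 0).
by rewrite mulmxDr -!scalemxAr.
Qed.

Variables (us : control R Omega m).
Hypothesis us_adm : admissible P N B U q us.

Let dcost_L1 u g : admissible P N B U q u ->
  L1 P (cost_derivative N B c x0 us u g).
Proof.
move=> u_adm.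
exact: (cost_derivative_L1 x0 p_ge2 q_gt2 L_ge0 B_random B_indep B_moments
  U_convex a_ref h1 h2 psi_modulus psi_coefs us_adm u_adm g).
Qed.

Let cost_L1' u g : admissible P N B U q u -> L1 P (cost N B c x0 u g).
Proof.
move=> u_adm.
exact: (cost_L1 x0 p_ge2 q_gt2 L_ge0 B_random B_indep B_moments
  U_convex a_ref h1 h2 phi_le u_adm g).
Qed.

Lemma mean_derivative_mix u v t g :
  admissible P N B U q u -> admissible P N B U q v ->
  mean_derivative P N B c x0 us (perturbed v u t) g =
  t * mean_derivative P N B c x0 us u g
  + (1 - t) * mean_derivative P N B c x0 us v g.
Proof.
move=> u_adm v_adm; rewrite /mean_derivative.
under eq_Rintegral do rewrite cost_derivative_mix.
rewrite RintegralD//; first by rewrite !RintegralZl//; exact: dcost_L1.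
- by apply: L1Z; exact: dcost_L1.
- by apply: L1Z; exact: dcost_L1.
Qed.

(** The right-hand side does not depend on g. The expansion can therefore be
    integrated against measures that vary with e. *)
Lemma mean_cost_taylor u e g : admissible P N B U q u -> 0 <= e <= 1 ->
  `|mean_cost P N B c x0 (perturbed us u e) g - mean_cost P N B c x0 us g
    - e * mean_derivative P N B c x0 us u g|
  <= e * mean_remainder P N B a x0 L psi us u e.
Proof.
move=> u_adm e01; have /andP[e0 _] := e01.
have e_adm := perturbed_admissible q_gt2 B_random U_convex us_adm u_adm e01.
have Le := cost_L1' g e_adm; have Lu := cost_L1' g us_adm.
have Ld := L1Z e (dcost_L1 g u_adm).
have Lr : L1 P (remainder_bound N B a x0 L psi us u e).
  apply: le_L1 (remainder_dominator_L1 a x0 psi p_ge2 q_gt2 L_ge0 B_random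
    B_indep B_moments us_adm u_adm).
    exact: (measurable_remainder_bound a x0 p_ge2 q_gt2 L_ge0 B_random B_indep
      B_moments psi_modulus us_adm u_adm e0).
  move=> w; rewrite ger0_norm; first exact: remainder_bound_le.
  exact: remainder_bound_ge0.
have LB : L1 P (fun w => cost N B c x0 (perturbed us u e) g w - cost N B c x0 us g w).
  by apply: (L1D Le); under eq_fun do rewrite -mulN1r; exact: L1Z.
rewrite /mean_cost /mean_derivative /mean_remainder.
rewrite -RintegralB// -!RintegralZl//; last exact: dcost_L1.
rewrite -RintegralB//; apply: mean_le.
- by apply: (L1D LB); under eq_fun do rewrite -mulN1r; exact: L1Z.
- exact: L1Z.
move=> w; apply: (cost_taylor B x0 L_ge0 U_convex a_ref h1 h2 psi_modulus
  psi_coefs g w _ _ e01).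
  exact: admissible_takes_values us_adm.
exact: admissible_takes_values u_adm.
Qed.

End expansion_of_means.

(** * A minimax theorem of Ky Fan *)

Section continuous_functions.
Context {R : realType} {T : topologicalType}.
Implicit Types f : T -> R.

Lemma continuous_subr_cst f k : continuous f -> continuous (fun x => f x - k).
Proof. by move=> cf x; apply: cvgB; [exact: cf|exact: cvg_cst]. Qed.

Lemma closed_nonneg f : continuous f -> closed [set x | 0 <= f x].
Proof.
move=> cf; have -> : [set x | 0 <= f x] = f @^-1` [set y | 0 <= y] by [].
by apply: closed_comp => [y _|]; [exact: cf|exact: closed_ge].
Qed.

End continuous_functions.

Section fan_minimax.
Context {R : realType} {T : ptopologicalType}.

Lemma compact_common_point (I : choiceType) (phi : I -> T -> R) (C : set T) :
  compact C -> C !=set0 -> (forall i, continuous (phi i)) ->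
  (forall s : seq I, exists2 x, C x & {in s, forall i, 0 <= phi i x}) ->
  exists2 x, C x & forall i, 0 <= phi i x.
Proof.
move=> + [x0 Cx0] cphi fin; rewrite compact_In0 => cC.
have [|D _|x xP] := cC I setT (fun i => C `&` [set x | 0 <= phi i x]).
- exists (fun i => [set x | 0 <= phi i x]) => // i _.
  exact: closed_nonneg.
- have [y Cy yP] := fin (finmap.enum_fset D).
  by exists y => i iD; split => //; exact: yP.
have [[i]|noI] := pselect (exists i : I, True).
  by exists x => [|j]; [have [] := xP i Logic.I|have [] := xP j Logic.I].
by exists x0 => // i; case: noI; exists i.
Qed.

(** By compactness, approximate solutions to every precision give an exact
    one. *)
Lemma compact_two_limits (f g : T -> R) (C : set T) : compact C ->
  continuous f -> continuous g ->
  (forall e, 0 < e -> exists2 x, C x & - e <= f x /\ - e <= g x) ->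
  exists2 x, C x & 0 <= f x /\ 0 <= g x.
Proof.
move=> cC cf cg near; have [x0 Cx0 _] := near 1 ltr01.
pose F (n : nat * bool) x := n.1.+1%:R^-1 + (if n.2 then f x else g x).
have [||s|x Cx xP] := @compact_common_point (nat * bool)%type F C cC.
- by exists x0.
- move=> [n b] x; apply: cvgD; first exact: cvg_cst.
  by case: b; [exact: cf|exact: cg].
- pose n := \max_(k <- s) k.1.
  have [x Cx [xf xg]] := near n.+1%:R^-1 ltac:(by rewrite invr_gt0).
  exists x => // -[k b] ks; rewrite /F /=.
  have kn : (n.+1%:R^-1 : R) <= k.+1%:R^-1.
    rewrite lef_pV2 ?posrE// ler_nat ltnS.
    exact: (@leq_bigmax_seq _ s xpredT (fun k : nat * bool => k.1) (k, b) ks).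
  rewrite -lerBlDl sub0r; apply: (@le_trans _ _ (- n.+1%:R^-1)).
    by rewrite lerN2.
  by case: b {ks}.
have lim (y : R) : (forall n, 0 <= n.+1%:R^-1 + y) -> 0 <= y.
  move=> h; apply/ler_addgt0Pl => e e0.
  have [n _ /(_ n (leqnn n))] := near_infty_natSinv_lt (PosNum e0).
  by move=> /= ne; apply: le_trans (h n) _; rewrite lerD2r ltW.
exists x => //; split; apply: lim => n; first exact: (xP (n, true)).
exact: (xP (n, false)).
Qed.

Section choice_index.
Variables (I : choiceType) (phi : I -> T -> R).
Hypothesis phi_cont : forall i, continuous (phi i).
Hypothesis phi_mix : forall i j t, 0 <= t <= 1 ->
  exists k, forall x, phi k x = t * phi i x + (1 - t) * phi j x.

Definition convexlike (C : set T) := forall x y t, C x -> C y -> 0 <= t <= 1 ->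
  exists2 z, C z & forall i, phi i z = t * phi i x + (1 - t) * phi i y.

Lemma convexlikeI C i : convexlike C -> convexlike (C `&` [set x | 0 <= phi i x]).
Proof.
move=> cC x y t [Cx /= ix] [Cy /= iy] t01; have [z Cz zP] := cC x y t Cx Cy t01.
have /andP[t0 t1] := t01.
by exists z => //; split=> //=; rewrite zP addr_ge0// mulr_ge0// subr_ge0.
Qed.

(** The image of C under (phi i, phi j) is a convex subset of the plane. If it
    stayed at a distance e from the positive quadrant, a line through the
    corner (- e, - e) would separate it from the quadrant, and the convex
    combination of phi i and phi j that defines this line would be negative on
    the whole of C. With f and g the functions shifted by e, the slope of the
    line is the supremum of f / - g over the points at which f is nonnegative.
    *)
Lemma two_functions C i j : compact C -> convexlike C ->
  (forall k, exists2 x, C x & 0 <= phi k x) ->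
  exists2 x, C x & 0 <= phi i x /\ 0 <= phi j x.
Proof.
move=> cC cvC pos.
have [x0 Cx0 _] := pos i.
apply: (compact_two_limits cC (@phi_cont i) (@phi_cont j)) => e.
move=> e0; apply: contrapT => none.
pose f x := phi i x + e; pose g x := phi j x + e.
have sep x : C x -> f x < 0 \/ g x < 0.
  move=> Cx; have [|fx] := ltP (f x) 0; first by left.
  have [|gx] := ltP (g x) 0; first by right.
  by case: none; exists x => //; move: fx gx; rewrite /f /g; lra.
(* otherwise g would be nonnegative at the zero of f between x and y *)
have cross x y : C x -> C y -> 0 <= f x -> 0 <= g y ->
    f x * g y <= f y * g x.
  move=> Cx Cy fx gy; rewrite leNgt; apply/negP => lt.
  have gx : g x < 0 by case: (sep x Cx) => //; rewrite ltNge fx.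
  have fy : f y < 0 by case: (sep y Cy) => //; rewrite ltNge gy.
  pose t := f y / (f y - f x).
  have D0 : f y - f x < 0 by lra.
  have t01 : 0 <= t <= 1.
    apply/andP; split; first by rewrite /t mulr_le0 ?invr_le0 ?ltW.
    by rewrite /t ler_ndivrMr// mul1r; lra.
  have [z Cz zP] := cvC x y t Cx Cy t01.
  have fz : f z = 0.
    rewrite [LHS]/f zP.
    have -> : t * phi i x + (1 - t) * phi i y + e = t * f x + (1 - t) * f y.
      by rewrite /f; ring.
    by rewrite /t; field; lra.
  have gz : g z = (f y * g x - f x * g y) / (f y - f x).
    rewrite [LHS]/g zP.
    have -> : t * phi j x + (1 - t) * phi j y + e = t * g x + (1 - t) * g y.
      by rewrite /g; ring.
    by rewrite /t; field; lra.
  have gz0 : 0 <= g z.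
    by rewrite gz mulr_le0 ?invr_le0 ?ltW//; lra.
  by case: (sep z Cz); rewrite ?fz ?ltxx// ltNge gz0.
have [y Cy jy] := pos j.
have gy : 0 < g y by rewrite /g; lra.
pose S := [set r | exists x, [/\ C x, 0 <= f x & r = f x / - g x]].
have [xi Cxi ixi] := pos i.
have Sub : has_sup S.
  split; first by exists (f xi / - g xi); exists xi; split => //; rewrite /f; lra.
  exists (- f y / g y) => _ [x [Cx fx ->]].
  have gx : g x < 0 by case: (sep x Cx) => //; rewrite ltNge fx.
  rewrite ler_pdivrMr ?oppr_gt0// mulrAC ler_pdivlMr//.
  by rewrite mulrNN; exact: cross (ltW gy).
set s := sup S.
have s0 : 0 <= s.
  have gxi : g xi < 0.
    by case: (sep xi Cxi) => //; rewrite ltNge /f; lra.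
  apply: (@le_trans _ _ (f xi / - g xi)).
    by rewrite divr_ge0//; [rewrite /f; lra|rewrite oppr_ge0 ltW].
  by apply: (sup_upper_bound Sub); exists xi; split => //; rewrite /f; lra.
(* the separating line: f + s g = 0 *)
have neg x : C x -> f x + s * g x <= 0.
  move=> Cx; have [fx|fx] := leP 0 (f x).
    have gx : g x < 0 by case: (sep x Cx) => //; rewrite ltNge fx.
    have : f x / - g x <= s by apply: (sup_upper_bound Sub); exists x.
    by rewrite ler_pdivrMr ?oppr_gt0// mulrN; lra.
  have [gx|gx] := leP (g x) 0.
    by have := mulr_ge0_le0 s0 gx; lra.
  have : s <= - f x / g x.
    apply: ge_sup; first by case: Sub.
    move=> _ [x' [Cx' fx' ->]].
    have gx' : g x' < 0 by case: (sep x' Cx') => //; rewrite ltNge fx'.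
    rewrite ler_pdivrMr ?oppr_gt0// mulrAC ler_pdivlMr//.
    by rewrite mulrNN; exact: cross (ltW gx).
  by rewrite ler_pdivlMr//; lra.
have s1 : 0 < 1 + s by lra.
have [|k kP] := @phi_mix i j (1 + s)^-1.
  by rewrite invr_ge0 ltW//= invf_le1// lerDl.
have [x Cx kx] := pos k.
have : (1 + s) * phi k x = phi i x + s * phi j x.
  by rewrite kP; field; lra.
have := neg x Cx; have := mulr_ge0 (ltW s1) kx; rewrite /f /g.
have := mulr_ge0 s0 (ltW e0); lra.
Qed.

Lemma fan_minimax_choice C : compact C -> C !=set0 -> convexlike C ->
  (forall i, exists2 x, C x & 0 <= phi i x) ->
  exists2 x, C x & forall i, 0 <= phi i x.
Proof.
move=> cC C0 cvC pos; apply: compact_common_point => // s.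
elim: s C cC C0 cvC pos => [|i s ih] C cC C0 cvC pos.
  by have [x Cx] := C0; exists x.
have [||||x [Cx ix] xP] := ih (C `&` [set x | 0 <= phi i x]).
- by apply: compact_closedI => //; exact: closed_nonneg.
- by have [x Cx ix] := pos i; exists x.
- exact: convexlikeI.
- move=> j; have [x Cx [ix jx]] := two_functions i j cC cvC pos.
  by exists x.
by exists x => // j; rewrite inE => /predU1P[->//|]; exact: xP.
Qed.

End choice_index.

(** A finite subfamily is treated one function at a time: C is cut down to the
    points where phi i is nonnegative, which is again compact and convexlike,
    and two_functions says that the hypothesis on the other functions survives
    the cut. Compactness passes to the whole family. *)
Theorem fan_minimax (I : Type) (phi : I -> T -> R) (C : set T) :
  (forall i, continuous (phi i)) ->
  (forall i j t, 0 <= t <= 1 ->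
     exists k, forall x, phi k x = t * phi i x + (1 - t) * phi j x) ->
  (forall x y t, C x -> C y -> 0 <= t <= 1 ->
     exists2 z, C z & forall i, phi i z = t * phi i x + (1 - t) * phi i y) ->
  compact C -> C !=set0 -> (forall i, exists2 x, C x & 0 <= phi i x) ->
  exists2 x, C x & forall i, 0 <= phi i x.
Proof.
move=> cphi mix cvC cC C0; exact: (@fan_minimax_choice {classic I} phi cphi mix).
Qed.

End fan_minimax.

(** * Worst-case measures *)

Section weak_topology.
Context {R : realType} {Gam : pmetricType R}.
Implicit Types (l : prob Gam) (h : Gam -> R).

Lemma continuous_borel h : continuous h ->
  measurable_fun [set: borelType Gam] h.
Proof.
move=> ch; apply: (measurability _ (measurable_realfun.RGenOpens.measurableE R)).
move=> _ [_ [a [b ->] <-]]; apply: sub_sigma_algebra; rewrite setTI.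
move: (interval_open (a := BSide false a) (b := BSide true b) isT isT).
by apply: open_comp => x _; exact: ch.
Qed.

Lemma bounded_continuous_integrable l h K : continuous h ->
  (forall x, `|h x| <= K) -> l.-integrable setT (EFin \o h).
Proof.
move=> ch hK; apply: (@le_integrable _ _ _ l setT measurableT _ (EFin \o cst K)).
- by apply/measurable_EFinP; exact: continuous_borel.
- by move=> x _; rewrite /= lee_fin (le_trans (hK x))// ler_norm.
- exact: finite_measure_integrable_cst.
Qed.

Lemma integral_weakly_continuous h K : continuous h -> (forall x, `|h x| <= K) ->
  continuous (fun l : initial_topology (@integrate_Cb R Gam) =>
    (\int[(l : prob Gam)]_x h x)%R).
Proof.
move=> ch hK.
pose f : Cb Gam := exist _ h (conj ch (ex_intro _ K hK)).
have -> : (fun l : initial_topology (@integrate_Cb R Gam) =>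
    \int[(l : prob Gam)]_x h x) =
  @proj {classic Cb Gam} (fun=> R^o) f \o @integrate_Cb R Gam by [].
move=> l; apply: continuous_comp; first exact: initial_continuous.
exact: (@proj_continuous {classic Cb Gam} (fun=> R^o)).
Qed.

(** The relation between the measures passes to integrals of nonnegative
    functions, hence to h shifted by a bound. *)
Lemma integral_mixture (l l1 l2 : prob Gam) t h K : 0 <= t <= 1 ->
  (forall A, measurable A -> l A = (t%:E * l1 A + (1 - t)%:E * l2 A)%E) ->
  continuous h -> (forall x, `|h x| <= K) ->
  \int[l]_x h x = t * \int[l1]_x h x + (1 - t) * \int[l2]_x h x.
Proof.
move=> /andP[t0 t1] lE ch hK.
have t1' : 0 <= 1 - t by rewrite subr_ge0.
have K0 x : 0 <= h x + K.
  by have := hK x; rewrite ler_norml => /andP[? _]; lra.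
have ih (l' : prob Gam) : l'.-integrable setT (EFin \o h).
  exact: bounded_continuous_integrable hK.
have shiftE (l' : prob Gam) : \int[l']_x (h x + K) = \int[l']_x h x + K.
  rewrite RintegralD//; [|exact: ih|exact: finite_measure_integrable_cst].
  rewrite Rintegral_cst//; congr (_ + _).
  rewrite -[RHS]mulr1; congr (_ * _).
  exact: (congr1 fine (probability_setT l')).
have mhK : measurable_fun [set: borelType Gam] (EFin \o (fun x => h x + K)).
  by apply/measurable_EFinP; apply: measurable_funD => //; exact: continuous_borel.
suff : \int[l]_x (h x + K) = t * \int[l1]_x (h x + K) + (1 - t) * \int[l2]_x (h x + K).
  by rewrite !shiftE; lra.
have ifin (l' : prob Gam) : (\int[l']_x (h x + K)%:E \is a fin_num)%E.
  apply: integrable_fin_num => //.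
  apply: (@bounded_continuous_integrable l' (fun x => h x + K) (K + K)).
    by move=> x; apply: cvgD; [exact: ch|exact: cvg_cst].
  move=> x; rewrite ger0_norm// lerD2r.
  exact: le_trans (ler_norm _) (hK x).
rewrite /Rintegral.
rewrite (eq_measure_integral (measure_add (mscale (NngNum t0) l1)
  (mscale (NngNum t1') l2))); last first.
  move=> A mA _; apply: etrans (lE A mA) _.
  exact/esym/(measure_addE (mscale (NngNum t0) l1) (mscale (NngNum t1') l2)).
rewrite ge0_integral_measure_add//; last by move=> x _; rewrite lee_fin.
rewrite !ge0_integral_mscale//=; try by move=> x _; rewrite lee_fin.
by rewrite fineD ?fin_numM// !fineM.
Qed.

End weak_topology.

Section worst_case_optimality.
Context {R : realType} {Gam : pmetricType R} (Lam : set (prob Gam)).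
Context {Ctl : Type} (y : Ctl -> Gam -> R) (us : Ctl).

Definition worst_case u : \bar R :=
  ereal_sup [set (\int[l]_x y u x)%R%:E | l in Lam].

Context (ydot : Ctl -> Gam -> R) (rho : Ctl -> R -> R).
Hypothesis Lam_compact : weakly_compact Lam.
Hypothesis Lam_convex : convex_probs Lam.
Hypothesis Lam_nonempty : Lam !=set0.
Hypothesis y_cont : forall u, continuous (y u).
Hypothesis y_bounded : forall u, exists K, forall x, `|y u x| <= K.
Hypothesis ydot_cont : forall u, continuous (ydot u).
Hypothesis ydot_bounded : forall u, exists K, forall x, `|ydot u x| <= K.
Hypothesis ydot_mix : forall u v t, 0 <= t <= 1 ->
  exists k, forall x, ydot k x = t * ydot u x + (1 - t) * ydot v x.
Hypothesis y_expansion : forall u e, 0 <= e <= 1 -> exists v, forall x,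
  `|y v x - y us x - e * ydot u x| <= e * rho u e.
Hypothesis rho_cvg : forall u e_, (forall i, 0 <= e_ i <= 1) -> vanishing e_ ->
  vanishing (rho u \o e_).
Hypothesis us_optimal : forall u, (worst_case us <= worst_case u)%E.

Let W := initial_topology (@integrate_Cb R Gam).
Let Iy u (l : W) : R := \int[(l : prob Gam)]_x y u x.
Let Id u (l : W) : R := \int[(l : prob Gam)]_x ydot u x.

Let Iy_cont u : continuous (Iy u).
Proof. by have [K yK] := y_bounded u; exact: integral_weakly_continuous yK. Qed.

Let Id_cont u : continuous (Id u).
Proof. by have [K yK] := ydot_bounded u; exact: integral_weakly_continuous yK. Qed.

Let y_int u (l : prob Gam) : l.-integrable setT (EFin \o y u).
Proof. by have [K yK] := y_bounded u; exact: bounded_continuous_integrable yK. Qed.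

Let ydot_int u (l : prob Gam) : l.-integrable setT (EFin \o ydot u).
Proof.
by have [K yK] := ydot_bounded u; exact: bounded_continuous_integrable yK.
Qed.

Lemma Rintegral_prob_cst (l : prob Gam) (k : R) : \int[l]_x k = k.
Proof.
rewrite Rintegral_cst// -[RHS]mulr1; congr (_ * _).
exact: (congr1 fine (probability_setT l)).
Qed.

Lemma normr_Rintegral_le (l : prob Gam) (h : Gam -> R) K : continuous h ->
  (forall x, `|h x| <= K) -> `|\int[l]_x h x| <= K.
Proof.
move=> ch hK; rewrite -[leRHS](Rintegral_prob_cst l).
have ih := bounded_continuous_integrable l ch hK.
apply: le_trans (le_normr_Rintegral _ ih) _ => //.
apply: le_Rintegral => //; last exact: finite_measure_integrable_cst.
have -> : EFin \o (fun x => `|h x|) = abse \o (EFin \o h) by [].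
exact: integrable_abse.
Qed.

Lemma integral_expansion u v e r (l : prob Gam) :
  (forall x, `|y v x - y us x - e * ydot u x| <= r) ->
  `|Iy v l - Iy us l - e * Id u l| <= r.
Proof.
move=> expansion; have iyv := y_int v l; have iy0 := y_int us l.
have id0 := ydot_int u l.
have iB : l.-integrable setT (EFin \o (fun x => y v x - y us x)).
  by have := integrableB measurableT iyv iy0.
have iZ : l.-integrable setT (EFin \o (fun x => e * ydot u x)).
  exact: (L1Z (P := l) e id0).
rewrite /Iy /Id -RintegralZl// -RintegralB// -RintegralB//.
apply: normr_Rintegral_le => [x|x]; last exact: expansion.
apply: cvgB; last by apply: cvgMr; exact: ydot_cont.
by apply: cvgB; exact: y_cont.
Qed.

Let Jr : R := fine (worst_case us).

Lemma worst_caseE : worst_case us = Jr%:E.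
Proof.
have [K yK] := y_bounded us; have [l0 Ll0] := Lam_nonempty.
rewrite /Jr fineK// fin_numE; apply/andP; split; apply/eqP => JE.
  have : ((Iy us l0)%:E <= worst_case us)%E.
    by apply: ereal_sup_ubound; exists l0.
  by rewrite JE.
have : (worst_case us <= K%:E)%E.
  apply: ge_ereal_sup => _ [l _ <-]; rewrite lee_fin.
  by apply: le_trans (ler_norm _) _; exact: normr_Rintegral_le.
by rewrite JE.
Qed.

Lemma worst_case_ub l : Lam l -> Iy us l <= Jr.
Proof.
move=> Ll; rewrite -lee_fin -worst_caseE; apply: ereal_sup_ubound.
by exists l.
Qed.

(** For a small e take a measure l that maximises the cost of the perturbed
    control up to e ^ 2. Since this cost is at least the optimal value, and
    the cost of us under l is at most the optimal value, the derivative under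
    l is almost nonnegative; and l almost maximises the cost of us because the
    two costs differ by a multiple of e. Compactness of Lam turns almost into
    exactly. *)
Lemma directional_witness u :
  exists2 l : W, Lam l & 0 <= Iy us l - Jr /\ 0 <= Id u l.
Proof.
apply: (compact_two_limits (C := Lam : set W) Lam_compact).
- exact: continuous_subr_cst.
- exact: Id_cont.
move=> e e0; have [K0 dK0] := ydot_bounded u.
pose K := `|K0|.
have dK x : `|ydot u x| <= K by apply: le_trans (dK0 x) (ler_norm _).
pose e_ i : R := i.+1%:R^-1.
have e_gt0 i : 0 < e_ i by rewrite invr_gt0.
have e01 i : 0 <= e_ i <= 1 by rewrite ltW//= invf_le1// ler1n.
have ev : vanishing e_ by exact: cvg_harmonic.
have small : vanishing (fun i => e_ i + `|rho u (e_ i)|).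
  by apply: vanishingD => //; apply/vanishing_abs; exact: rho_cvg.
(* the first summand pays for the drift of the cost of us, the others for the
   derivative *)
have small2 : vanishing (fun i => K * e_ i + (e_ i + `|rho u (e_ i)|)).
  by apply: vanishingD => //; exact: vanishingZ.
have /cvgrPdist_lt/(_ e e0)[i _ /(_ i (leqnn i))] := small2.
rewrite /= sub0r normrN ger0_norm; last first.
  by rewrite !addr_ge0 ?mulr_ge0 ?normr_ge0 ?ltW.
set ei := e_ i; set ri := rho u ei => lt_e.
have ei0 : 0 < ei := e_gt0 i.
have /andP[_ ei1] : 0 <= ei <= 1 := e01 i.
have [v expansion] := y_expansion u (e01 i); rewrite -/ei -/ri in expansion.
(* an error of order ei ^ 2 remains negligible after division by ei *)
have [l Ll lP] : exists2 l, Lam l & Jr - ei ^+ 2 <= Iy v l.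
  apply: contrapT => none.
  have : (worst_case v <= (Jr - ei ^+ 2)%:E)%E.
    apply: ge_ereal_sup => _ [l Ll <-]; rewrite lee_fin leNgt; apply/negP => lt.
    by apply: none; exists l => //; exact: ltW.
  move/(le_trans (us_optimal v)); rewrite worst_caseE lee_fin.
  have ei2 : 0 < ei ^+ 2 by rewrite exprn_gt0.
  by rewrite lerBrDr gerDl leNgt ei2.
have := integral_expansion l expansion; rewrite ler_norml => /andP[lo up].
have ub := worst_case_ub Ll.
have dl : `|Id u l| <= K by exact: normr_Rintegral_le.
have ri_le := ler_norm ri; rewrite ler_norml in dl; case/andP: dl => dl1 dl2.
exists l => //; split.
  have h : ei * (Id u l) <= ei * K by rewrite ler_pM2l.
  have h2 : ei * ri <= ei * `|ri| by rewrite ler_pM2l.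
  have h3 : ei * `|ri| <= `|ri| by rewrite ler_piMl.
  have h4 : ei ^+ 2 <= ei by rewrite expr2 ler_piMl// ltW.
  lra.
have h : ei * (- ei - ri) <= ei * Id u l by lra.
rewrite ler_pM2l// in h.
have K_ge0 : 0 <= K * ei by rewrite mulr_ge0 ?normr_ge0 ?ltW.
lra.
Qed.

(** The measures that are worst for us form a compact convex set on which each
    direction has a measure with nonnegative derivative. The derivative is
    affine in the measure and in the direction, so the minimax theorem gives
    one measure that serves all directions. *)
Theorem worst_case_first_order : exists2 l : prob Gam, Lam l &
  worst_case us = (\int[l]_x y us x)%:E /\ forall u, 0 <= \int[l]_x ydot u x.
Proof.
pose C : set W := Lam `&` [set l | 0 <= Iy us l - Jr].
have cC : compact C.
  by apply: compact_closedI => //; apply: closed_nonneg; exact: continuous_subr_cst.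
have [||||l [Ll lJ] lP] := @fan_minimax _ W Ctl Id C Id_cont _ _ cC.
- move=> u v t t01; have [k kP] := ydot_mix u v t01.
  exists k => l; rewrite /Id.
  under eq_Rintegral do rewrite kP.
  have iZ s w : (l : prob Gam).-integrable setT (EFin \o (fun x => s * ydot w x)).
    exact: (L1Z (P := (l : prob Gam)) s (ydot_int w l)).
  rewrite RintegralD//.
  by rewrite !RintegralZl//; exact: ydot_int.
- move=> l1 l2 t [L1 J1] [L2 J2] t01; have [l Ll lE] := Lam_convex L1 L2 t01.
  have mixI (h : Gam -> R) K : continuous h -> (forall x, `|h x| <= K) ->
      \int[l]_x h x = t * \int[(l1 : prob Gam)]_x h x
                      + (1 - t) * \int[(l2 : prob Gam)]_x h x.
    exact: integral_mixture.
  exists l; last first.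
    by move=> u; have [K dK] := ydot_bounded u; exact: mixI dK.
  split => //; have [K yK] := y_bounded us.
  rewrite /= /Iy (mixI _ _ (@y_cont us) yK) -/(Iy us l1) -/(Iy us l2).
  move: t01 J1 J2 => /andP[t0 t1] /= J1 J2.
  have -> : t * Iy us l1 + (1 - t) * Iy us l2 - Jr =
    t * (Iy us l1 - Jr) + (1 - t) * (Iy us l2 - Jr) by ring.
  by rewrite addr_ge0// mulr_ge0// subr_ge0.
- by have [l Ll [lJ _]] := directional_witness us; exists l.
- by move=> u; have [l Ll [lJ lP]] := directional_witness u; exists l.
exists l => //; split => //.
rewrite worst_caseE; congr (_%:E); apply/eqP.
rewrite eq_le worst_case_ub// andbT.
by move: lJ; rewrite /= subr_ge0.
Qed.

End worst_case_optimality.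

Theorem theorem3p4 (R : realType)
  (disp : measure_display) (Omega : measurableType disp)
  (P : probability Omega R) (hP : measure_is_complete P)
  (Gam : pmetricType R)
  (hlc : locally_compact [set: Gam]) (hpolish : polish R Gam)
  (n m d N : nat) (hN : (0 < N)%N)
  (B : nat -> Omega -> 'cV[R]_d) (p : R) (hp : 2 <= p)
  (hB : random_noise N B)
  (hBind : independent_noise P N B) (hBp : bounded_moments P N B p)
  (U : nat -> set 'cV[R]_m)
  (hU0 : forall k, (k < N)%N -> U k !=set0)
  (hU : forall k, (k < N)%N -> convex_set (U k))
  (q : R) (hq : 2 < q)
  (Lam : set (prob Gam)) (hLam0 : Lam !=set0)
  (c : coefs R Gam n m d) (x0 : 'cV[R]_n)
  (a : nat -> 'cV[R]_m) (ha : ref_control N U a)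
  (L : R) (hL : 0 < L)
  (h1 : H1 N U c a L) (h2 : H2 N U c a L) (h3 : H3 N U c)
  (h4 : H4 N U c (@mdist R Gam)) (h5 : H5 Lam)
  (hphi0 : exists M : R, forall g, `|cphi c g 0| <= M)
  (us : control R Omega m) (hopt : optimal P N B c x0 Lam U q us) :
  exists ls : prob Gam, Lambda_opt P N B c x0 Lam us ls /\
    (0 <= ereal_inf [set \int[ls]_g ybar0 P N B c x0 us u g
                    | u in admissible P N B U q])%E.
Proof.
have L_ge0 := ltW hL.
have [us_adm us_min] := hopt.
have [psi psi_m psi_coefs] := h3.
have [M phi_le] := hphi0.
have [Lam_compact Lam_convex] := h5.
pose Ctl := {u : control R Omega m | admissible P N B U q u}.
pose y (u : Ctl) := mean_cost P N B c x0 (sval u).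
pose ydot (u : Ctl) := mean_derivative P N B c x0 us (sval u).
pose rho (u : Ctl) := mean_remainder P N B a x0 L psi us (sval u).
pose us' : Ctl := exist _ us us_adm.
have y_cont (u : Ctl) : continuous (y u).
  exact: (mean_cost_continuous hp hq L_ge0 hB hBind hBp hU ha h1 h2 phi_le h4
    (svalP u)).
have y_bounded (u : Ctl) : exists K, forall g, `|y u g| <= K.
  exists (\int[P]_w cost_bound N B a x0 L M (sval u) w).
  exact: (mean_cost_le x0 hp hq L_ge0 hB hBind hBp hU ha h1 h2 phi_le (svalP u)).
have ydot_cont (u : Ctl) : continuous (ydot u).
  exact: (mean_derivative_continuous hp hq L_ge0 hB hBind hBp hU ha h1 h2
    psi_m psi_coefs h4 us_adm (svalP u)).
have ydot_bounded (u : Ctl) : exists K, forall g, `|ydot u g| <= K.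
  exists (\int[P]_w derivative_bound N B a x0 L us (sval u) w).
  exact: (mean_derivative_le x0 hp hq L_ge0 hB hBind hBp hU ha h1 h2
    psi_m psi_coefs us_adm (svalP u)).
have integralE (l : prob Gam) (h : Gam -> R) : continuous h ->
    (exists K, forall g, `|h g| <= K) ->
    (\int[l]_g (h g)%:E = (\int[l]_g h g)%R%:E)%E.
  move=> ch [K hK]; rewrite /Rintegral fineK//; apply: integrable_fin_num => //.
  exact: bounded_continuous_integrable hK.
have costE (u : Ctl) (l : prob Gam) :
    (\int[l]_g y0 P N B c x0 (sval u) g = (\int[l]_g y u g)%R%:E)%E.
  rewrite -integralE//; apply: eq_integral => g _.
  exact: (y0E x0 hp hq L_ge0 hB hBind hBp hU ha h1 h2 phi_le (svalP u)).
have derivativeE (u : Ctl) (l : prob Gam) :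
    (\int[l]_g ybar0 P N B c x0 us (sval u) g = (\int[l]_g ydot u g)%R%:E)%E.
  rewrite -integralE//; apply: eq_integral => g _.
  exact: (ybar0E x0 hp hq L_ge0 hB hBind hBp hU ha h1 h2
    psi_m psi_coefs us_adm (svalP u)).
have JE (u : Ctl) : J P N B c x0 Lam (sval u) = worst_case Lam y u.
  by rewrite /J /worst_case; congr ereal_sup; apply: eq_imagel => l _.
have [||||l Ll [Jl dl]] := @worst_case_first_order R Gam Lam Ctl y us' ydot rho
    Lam_compact Lam_convex hLam0 y_cont y_bounded ydot_cont ydot_bounded.
- move=> u v t t01.
  have adm := perturbed_admissible hq hB hU (svalP v) (svalP u) t01.
  exists (exist _ _ adm) => g.
  exact: (mean_derivative_mix x0 hp hq L_ge0 hB hBind hBp hU ha h1 h2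
    psi_m psi_coefs us_adm t g (svalP u) (svalP v)).
- move=> u e e01; have adm := perturbed_admissible hq hB hU us_adm (svalP u) e01.
  exists (exist _ _ adm) => g.
  exact: (mean_cost_taylor x0 hp hq L_ge0 hB hBind hBp hU ha h1 h2 phi_le
    psi_m psi_coefs us_adm g (svalP u) e01).
- move=> u e_ e01 ev.
  exact: (mean_remainder_cvg a x0 hp hq L_ge0 hB hBind hBp psi_m us_adm
    (svalP u) e01 ev).
- by move=> u; rewrite -!JE; exact: us_min (svalP u).
exists l; split; first by split => //; rewrite (JE us') Jl -costE.
apply/ereal_infP => _ [u u_adm <-].
by rewrite (derivativeE (exist _ u u_adm)) lee_fin; exact: dl.
Qed.
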